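(* Let $N\ge 3$, let $1<p<\frac{M+2}{M-2}$ for some $M\in\{3,\dots,N\}$, and let $0<c<c_p$, where $c_p:=\left(\frac{p+1}{2}\right)^{\frac1{p-1}}$. Then the problem $$-\Delta v + v = |v|^{p-1}v \ \text{ in } \mathbb{R}^N_+,\qquad v = c \ \text{ on } \partial\mathbb{R}^N_+,\qquad \lim_{x_N\to\infty} v(x',x_N)=0 \ \text{ uniformly in } x'\in\mathbb{R}^{N-1},$$ admits at least $M+1$ (pairwise) geometrically distinct positive solutions.
   Context: $\mathbb{R}^N_+ := \{x\in\mathbb{R}^N : x_N>0\}$, and points are written $x=(x',x_N)$ with $x'\in\mathbb{R}^{N-1}$. A positive solution is a positive function $v\in C^2(\mathbb{R}^N_+)\cap C(\overline{\mathbb{R}^N_+})$ satisfying the equation and the boundary condition pointwise, together with the uniform decay condition as $x_N\to\infty$. The problem is invariant under translations and rotations of the variable $x'\in\mathbb{R}^{N-1}$. Two solutions are called geometrically distinct if they do not belong to the same orbit of solutions under translations and rotations in $\mathbb{R}^{N-1}$ (acting on $x'$). *)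

(* Defs.v *)
From HB Require Import structures.
From mathcomp Require Import all_boot all_order all_algebra.
From mathcomp Require Import all_classical all_reals all_analysis.

Set Implicit Arguments.
Unset Strict Implicit.
Unset Printing Implicit Defensive.

Import Order.TTheory GRing.Theory Num.Theory.
Import numFieldNormedType.Exports.

Local Open Scope classical_set_scope.
Local Open Scope ring_scope.

                                                                              
                                                                             
                                                                           
           
Notation "''RN[' R ]_ N" := 'rV[R]_(N.-1 + 1)
  (at level 8, N at level 2, format "''RN[' R ]_ N") : type_scope.

Section HalfSpace.
Variables (R : realType) (N : nat).

Definition pt (x' : 'rV[R]_(N.-1)) (t : R) : 'RN[R]_N := row_mx x' t%:M.
Definition tang (x : 'RN[R]_N) : 'rV[R]_(N.-1) := lsubmx x.
Definition height (x : 'RN[R]_N) : R := rsubmx x 0 0.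

Definition half_space : set 'RN[R]_N := [set x | 0 < height x].
Definition closed_half_space : set 'RN[R]_N := [set x | 0 <= height x].
Definition half_space_boundary : set 'RN[R]_N := [set x | height x = 0].

Definition partial (i : 'I_(N.-1 + 1)) (v : 'RN[R]_N -> R) : 'RN[R]_N -> R :=
  fun x => 'D_(delta_mx 0 i) v x.

Definition laplacian (v : 'RN[R]_N -> R) (x : 'RN[R]_N) : R :=
  \sum_i partial i (partial i v) x.

                                                                            
                                                    
Definition C1_on (U : set 'RN[R]_N) (v : 'RN[R]_N -> R) : Prop :=
  {in U, continuous v} /\
  forall i, {in U, forall x, derivable v x (delta_mx 0 i)} /\
            {in U, continuous (partial i v)}.

Definition C2_on (U : set 'RN[R]_N) (v : 'RN[R]_N -> R) : Prop :=
  C1_on U v /\ forall i, C1_on U (partial i v).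

                                                                              
                                                          
Record positive_solution (p c : R) (v : 'RN[R]_N -> R) : Prop :=
  PositiveSolution {
    solution_C2 : C2_on half_space v ;
    solution_continuous : {within closed_half_space, continuous v} ;
    solution_pos : forall x, closed_half_space x -> 0 < v x ;
    solution_eq : forall x, half_space x ->
      - laplacian v x + v x = `|v x| `^ (p - 1) * v x ;
    solution_boundary : forall x, half_space_boundary x -> v x = c ;
    solution_decay :
      {uniform, (fun (t : R) (x' : 'rV[R]_(N.-1)) => v (pt x' t)) @ +oo%R
                --> (fun=> 0 : R)}
  }.

Definition rotation (A : 'M[R]_(N.-1)) : Prop := A *m A^T = 1%:M /\ \det A = 1.

                                                                            
                                                            
Definition same_orbit (v w : 'RN[R]_N -> R) : Prop :=
  exists (A : 'M[R]_(N.-1)) (b : 'rV[R]_(N.-1)), rotation A /\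
    forall x, closed_half_space x -> w x = v (pt (tang x *m A + b) (height x)).

Definition geometrically_distinct (v w : 'RN[R]_N -> R) : Prop :=
  ~ same_orbit v w.

End HalfSpace.

Definition critical_height (R : realType) (p : R) : R :=
  ((p + 1) / 2) `^ (p - 1)^-1.

(* Main.v *)
(* Let [w] be the one-dimensional profile, [w'' = w - w^p], [w 0 = c], that
   first increases.  Since [w'] is a decaying solution of
   [y'' = (k^2 - p w^(p-1)) y] for [k = 1] which changes sign, the decaying
   solution for some larger [k = sqrt (1 + mu)] vanishes at [0].  Therefore
   solutions that are periodic in one tangential variable, with frequency
   [om] close to [sqrt mu], bifurcate from [w].  In
   [v = w + sum_k u_k (x_N) cos (k om x_1)] the modes satisfy
   [u_k'' = (1 + k^2 om^2 - p w^(p-1)) u_k - N_k u], and once the amplitude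
   [eps] of the first mode is prescribed, [om^2 - mu] is determined by the
   solvability of the resonant mode [k = 1] and the remaining unknowns by a
   contraction in a weighted sup norm.  This works for every [p > 1].

   A rigid motion of the tangential variables preserves the set of values of
   [v] on [{x_N = T}], which for a bifurcating solution is a nontrivial
   interval around [w T] as short as we please.  Choosing the amplitudes
   successively smaller gives infinitely many distinct solutions. *)

Require Import Defs.
From mathcomp Require Import all_boot all_order all_algebra.
From mathcomp Require Import all_classical all_reals all_analysis.
From mathcomp Require Import ring lra.

Set Implicit Arguments.
Unset Strict Implicit.
Unset Printing Implicit Defensive.

Import Order.TTheory GRing.Theory Num.Theory.
Import numFieldNormedType.Exports.

Local Open Scope classical_set_scope.
Local Open Scope ring_scope.

(** In the logistic variable [zeta] the linearized equation becomes hypergeometric, so its decaying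
    solutions [psi k] are explicit power series, continuous in k, with [psi k 0] close to 1 for
    large k. As [psi 1 0] is negative, there is a last sign change [k0 > 1]. Using the last one
    keeps the modes 2, 3, ... off resonance; mode 0 is off resonance because [psi 1 0] is nonzero.

    The obstacle in the nonlinear part is that the p-th power is not smooth at 0 while w tends to 0.
    The perturbation u is therefore measured relative to w: the remainder is w^p nl (u / w), and the
    weight exp (- t), comparable with w, keeps |u / w| at most 1/2 everywhere, which also gives
    positivity. Mode 0 is borderline, since its homogeneous solution decays like exp (- t) itself;
    the factor w^p, of rate p > 1, saves it.

    In k the weight is (k + 1)^-4. Such coefficients give a C^2 function of y, the cosine
    coefficients of its nonlinear image decay like k^-2, and the Green operator supplies the other
    k^-2. *)

Definition drv {R : realType} (f : R -> R) (x d : R) : Prop := is_derive x (1 : R) f d.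

(** * Calculus on the line *)

Section Calculus.
Context {R : realType}.
Implicit Types (f g h : R -> R) (x y a b c : R).

Lemma drv_eq f x a b : drv f x a -> a = b -> drv f x b.
Proof. by move=> h <-. Qed.

Lemma drv_cst x c : drv (fun=> c) x 0.
Proof. exact: is_derive_cst. Qed.

Lemma drv_id x : drv (fun t : R => t) x 1.
Proof. exact: is_derive_id. Qed.

Lemma drvD f g x a b : drv f x a -> drv g x b -> drv (fun t => f t + g t) x (a + b).
Proof. by rewrite /drv => df dg; exact: is_deriveD. Qed.

Lemma drvN f x a : drv f x a -> drv (fun t => - f t) x (- a).
Proof. by rewrite /drv => df; exact: is_deriveN. Qed.

Lemma drvB f g x a b : drv f x a -> drv g x b -> drv (fun t => f t - g t) x (a - b).
Proof. by rewrite /drv => df dg; exact: is_deriveB. Qed.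

Lemma drvM f g x a b : drv f x a -> drv g x b ->
  drv (fun t => f t * g t) x (a * g x + f x * b).
Proof.
rewrite /drv => df dg; have := is_deriveM df dg => /is_derive_eq; apply.
by rewrite /GRing.scale /= addrC mulrC.
Qed.

Lemma drvZ f x c a : drv f x a -> drv (fun t => c * f t) x (c * a).
Proof. by move=> df; apply: drv_eq (drvM (drv_cst _ _) df) _; rewrite mul0r add0r. Qed.

Lemma drv_comp f g x a b : drv f (g x) a -> drv g x b -> drv (fun t => f (g t)) x (a * b).
Proof.
rewrite /drv => df dg; have := is_derive1_comp df dg => /is_derive_eq; apply.
by rewrite /GRing.scale /= mulrC.
Qed.

Lemma drv_expR f x a : drv f x a -> drv (fun t => expR (f t)) x (expR (f x) * a).
Proof. by move=> df; apply: drv_comp df; exact: is_derive_expR. Qed.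

Lemma drv_powR f x a p : 0 < f x -> drv f x a ->
  drv (fun t => (f t) `^ p) x (p * (f x) `^ (p - 1) * a).
Proof.
by move=> fx df; apply: (@drv_comp (fun y => y `^ p)) df; exact: is_derive1_powR.
Qed.

Lemma drv_sin f x a : drv f x a -> drv (fun t => sin (f t)) x (cos (f x) * a).
Proof. by move=> df; apply: drv_comp df; exact: is_derive_sin. Qed.

Lemma drv_cos f x a : drv f x a -> drv (fun t => cos (f t)) x (- sin (f x) * a).
Proof. by move=> df; apply: drv_comp df; exact: is_derive_cos. Qed.

Lemma drv_inv f x a : f x != 0 -> drv f x a -> drv (fun t => (f t)^-1) x (- a / f x ^+ 2).
Proof.
rewrite /drv => f0 df; have := @is_deriveV R f x a 1 f0 df => /is_derive_eq; apply.
by rewrite /GRing.scale /= !mulNr mulrC.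
Qed.

Lemma drv_cont f x a : drv f x a -> {for x, continuous f}.
Proof. by move=> [df _]; apply: differentiable_continuous; exact/derivable1_diffP. Qed.

Lemma drv_continuous f (f' : R -> R) : (forall x, drv f x (f' x)) -> continuous f.
Proof. by move=> df x; exact: drv_cont (df x). Qed.

Lemma drv_near f g x a : (\near x, f x = g x) -> drv f x a -> drv g x a.
Proof. by move=> fg df; apply: near_eq_is_derive df => //; exact: oner_neq0. Qed.

Lemma mvt_itv f (f' : R -> R) a b : a <= b ->
  (forall x, a <= x <= b -> drv f x (f' x)) ->
  exists2 c, a <= c <= b & f b - f a = f' c * (b - a).
Proof.
move=> ab df; have [||c cab e] := @MVT_segment R f f' a b ab _ _.
- by move=> x; rewrite in_itv/= => /andP[/ltW ? /ltW ?]; apply: df; apply/andP.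
- apply: continuous_in_subspaceT => x; rewrite inE/= in_itv/= => xab.
  exact: drv_cont (df _ xab).
- by exists c.
Qed.

Lemma mono_itv f (f' : R -> R) a b : a <= b ->
  (forall x, a <= x <= b -> drv f x (f' x)) ->
  (forall x, a <= x <= b -> 0 <= f' x) -> f a <= f b.
Proof.
move=> ab df f0; have [c cab e] := mvt_itv ab df.
by rewrite -subr_ge0 e mulr_ge0 ?subr_ge0// f0.
Qed.

(** Both g + f and g - f are nondecreasing; this takes the place of integrating [|f'|]. *)
Lemma dominated_incr f g (f' g' : R -> R) a b : a <= b ->
  (forall x, a <= x <= b -> drv f x (f' x)) ->
  (forall x, a <= x <= b -> drv g x (g' x)) ->
  (forall x, a <= x <= b -> `|f' x| <= g' x) -> `|f b - f a| <= g b - g a.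
Proof.
move=> ab df dg fg; rewrite ler_norml; apply/andP; split.
- have := @mono_itv (fun x => f x + g x) (fun x => f' x + g' x) a b ab.
  suff h : f a + g a <= f b + g b by lra.
  apply: (@mono_itv (fun x => f x + g x) (fun x => f' x + g' x)) => // x xab.
    by apply: drvD; [exact: df|exact: dg].
  by have := fg x xab; rewrite ler_norml => /andP[]; lra.
- suff h : g a - f a <= g b - f b by lra.
  apply: (@mono_itv (fun x => g x - f x) (fun x => g' x - f' x)) => // x xab.
    by apply: drvB; [exact: dg|exact: df].
  by have := fg x xab; rewrite ler_norml => /andP[]; lra.
Qed.

Lemma lipschitz_itv f (f' : R -> R) K a b :
  (forall x, Num.min a b <= x <= Num.max a b -> drv f x (f' x)) ->
  (forall x, Num.min a b <= x <= Num.max a b -> `|f' x| <= K) ->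
  `|f b - f a| <= K * `|b - a|.
Proof.
wlog ab : a b / a <= b.
  move=> H; case/orP: (le_total a b) => [/H//|ba].
  by rewrite minC maxC distrC (distrC b); exact: H.
rewrite (min_idPl ab) (max_idPr ab) => df fK.
have [c cab ->] := mvt_itv ab df.
by rewrite normrM ler_wpM2r// fK.
Qed.

Lemma drv_0_cst f a b : (forall x, Num.min a b <= x <= Num.max a b -> drv f x 0) -> f a = f b.
Proof.
move=> df; apply/eqP; rewrite eq_sym -subr_eq0 -normr_le0.
rewrite -(mul0r `|b - a|).
by apply: (@lipschitz_itv f (fun=> 0)) => // x _; rewrite normr0.
Qed.

Lemma cont_expR f : continuous f -> continuous (fun t => expR (f t)).
Proof. by move=> cf x; apply: continuous_comp; [exact: cf|exact: continuous_expR]. Qed.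

Lemma contM f g : continuous f -> continuous g -> continuous (fun t => f t * g t).
Proof. by move=> cf cg x; apply: cvgM; [exact: cf|exact: cg]. Qed.

Lemma contD f g : continuous f -> continuous g -> continuous (fun t => f t + g t).
Proof. by move=> cf cg x; apply: cvgD; [exact: cf|exact: cg]. Qed.

Lemma contB f g : continuous f -> continuous g -> continuous (fun t => f t - g t).
Proof. by move=> cf cg x; apply: cvgB; [exact: cf|exact: cg]. Qed.

Lemma contZ f c : continuous f -> continuous (fun t => c * f t).
Proof. by move=> cf x; apply: cvgM; [exact: cvg_cst|exact: cf]. Qed.

Lemma cont_comp f g : continuous f -> continuous g -> continuous (fun t => f (g t)).
Proof. by move=> cf cg x; apply: continuous_comp; [exact: cg|exact: cf]. Qed.

Lemma cont_maxr c : continuous (fun t : R => Num.max t c).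
Proof. by move=> x; apply: continuous_max; [exact: cvg_id|exact: cvg_cst]. Qed.

End Calculus.

(** * Primitives on the whole line, based at 0 *)

Section Primitive.
Context {R : realType}.
Implicit Types (f g h : R -> R) (x y a b c t : R).

Lemma ex_primitive g : continuous g ->
  exists G : R -> R, G 0 = 0 /\ forall x, drv G x (g x).
Proof.
move=> cg.
pose I (n : R) (x : R) : R := (\int[lebesgue_measure]_(t in `[- n, x]) (g t))%R.
have dI n x : - n < x -> drv (I n) x (g x).
  move=> nx.
  have xx1 : x < x + 1 by rewrite ltrDl.
  have [] := @continuous_FTC1_closed R g (- n) x (x + 1) xx1 _ nx (cg x).
    apply: continuous_compact_integrable; first exact: segment_compact.
    exact: continuous_subspaceT.
  by move=> d e; apply: DeriveDef; [exact: d|rewrite -derive1E; exact: e].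
(* The lower limit depends on x; subtracting the value at 0 removes that dependence, as [GE]
   shows. *)
pose G x := I (`|x| + 1) x - I (`|x| + 1) 0.
have GE n x : `|x| < n -> G x = I n x - I n 0.
  move=> xn; rewrite /G; set m := `|x| + 1.
  have h : (fun y => I m y - I n y) x = (fun y => I m y - I n y) 0.
    apply: (@drv_0_cst _ (fun y => I m y - I n y)) => y /andP[y1 _].
    have ym : - m < y.
      rewrite /m; case/orP: (le_total x 0) y1 => [/[dup] x0 /min_idPl -> |x0].
        by rewrite (ler0_norm x0); lra.
      by rewrite (min_idPr x0) (ger0_norm x0); lra.
    have yn : - n < y.
      case/orP: (le_total x 0) xn y1 => [/[dup] x0 /min_idPl -> |x0].
        by rewrite (ler0_norm x0); lra.
      by rewrite (min_idPr x0) (ger0_norm x0); lra.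
    by apply: drv_eq (drvB (dI _ _ ym) (dI _ _ yn)) _; rewrite subrr.
  by move: h => /=; lra.
exists G; split; first by rewrite /G subrr.
move=> x; apply: (@drv_near _ (fun y => I (`|x| + 1) y - I (`|x| + 1) 0)).
  near=> y; rewrite (GE (`|x| + 1))//.
  have : `|y - x| < 1 by near: y; apply: cvgr_distC_lt => //; exact: cvg_id.
  by have := ler_normD (y - x) x; rewrite subrK; lra.
apply: drv_eq (drvB (dI _ _ _) (drv_cst _ _)) _; last by rewrite subr0.
by have := ler_norm (- x); rewrite normrN; lra.
Unshelve. all: by end_near.
Qed.

Definition prim g : R -> R := xget (fun=> 0) [set G | G 0 = 0 /\ forall x, drv G x (g x)].

Lemma primP g : continuous g -> prim g 0 = 0 /\ forall x, drv (prim g) x (g x).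
Proof.
move=> cg; rewrite /prim; case: xgetP => //= h; have [G GP] := ex_primitive cg.
by case: (h G).
Qed.

Lemma prim0 g : continuous g -> prim g 0 = 0. Proof. by move=> /primP[]. Qed.

Lemma drv_prim g x : continuous g -> drv (prim g) x (g x).
Proof. by move=> /primP[]. Qed.

Lemma cont_prim g : continuous g -> continuous (prim g).
Proof. by move=> cg; apply: drv_continuous => x; exact: drv_prim. Qed.

Lemma prim_uniq g G b : 0 <= b -> continuous g ->
  (forall x, 0 <= x <= b -> drv G x (g x)) -> prim g b = G b - G 0.
Proof.
move=> b0 cg dG.
have : (fun x => prim g x - G x) 0 = (fun x => prim g x - G x) b.
  apply: (@drv_0_cst _ (fun x => prim g x - G x)) => x; rewrite (min_idPl b0) (max_idPr b0) => xb.
  by apply: drv_eq (drvB (drv_prim _ cg) (dG _ xb)) _; rewrite subrr.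
by rewrite /= prim0//; lra.
Qed.

Lemma prim_dom g G (G' : R -> R) a b : a <= b -> continuous g ->
  (forall x, a <= x <= b -> drv G x (G' x)) ->
  (forall x, a <= x <= b -> `|g x| <= G' x) -> `|prim g b - prim g a| <= G b - G a.
Proof.
by move=> ab cg dG gG; apply: dominated_incr gG => // x _; exact: drv_prim.
Qed.

Lemma prim_bound g K b : 0 <= b -> continuous g ->
  (forall x, 0 <= x <= b -> `|g x| <= K) -> `|prim g b| <= K * b.
Proof.
move=> b0 cg gK.
have := @prim_dom g (fun x => K * x) (fun=> K) 0 b b0 cg _ gK.
rewrite prim0// subr0 mulr0 subr0; apply => x _.
by apply: drv_eq (drvZ _ (drv_id _)) _; rewrite mulr1.
Qed.

Lemma primB g h b : 0 <= b -> continuous g -> continuous h ->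
  prim (fun x => g x - h x) b = prim g b - prim h b.
Proof.
move=> b0 cg ch.
rewrite (@prim_uniq _ (fun x => prim g x - prim h x))//.
- by rewrite !prim0// !subr0.
- exact: contB.
- by move=> x _; apply: drvB; exact: drv_prim.
Qed.

Lemma primZ c g b : 0 <= b -> continuous g -> prim (fun x => c * g x) b = c * prim g b.
Proof.
move=> b0 cg; rewrite (@prim_uniq _ (fun x => c * prim g x))//.
- by rewrite !prim0// mulr0 subr0.
- exact: contZ.
- by move=> x _; apply: drvZ; exact: drv_prim.
Qed.

Lemma primD g h b : 0 <= b -> continuous g -> continuous h ->
  prim (fun x => g x + h x) b = prim g b + prim h b.
Proof.
move=> b0 cg ch.
rewrite (@prim_uniq _ (fun x => prim g x + prim h x))//.
- by rewrite !prim0// addr0 subr0.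
- exact: contD.
- by move=> x _; apply: drvD; exact: drv_prim.
Qed.

Lemma eq_prim g h b : 0 <= b -> continuous g -> continuous h ->
  (forall x, 0 <= x <= b -> g x = h x) -> prim g b = prim h b.
Proof.
move=> b0 cg ch gh; rewrite (@prim_uniq h (prim g))//; first by rewrite prim0// subr0.
by move=> x xb; rewrite -gh//; exact: drv_prim.
Qed.

Lemma prim_ge0 g b : 0 <= b -> continuous g ->
  (forall x, 0 <= x <= b -> 0 <= g x) -> 0 <= prim g b.
Proof.
move=> b0 cg g0; rewrite -(prim0 cg).
by apply: mono_itv g0 => // x _; exact: drv_prim.
Qed.

End Primitive.

(** * Improper integrals of exponentially decaying functions *)

Section Tail.
Context {R : realType}.
Implicit Types (f g h : R -> R) (x y a b c t : R).

Lemma le0_exp_decay d A a : 0 < a ->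
  (forall t, 0 <= t -> d <= A * expR (- (a * t))) -> d <= 0.
Proof.
move=> a0 H; rewrite leNgt; apply/negP => d0.
have A0 : 0 < A.
  by have := H 0 (lexx _); rewrite mulr0 oppr0 expR0 mulr1; exact: lt_le_trans.
(* At this time the inequality exp x >= 1 + x, with x = A / d, turns the assumed bound into d + A <=
   A. *)
have t0 : 0 <= A / (d * a) by rewrite divr_ge0 ?mulr_ge0// ltW.
have := H _ t0; rewrite expRN ler_pdivlMr ?expR_gt0//.
have -> : a * (A / (d * a)) = A / d by field; rewrite ?gt_eqF.
have := expR_ge1Dx (A / d) => h1 h2.
have : d * (1 + A / d) <= d * expR (A / d) by rewrite ler_wpM2l// ltW.
have -> : d * (1 + A / d) = d + A by field; rewrite gt_eqF.
lra.
Qed.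

Lemma drv_expN A a x : a != 0 ->
  drv (fun t => - (A / a) * expR (- (a * t))) x (A * expR (- (a * x))).
Proof.
move=> a0; apply: drv_eq.
  apply: drvZ; apply: drv_expR; apply: drvN; apply: drvZ; exact: drv_id.
by field.
Qed.

Lemma ex_improper g A a : continuous g -> 0 < a ->
  (forall t, 0 <= t -> `|g t| <= A * expR (- (a * t))) ->
  exists L, forall t, 0 <= t -> `|L - prim g t| <= A / a * expR (- (a * t)).
Proof.
move=> cg a0 gA.
have step s t : 0 <= s -> s <= t ->
    `|prim g t - prim g s| <= A / a * expR (- (a * s)) - A / a * expR (- (a * t)).
  move=> s0 st.
  have := @prim_dom _ g _ _ s t st cg (fun x _ => @drv_expN A a x (lt0r_neq0 a0)).
  by rewrite [X in _ -> _ <= X]addrC !mulNr opprK; apply => x /andP[sx _];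
    apply: gA; exact: le_trans sx.
(* By [step], the lower envelope [prim g t - A / a * expR (- (a * t))] increases and the upper one
   decreases, so the supremum of the first lies between them at every t. *)
pose S := [set prim g t - A / a * expR (- (a * t)) | t in [set t | 0 <= t]].
have ub t : 0 <= t -> ubound S (prim g t + A / a * expR (- (a * t))).
  move=> t0 _ [s /= s0 <-].
  have A0 : 0 <= A / a.
    apply: divr_ge0 (ltW a0); have := gA 0 (lexx _).
    by rewrite mulr0 oppr0 expR0 mulr1; exact: le_trans.
  have Es := mulr_ge0 A0 (expR_ge0 (- (a * s))).
  have Et := mulr_ge0 A0 (expR_ge0 (- (a * t))).
  case/orP: (le_total s t) => st; have := step _ _ _ st; move=> /(_ ltac:(done));
    rewrite ler_norml => /andP[]; lra.
exists (sup S) => t t0; rewrite ler_norml.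
have h1 : sup S <= prim g t + A / a * expR (- (a * t)).
  by apply: ge_sup; [exists (prim g 0 - A / a * expR (- (a * 0))); exists 0 => //=|exact: ub].
have h2 : prim g t - A / a * expR (- (a * t)) <= sup S.
  apply: ub_le_sup; last by exists t.
  by exists (prim g t + A / a * expR (- (a * t))); exact: ub.
lra.
Qed.

(** An exponential rate is built into convergence: it makes the limit unique and lets sums and
    estimates be handled without filters. *)
Definition is_improper g L := exists A a, 0 < a /\
  forall t, 0 <= t -> `|L - prim g t| <= A * expR (- (a * t)).

Lemma is_improper_uniq g L L' : is_improper g L -> is_improper g L' -> L = L'.
Proof.
move=> [A [a [a0 H]]] [A' [a' [a'0 H']]].
apply/eqP; rewrite -subr_eq0 -normr_le0.
have A0 : 0 <= A.
  by have := H 0 (lexx _); rewrite mulr0 oppr0 expR0 mulr1; exact: le_trans.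
have A'0 : 0 <= A'.
  by have := H' 0 (lexx _); rewrite mulr0 oppr0 expR0 mulr1; exact: le_trans.
have m0 : 0 < Num.min a a' by rewrite lt_min a0.
apply: (@le0_exp_decay _ (A + A') (Num.min a a')) => // t t0.
have e1 : A * expR (- (a * t)) <= A * expR (- (Num.min a a' * t)).
  by apply: ler_wpM2l => //; rewrite ler_expR lerN2 ler_wpM2r// ge_min lexx.
have e2 : A' * expR (- (a' * t)) <= A' * expR (- (Num.min a a' * t)).
  by apply: ler_wpM2l => //; rewrite ler_expR lerN2 ler_wpM2r// ge_min lexx orbT.
have := H t t0; have := H' t t0; rewrite !ler_norml mulrDl.
move=> /andP[? ?] /andP[? ?]; apply/andP; split; lra.
Qed.

Definition improper g : R := xget 0 [set L | is_improper g L].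
Definition tail g t : R := improper g - prim g t.

Lemma improperE g L : is_improper g L -> improper g = L.
Proof.
move=> gL; rewrite /improper; case: xgetP => [y -> /= gy|/(_ L)//].
exact: is_improper_uniq gy gL.
Qed.

Definition edec A a g := forall t, 0 <= t -> `|g t| <= A * expR (- (a * t)).

Lemma is_improperP g A a : continuous g -> 0 < a -> edec A a g -> is_improper g (improper g).
Proof.
move=> cg a0 gA; have [L HL] := ex_improper cg a0 gA.
have gL : is_improper g L by exists (A / a), a.
by rewrite (improperE gL).
Qed.

Lemma tail_bound g A a : continuous g -> 0 < a -> edec A a g -> edec (A / a) a (tail g).
Proof.
move=> cg a0 gA; have [L HL] := ex_improper cg a0 gA.
have gL : is_improper g L by exists (A / a), a.
by move=> t t0; rewrite /tail (improperE gL); exact: HL.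
Qed.

Lemma drv_tail g x : continuous g -> drv (tail g) x (- g x).
Proof.
by move=> cg; apply: drv_eq (drvB (drv_cst _ _) (drv_prim _ cg)) _; rewrite sub0r.
Qed.

Lemma tail0 g : continuous g -> tail g 0 = improper g.
Proof. by move=> cg; rewrite /tail prim0// subr0. Qed.

Lemma improperB g h : continuous g -> continuous h -> is_improper g (improper g) ->
  is_improper h (improper h) -> improper (fun x => g x - h x) = improper g - improper h.
Proof.
move=> cg ch [A [a [a0 H]]] [A' [a' [a'0 H']]]; apply: improperE.
exists (A + A'), (Num.min a a'); split; first by rewrite lt_min a0.
move=> t t0; rewrite primB//.
have A0 : 0 <= A.
  by have := H 0 (lexx _); rewrite mulr0 oppr0 expR0 mulr1; exact: le_trans.
have A'0 : 0 <= A'.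
  by have := H' 0 (lexx _); rewrite mulr0 oppr0 expR0 mulr1; exact: le_trans.
have e1 : A * expR (- (a * t)) <= A * expR (- (Num.min a a' * t)).
  by apply: ler_wpM2l => //; rewrite ler_expR lerN2 ler_wpM2r// ge_min lexx.
have e2 : A' * expR (- (a' * t)) <= A' * expR (- (Num.min a a' * t)).
  by apply: ler_wpM2l => //; rewrite ler_expR lerN2 ler_wpM2r// ge_min lexx orbT.
have := H t t0; have := H' t t0; rewrite !ler_norml mulrDl.
move=> /andP[? ?] /andP[? ?]; apply/andP; split; lra.
Qed.

Lemma improperZ c g : continuous g -> is_improper g (improper g) ->
  improper (fun x => c * g x) = c * improper g.
Proof.
move=> cg [A [a [a0 H]]]; apply: improperE; exists (`|c| * A), a; split => // t t0.
by rewrite primZ// -mulrBr normrM -mulrA ler_wpM2l// H.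
Qed.

Lemma tailB g h t : 0 <= t -> continuous g -> continuous h -> is_improper g (improper g) ->
  is_improper h (improper h) -> tail (fun x => g x - h x) t = tail g t - tail h t.
Proof. by move=> t0 cg ch tg th; rewrite /tail improperB// primB//; lra. Qed.

Lemma eq_tail g h t : 0 <= t -> continuous g -> continuous h ->
  (forall x, 0 <= x -> g x = h x) -> tail g t = tail h t.
Proof.
move=> t0 cg ch gh; rewrite /tail (@eq_prim _ g h)//; last by move=> x /andP[/gh].
suff -> : improper g = improper h by [].
rewrite /improper; congr xget; apply/seteqP; split=> L [A [a [a0 H]]];
  exists A, a; split => // s s0; have := H s s0; rewrite (@eq_prim _ g h)//; by move=> x /andP[/gh].
Qed.

Lemma improper_ge_prim g T : 0 <= T -> continuous g -> is_improper g (improper g) ->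
  (forall t, 0 <= t -> 0 <= g t) -> prim g T <= improper g.
Proof.
move=> T0 cg [A [a [a0 H]]] g0; rewrite -subr_le0.
have A0 : 0 <= A.
  by have := H 0 (lexx _); rewrite mulr0 oppr0 expR0 mulr1; exact: le_trans.
apply: (@le0_exp_decay _ A a) => // t t0.
have : prim g T <= prim g (t + T).
  apply: (@mono_itv _ _ g); first by lra.
  - by move=> x _; exact: drv_prim.
  - by move=> x /andP[Tx _]; apply: g0; exact: le_trans Tx.
have := H (t + T) (addr_ge0 t0 T0); rewrite ler_norml => /andP[h1 h2] h3.
have : expR (- (a * (t + T))) <= expR (- (a * t)).
  by rewrite ler_expR lerN2 ler_wpM2l//; lra.
move=> /(ler_wpM2l A0); lra.
Qed.

End Tail.

(** * Dominated series and a contraction principle *)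

Section Series.
Context {R : realType}.
Implicit Types (u v M : nat -> R).

Definition ssum u : R := limn (series u).

Lemma cvg_dom u M : cvgn (series M) -> (forall n, `|u n| <= M n) -> cvgn (series u).
Proof.
move=> cM uM; apply: normed_cvg; apply: series_le_cvg cM => n //=.
by apply: le_trans (uM n).
Qed.

Lemma ssum_tail u M N : cvgn (series M) -> (forall n, `|u n| <= M n) ->
  `|ssum u - series u N| <= ssum M - series M N.
Proof.
move=> cM uM; have cu := cvg_dom cM uM.
have c1 : (fun n => `|series u n - series u N|) @ \oo --> `|ssum u - series u N|.
  by apply: cvg_norm; apply: cvgB => //; exact: cvg_cst.
have c2 : (fun n => series M n - series M N) @ \oo --> ssum M - series M N.
  by apply: cvgB => //; exact: cvg_cst.
rewrite -(cvg_lim _ c1)// -(cvg_lim _ c2)//.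
apply: ler_lim; [by apply/cvg_ex; eexists; exact: c1|by apply/cvg_ex; eexists; exact: c2|].
near=> n.
have Nn : (N <= n)%N by near: n; exact: nbhs_infty_ge.
by rewrite !sub_series Nn (le_trans (ler_norm_sum _ _ _))// ler_sum.
Unshelve. all: by end_near.
Qed.

Lemma ssum_bound u M : cvgn (series M) -> (forall n, `|u n| <= M n) -> `|ssum u| <= ssum M.
Proof.
by move=> cM uM; have := ssum_tail 0 cM uM; rewrite /series/= !big_geq// !subr0.
Qed.

Lemma ssumB u v : cvgn (series u) -> cvgn (series v) ->
  ssum (fun n => u n - v n) = ssum u - ssum v.
Proof. exact: lim_seriesB. Qed.

Lemma ssumD u v : cvgn (series u) -> cvgn (series v) ->
  ssum (fun n => u n + v n) = ssum u + ssum v.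
Proof. exact: lim_seriesD. Qed.

Lemma ssumZ c u : cvgn (series u) -> ssum (fun n => c * u n) = c * ssum u.
Proof. exact: lim_seriesZ. Qed.

Lemma cvg_seriesZ c u : cvgn (series u) -> cvgn (series (fun n => c * u n)).
Proof. exact: is_cvg_seriesZ. Qed.

Lemma cvg_seriesD u v : cvgn (series u) -> cvgn (series v) ->
  cvgn (series (fun n => u n + v n)).
Proof. exact: is_cvg_seriesD. Qed.

(** Dominated convergence for series: cut where the tail of M is below e / 3, uniformly in x, and
    pass to the limit in the finite part. *)
Lemma tannery (T : Type) (F : set_system T) {FF : ProperFilter F} (f : nat -> T -> R)
    (l M : nat -> R) : cvgn (series M) ->
  (\forall x \near F, forall n, `|f n x| <= M n) ->
  (forall n, f n x @[x --> F] --> l n) ->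
  ssum (f^~ x) @[x --> F] --> ssum l.
Proof.
move=> cM fM fl.
have lM n : `|l n| <= M n.
  have c1 := cvg_norm (fl n).
  rewrite -(cvg_lim _ (c1 _))//; apply: limr_le; first exact: cvgP (c1 _).
  by apply: filterS fM => x; exact.
apply/cvgrPdist_le => e e0.
have e30 : 0 < e / 3 by lra.
have /cvgrPdist_le /(_ _ e30) [N _ HN] : series M @ \oo --> ssum M by [].
have {}HN : ssum M - series M N <= e / 3.
  by have := HN N (leqnn N); exact: le_trans (ler_norm _).
have cfin : series (f^~ x) N @[x --> F] --> series l N.
  rewrite /series/=; elim: N {HN} => [|N IH].
    by rewrite big_geq//; under eq_cvg do rewrite big_geq//; exact: cvg_cst.
  rewrite big_nat_recr//=; under eq_cvg do rewrite big_nat_recr//=.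
  by apply: cvgD => //; exact: fl.
move/cvgrPdist_le : cfin => /(_ _ e30) H.
near=> x.
have h1 := ssum_tail N cM lM.
have h2 : `|ssum (f^~ x) - series (f^~ x) N| <= ssum M - series M N.
  by apply: ssum_tail => //; near: x.
have h3 : `|series l N - series (f^~ x) N| <= e / 3 by near: x.
have -> : ssum l - ssum (f^~ x) = (ssum l - series l N) + (series l N - series (f^~ x) N)
  - (ssum (f^~ x) - series (f^~ x) N) by lra.
apply: le_trans (ler_normB _ _) _.
by have := ler_normD (ssum l - series l N) (series l N - series (f^~ x) N); lra.
Unshelve. all: by end_near.
Qed.

Lemma ex_half (K e : R) : 0 < e -> exists n, K / 2 ^+ n < e.
Proof.
move=> e0; have [K0|K0] := leP K 0.
  by exists 0%N; rewrite expr0 divr1; apply: le_lt_trans e0.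
exists (Num.Def.archi_bound (K / e)).
have := @archi_boundP _ (K / e) (divr_ge0 (ltW K0) (ltW e0)).
set n := Num.Def.archi_bound _ => h.
rewrite ltr_pdivrMr ?exprn_gt0// mulrC -ltr_pdivrMr//.
by apply: lt_trans h _; rewrite -natrX ltr_nat ltn_expl.
Qed.

Lemma le0_half (d K : R) : (forall n, d <= K / 2 ^+ n) -> d <= 0.
Proof.
move=> H; rewrite leNgt; apply/negP => d0; have [n] := ex_half K d0.
by rewrite ltNge H.
Qed.

Lemma cvg_half (K : R) : cvgn (series (fun n => K / 2 ^+ n)).
Proof.
have -> : (fun n => K / 2 ^+ n) = geometric K (2^-1).
  by apply/funext => n; rewrite /geometric/= exprVn.
by apply: is_cvg_geometric_series; rewrite ger0_norm//; lra.
Qed.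

Lemma series_half (K : R) N : series (fun n => K / 2 ^+ n) N = 2 * K - 2 * K / 2 ^+ N.
Proof.
rewrite /series/=; elim: N => [|N IH]; first by rewrite big_geq// expr0; lra.
rewrite big_nat_recr//= IH exprS.
have : (2 : R) ^+ N != 0 by rewrite expf_neq0.
by move=> h; field; rewrite h.
Qed.

Lemma ssum_half (K : R) : ssum (fun n => K / 2 ^+ n) = 2 * K.
Proof.
apply/cvg_lim => //; rewrite (_ : series _ = (fun N => 2 * K - 2 * K / 2 ^+ N)); last first.
  by apply/funext => N; rewrite series_half.
rewrite -[X in _ --> X]subr0; apply: cvgB; first exact: cvg_cst.
apply/cvgrPdist_le => e e0; have [n Hn] := ex_half (2 * `|K|) e0.
exists n => // m /= nm; rewrite sub0r normrN normrM normfV normrX.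
rewrite normrM (ger0_norm (ler0n _ 2)); apply: le_trans (ltW Hn).
by rewrite ler_wpM2l ?mulr_ge0// lef_pV2 ?posrE ?exprn_gt0// ler_weXn2l// ler1n.
Qed.

(** Banach iteration for the sup norm of a / W, done pointwise so that no complete normed space has
    to be built. With ratio 1/2 the n-th iterate is within 2 K / 2^n of the limit, and S has to be
    closed under limits at this rate. *)
Lemma weighted_contraction (T : Type) (W : T -> R) (S : set (T -> R))
    (Phi : (T -> R) -> T -> R) (a0 : T -> R) (K : R) :
  (forall x, 0 <= W x) -> 0 <= K -> S a0 -> (forall a, S a -> S (Phi a)) ->
  (forall x, `|Phi a0 x - a0 x| <= K * W x) ->
  (forall a b d, S a -> S b -> 0 <= d -> (forall x, `|a x - b x| <= d * W x) ->
    forall x, `|Phi a x - Phi b x| <= d / 2 * W x) ->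
  (forall (u : nat -> T -> R) a, (forall n, S (u n)) ->
    (forall n x, `|a x - u n x| <= 2 * K / 2 ^+ n * W x) -> S a) ->
  exists a, S a /\ Phi a = a.
Proof.
move=> W0 K0 Sa0 SPhi base contr clos.
pose u n := iter n Phi a0.
have Su n : S (u n) by elim: n => //= n; exact: SPhi.
have du n x : `|u n.+1 x - u n x| <= K / 2 ^+ n * W x.
  elim: n x => [|n IH] x; first by rewrite expr0 divr1; exact: base.
  have -> : K / 2 ^+ n.+1 = K / 2 ^+ n / 2 by rewrite exprS invfM -mulrA (mulrC (2^-1)) .
  by apply: (contr _ _ (K / 2 ^+ n)) => //; [exact: (Su n.+1)|rewrite divr_ge0// exprn_ge0].
pose a x := a0 x + ssum (fun n => u n.+1 x - u n x).
have ua n x : `|a x - u n x| <= 2 * K / 2 ^+ n * W x.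
  have dM m : `|u m.+1 x - u m x| <= K * W x / 2 ^+ m by rewrite mulrAC.
  have := ssum_tail n (@cvg_half (K * W x)) dM.
  rewrite ssum_half series_half.
  have -> : series (fun n => u n.+1 x - u n x) n = u n x - a0 x.
    by rewrite /series/= telescope_sumr.
  rewrite subKr; set s1 := ssum _ => h.
  have -> : a x - u n x = s1 - (u n x - a0 x) by rewrite /a -/s1; lra.
  by apply: le_trans h _; rewrite mulrA (mulrAC _ (W x)).
exists a; have Sa : S a by exact: clos ua.
split => //; apply/funext => x; apply/eqP; rewrite -subr_eq0 -normr_le0.
apply: (@le0_half _ (2 * K * W x)) => n.
have h1 := contr a (u n) _ Sa (Su n) _ (ua n) x.
have /h1 {}h1 : 0 <= 2 * K / 2 ^+ n by rewrite divr_ge0 ?exprn_ge0 ?mulr_ge0.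
have h2 := ua n.+1 x.
have e : 2 * K / 2 ^+ n.+1 = 2 * K / 2 ^+ n / 2.
  by rewrite exprS invfM -!mulrA (mulrC (2^-1)).
rewrite e in h2; rewrite /= in h1 h2.
have -> : 2 * K * W x / 2 ^+ n = 2 * K / 2 ^+ n / 2 * W x + 2 * K / 2 ^+ n / 2 * W x.
  by rewrite -mulrDl -splitr mulrAC.
apply: le_trans (lerD h1 h2); rewrite -[X in `|X|](subrKA (Phi (u n) x)).
apply: le_trans (ler_normD _ _) _; rewrite (distrC (Phi (u n) x)).
by rewrite lerD2l.
Qed.

Lemma continuous_half_limit (u : nat -> R -> R) (a : R -> R) (K : R) :
  (forall n, continuous (u n)) -> (forall n x, `|a x - u n x| <= K / 2 ^+ n) ->
  continuous a.
Proof.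
move=> cu ua x; apply/cvgrPdist_le => e e0.
have [n Hn] := @ex_half K (e / 3) ltac:(lra).
have /cvgrPdist_le /(_ (e / 3) ltac:(lra)) H := cu n x.
near=> y.
have h : `|u n x - u n y| <= e / 3 by near: y.
have h1 := ua n x; have h2 := ua n y.
have -> : a x - a y = (a x - u n x) + (u n x - u n y) - (a y - u n y) by lra.
apply: le_trans (ler_normB _ _) _.
by have := ler_normD (a x - u n x) (u n x - u n y); lra.
Unshelve. all: by end_near.
Qed.

End Series.

(** * Termwise differentiation and power series *)

Section Termwise.
Context {R : realType}.

Lemma drv_of_cvg (f : R -> R) x d :
  h^-1 * (f (h + x) - f x) @[h --> 0^'] --> d -> drv f x d.
Proof.
move=> H.
have e : (fun h : R => h^-1 *: ((f \o shift x) (h *: (1 : R)) - f x)) =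
         (fun h => h^-1 * (f (h + x) - f x)).
  by apply/funext => h /=; rewrite /GRing.scale/= mulr1.
apply: DeriveDef; first by rewrite /derivable e; apply/cvg_ex; exists d.
by rewrite /derive e; apply/cvg_lim.
Qed.

Lemma cvg_of_drv (f : R -> R) x d : drv f x d ->
  h^-1 * (f (h + x) - f x) @[h --> 0^'] --> d.
Proof.
move=> [df <-].
have e : (fun h : R => h^-1 *: ((f \o shift x) (h *: (1 : R)) - f x)) =
         (fun h => h^-1 * (f (h + x) - f x)).
  by apply/funext => h /=; rewrite /GRing.scale/= mulr1.
by rewrite -e.
Qed.

(** By the mean value theorem the difference quotients of the n-th term are at most [M n], so
    dominated convergence applies to them. *)
Lemma drv_ssum (f f' : nat -> R -> R) (M M0 : nat -> R) x0 r : 0 < r ->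
  cvgn (series M) -> cvgn (series M0) ->
  (forall n x, `|x - x0| < r -> drv (f n) x (f' n x)) ->
  (forall n x, `|x - x0| < r -> `|f' n x| <= M n) ->
  (forall n, `|f n x0| <= M0 n) ->
  drv (fun x => ssum (f^~ x)) x0 (ssum (f'^~ x0)).
Proof.
move=> r0 cM cM0 df f'M fM0; apply: drv_of_cvg.
have lip n h : `|h| < r -> `|f n (h + x0) - f n x0| <= M n * `|h|.
  move=> hr; rewrite -[in leRHS](addrK x0 h).
  have near x : Num.min x0 (h + x0) <= x <= Num.max x0 (h + x0) -> `|x - x0| < r.
    move: hr; rewrite ltr_norml => /andP[h1 h2].
    by case/orP: (le_total x0 (h + x0)) => [/[dup] ? /min_idPl ->|/[dup] ? /min_idPr ->];
      [rewrite max_r//|rewrite max_l//] => /andP[? ?]; rewrite ltr_norml; apply/andP; split; lra.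
  by apply: (@lipschitz_itv _ _ (f' n)) => x /near; [exact: df|exact: f'M].
have cfh h : `|h| < r -> cvgn (series (f^~ (h + x0))).
  move=> hr; apply: (@cvg_dom _ _ (fun n => M0 n + `|h| * M n)).
    by apply: cvg_seriesD => //; exact: cvg_seriesZ.
  move=> n; have := lip n h hr; have := fM0 n.
  have := ler_normD (f n x0) (f n (h + x0) - f n x0).
  by rewrite addrC subrK (mulrC `|h|); lra.
have cf0 : cvgn (series (f^~ x0)) by exact: cvg_dom fM0.
have eq : \forall h \near (0 : R)^',
   ssum (fun n => h^-1 * (f n (h + x0) - f n x0)) =
   h^-1 * (ssum (f^~ (h + x0)) - ssum (f^~ x0)).
  near=> h; have hr : `|h| < r by near: h; exact: dnbhs0_lt.
  by rewrite ssumZ ?ssumB//; [exact: cfh|apply: is_cvg_seriesB => //; exact: cfh].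
apply: (@cvg_trans _ (ssum (fun n => h^-1 * (f n (h + x0) - f n x0)) @[h --> 0^'])).
  by apply: near_eq_cvg; apply: filterS eq => h ->.
apply: (@tannery _ R _ _ (fun n h => h^-1 * (f n (h + x0) - f n x0)) _ M) => //.
- near=> h => n; have hr : `|h| < r by near: h; exact: dnbhs0_lt.
  have h0 : h != 0 by near: h; exact: nbhs_dnbhs_neq.
  by rewrite normrM normfV ler_pdivrMl ?normr_gt0// mulrC lip.
- by move=> n; apply: cvg_of_drv; apply: df; rewrite subrr normr0.
Unshelve. all: by end_near.
Qed.

Lemma cont_ssum (T : topologicalType) (f : nat -> T -> R) (M : nat -> R) x0 :
  cvgn (series M) -> (\forall x \near x0, forall n, `|f n x| <= M n) ->
  (forall n, {for x0, continuous (f n)}) -> {for x0, continuous (fun x => ssum (f^~ x))}.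
Proof. by move=> cM fM cf; exact: tannery cM fM cf. Qed.

(** Implies that the radius of convergence is at least r ([cvg_pser]), and passes to [pseries_diffs]
    at every smaller positive radius. *)
Definition bounded_coeffs (c : nat -> R) (r : R) := exists B, forall n, `|c n| * r ^+ n <= B.

Definition pser (c : nat -> R) (x : R) : R := ssum (fun n => c n * x ^+ n).

(** Each of the n copies of s^n is at most one of the terms 1, s, ..., s^(n-1) of the geometric
    series. *)
Lemma natmul_exp_le (s : R) n : 0 <= s -> s < 1 -> n%:R * s ^+ n <= (1 - s)^-1.
Proof.
move=> s0 s1; have h : n%:R * s ^+ n <= \sum_(0 <= k < n) s ^+ k.
  rewrite mulr_natl -[X in _ *+ X]subn0 -sumr_const_nat ler_sum_nat// => i /andP[_ /ltnW ni].
  by rewrite ler_wiXn2l// ltW.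
apply: le_trans h _; rewrite -[leRHS]mul1r ler_pdivlMr ?subr_gt0// big_mkord mulrC.
have e := @subrX1 R s n.
have : s ^+ n - 1 = - ((1 - s) * \sum_(i < n) s ^+ i) by rewrite e; lra.
have : 0 <= s ^+ n by exact: exprn_ge0.
lra.
Qed.

Lemma cvg_pser c r x : bounded_coeffs c r -> `|x| < r ->
  exists M, cvgn (series M) /\ forall n, `|c n * x ^+ n| <= M n.
Proof.
move=> [B HB] xr; have r0 : 0 < r by exact: le_lt_trans xr.
exists (geometric B (`|x| / r)); split.
  by apply: is_cvg_geometric_series; rewrite ger0_norm ?divr_ge0 1?(ltW r0)// ltr_pdivrMr ?mul1r.
move=> n; rewrite /geometric/= expr_div_n normrM normrX mulrA ler_pdivlMr ?exprn_gt0//.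
by rewrite mulrAC ler_wpM2r// exprn_ge0.
Qed.

Lemma bounded_diffs c r r' : bounded_coeffs c r -> 0 < r' -> r' < r ->
  bounded_coeffs (pseries_diffs c) r'.
Proof.
move=> [B HB] r'0 r'r; have r0 : 0 < r by exact: lt_trans r'r.
have q1 : r' / r < 1 by rewrite ltr_pdivrMr ?mul1r.
have q0 : 0 <= r' / r by rewrite divr_ge0// ltW.
have B0 : 0 <= B by apply: le_trans (HB 0%N); rewrite mulr_ge0// exprn_ge0// ltW.
exists ((1 - r' / r)^-1 * B / r') => n; rewrite /pseries_diffs normrM normr_nat.
have := natmul_exp_le n.+1 q0 q1.
rewrite ler_pdivlMr// -mulrA -exprSr => h.
have -> : n.+1%:R * `|c n.+1| * r' ^+ n.+1 =
   (n.+1%:R * (r' / r) ^+ n.+1) * (`|c n.+1| * r ^+ n.+1).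
  rewrite expr_div_n; have : r ^+ n.+1 != 0 by rewrite expf_neq0// gt_eqF.
  by move=> ?; field.
by apply: ler_pM => //; rewrite mulr_ge0// exprn_ge0// ltW.
Qed.

Lemma drv_pser c r x : bounded_coeffs c r -> `|x| < r ->
  drv (pser c) x (pser (pseries_diffs c) x).
Proof.
move=> bc xr.
(* Equally spaced radii from r down to |x|: each derivation of the series costs one, and at [K] all
   three series converge. *)
pose r1 := (3 * r + `|x|) / 4; pose r2 := (2 * r + 2 * `|x|) / 4; pose K := (r + 3 * `|x|) / 4.
have x0 := normr_ge0 x.
have b1 : bounded_coeffs (pseries_diffs c) r1 by apply: bounded_diffs bc _ _; rewrite /r1; lra.
have b2 : bounded_coeffs (pseries_diffs (pseries_diffs c)) r2.
  by apply: bounded_diffs b1 _ _; rewrite /r1 /r2; lra.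
have K0 : 0 <= K by rewrite /K; lra.
have cv d s : bounded_coeffs d s -> K < s -> cvgn (pseries d K).
  by move=> bd Ks; have [|M [cM dM]] := @cvg_pser d s K bd; [rewrite ger0_norm|exact: cvg_dom dM].
apply: (@pseries_snd_diffs _ c K x).
- by apply: cv bc _; rewrite /K; lra.
- by apply: cv b1 _; rewrite /K /r1; lra.
- by apply: cv b2 _; rewrite /K /r2; lra.
- by rewrite (ger0_norm K0) /K; lra.
Qed.

End Termwise.

(** * The profile and its linearization *)

Section Profile.
Context {R : realType} (p b : R).
Hypotheses (hp : 1 < p) (hb0 : 0 < b) (hb1 : b < 1).
Implicit Types (t x k : R).

Ltac plra := have ? := hp; have ? := hb0; have ? := hb1; lra.

(* [prof] is the soliton solution of [w'' = w - w^p], translated so that its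
   maximum [zeta = 1/2] is at a positive height (as [b < 1]). *)
Definition zeta t : R := (1 + b * expR ((p - 1) * t))^-1.

Lemma zeta_den t : 0 < 1 + b * expR ((p - 1) * t).
Proof. by rewrite addr_gt0// mulr_gt0// expR_gt0. Qed.

Lemma zeta_gt0 t : 0 < zeta t. Proof. by rewrite invr_gt0 zeta_den. Qed.

Lemma zeta_lt1 t : zeta t < 1.
Proof. by rewrite invf_lt1 ?zeta_den// ltrDl mulr_gt0// expR_gt0. Qed.

Lemma drv_zeta t : drv zeta t (- (p - 1) * zeta t * (1 - zeta t)).
Proof.
apply: drv_eq.
  apply: drv_inv; first by rewrite gt_eqF// zeta_den.
  apply: drvD (drv_cst _ _) _; apply: drvZ; apply: drv_expR; apply: drvZ; exact: drv_id.
rewrite /zeta; field; rewrite gt_eqF//; exact: zeta_den.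
Qed.

Lemma zeta_ub t : zeta t <= b^-1 * expR (- ((p - 1) * t)).
Proof.
rewrite /zeta expRN -invfM lef_pV2 ?posrE ?zeta_den ?mulr_gt0 ?expR_gt0//.
by rewrite lerDr.
Qed.

Lemma zeta_lb t : 0 <= t -> 2^-1 * expR (- ((p - 1) * t)) <= zeta t.
Proof.
move=> t0; rewrite /zeta expRN -invfM lef_pV2 ?posrE ?zeta_den ?mulr_gt0 ?expR_gt0//.
have e1 : 1 <= expR ((p - 1) * t).
  by apply: le_trans (expR_ge1Dx _); rewrite lerDl mulr_ge0//; plra.
have : b * expR ((p - 1) * t) <= expR ((p - 1) * t) by rewrite ler_piMl ?expR_ge0// ltW.
plra.
Qed.

Lemma zeta0 : zeta 0 = (1 + b)^-1. Proof. by rewrite /zeta mulr0 expR0 mulr1. Qed.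

Lemma zeta_le0 t : 0 <= t -> zeta t <= (1 + b)^-1.
Proof.
move=> t0; rewrite /zeta lef_pV2 ?posrE ?zeta_den ?addr_gt0//.
rewrite lerD2l ler_peMr ?(ltW hb0)//.
by apply: le_trans (expR_ge1Dx _); rewrite lerDl mulr_ge0//; plra.
Qed.

(** The potential p w^(p-1) of the linearization in closed form, see [pot_prof]. *)
Definition pot t : R := 2 * p * (p + 1) * zeta t * (1 - zeta t).

(** In classical form, ((p + 1) / 2 sech^2 ((p - 1) (t - t0) / 2))^(1 / (p - 1)) with b = exp (- (p
    - 1) t0); its maximum, at t0, is [critical_height p]. *)
Definition prof t : R := (2 * (p + 1) * zeta t * (1 - zeta t)) `^ (p - 1)^-1.
Definition prof' t : R := - (1 - 2 * zeta t) * prof t.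

Lemma pot_ge0 t : 0 <= pot t.
Proof.
have := zeta_gt0 t; have := zeta_lt1 t => z1 z0.
by rewrite /pot !mulr_ge0//; plra.
Qed.

Lemma pot_le t : pot t <= 2 * p * (p + 1) * zeta t.
Proof.
have := zeta_gt0 t; have := zeta_lt1 t => z1 z0.
rewrite /pot ler_piMr//; last by plra.
by rewrite !mulr_ge0//; plra.
Qed.

Lemma prof_base t : 0 < 2 * (p + 1) * zeta t * (1 - zeta t).
Proof.
have := zeta_gt0 t; have := zeta_lt1 t => z1 z0.
by rewrite !mulr_gt0//; plra.
Qed.

Lemma prof_gt0 t : 0 < prof t. Proof. by rewrite powR_gt0// prof_base. Qed.

Lemma drv_prof t : drv prof t (prof' t).
Proof.
have s0 : p - 1 != 0 by rewrite gt_eqF//; plra.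
have z0 := zeta_gt0 t; have z1 := zeta_lt1 t.
apply: drv_eq.
  apply: drv_powR; first exact: prof_base.
  apply: drvM; first by apply: drvZ; exact: drv_zeta.
  by apply: drvB (drv_cst _ _) (drv_zeta _).
rewrite /prof' /prof powRB; last by apply/implyP => _; rewrite gt_eqF// prof_base.
rewrite powRr1 ?ltW ?prof_base//.
by field; rewrite s0 gt_eqF ?subr_gt0//= gt_eqF//= gt_eqF//; plra.
Qed.

Lemma prof_pow t : prof t `^ (p - 1) = 2 * (p + 1) * zeta t * (1 - zeta t).
Proof.
by rewrite /prof -powRrM mulVf ?powRr1 ?ltW ?prof_base// gt_eqF//; plra.
Qed.

Lemma pot_prof t : pot t = p * prof t `^ (p - 1).
Proof. by rewrite prof_pow /pot; plra. Qed.

Lemma drv_prof' t : drv prof' t ((1 - 2 * (p + 1) * zeta t * (1 - zeta t)) * prof t).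
Proof.
apply: drv_eq.
  apply: drvM; last exact: drv_prof.
  apply: drvN; apply: drvB (drv_cst _ _) _; apply: drvZ; exact: drv_zeta.
rewrite /prof'; ring.
Qed.

(** The linearized equation for [prof'], which [psi1_lt0] compares with [psi 1]. *)
Lemma drv_prof'' t : drv (fun t => (1 - 2 * (p + 1) * zeta t * (1 - zeta t)) * prof t) t
  ((1 - pot t) * prof' t).
Proof.
apply: drv_eq.
  apply: drvM; last exact: drv_prof.
  apply: drvB (drv_cst _ _) _; apply: drvM; first by apply: drvZ; exact: drv_zeta.
  by apply: drvB (drv_cst _ _) (drv_zeta _).
rewrite /prof' /pot; ring.
Qed.

Lemma prof_ub : exists C, 0 < C /\ forall t, prof t <= C * expR (- t).
Proof.
exists ((2 * (p + 1) * b^-1) `^ (p - 1)^-1).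
have hB : 0 < 2 * (p + 1) * b^-1 by rewrite !mulr_gt0 ?invr_gt0//; plra.
split; first by rewrite powR_gt0.
move=> t; have -> : expR (- t) = (expR (- ((p - 1) * t))) `^ (p - 1)^-1.
  rewrite -expRM; congr expR; field; rewrite gt_eqF//; plra.
rewrite -powRM ?expR_ge0 ?(ltW hB)//; apply: ge0_ler_powR.
- by rewrite invr_ge0; plra.
- by rewrite nnegrE ltW// prof_base.
- by rewrite nnegrE mulr_ge0 ?expR_ge0// ltW.
have z0 := zeta_gt0 t; have z1 := zeta_lt1 t.
apply: (@le_trans _ _ (2 * (p + 1) * zeta t)).
  by rewrite ler_piMr ?mulr_ge0//; plra.
by rewrite -[leRHS]mulrA ler_wpM2l ?zeta_ub// mulr_ge0//; plra.
Qed.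

Lemma prof_lb : exists C, 0 < C /\ forall t, 0 <= t -> C * expR (- t) <= prof t.
Proof.
have zb : 0 < 1 - (1 + b)^-1 by rewrite subr_gt0 invf_lt1 ?ltrDl// addr_gt0.
pose D := 2 * (p + 1) * 2^-1 * (1 - (1 + b)^-1).
have hD : 0 < D by rewrite !mulr_gt0//; plra.
exists (D `^ (p - 1)^-1); split; first by rewrite powR_gt0.
move=> t t0; have -> : expR (- t) = (expR (- ((p - 1) * t))) `^ (p - 1)^-1.
  rewrite -expRM; congr expR; field; rewrite gt_eqF//; plra.
rewrite -powRM ?expR_ge0 ?(ltW hD)//; apply: ge0_ler_powR.
- by rewrite invr_ge0; plra.
- by rewrite nnegrE mulr_ge0 ?expR_ge0// ltW.
- by rewrite nnegrE ltW// prof_base.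
have h1 := zeta_lb t0; have h2 := zeta_le0 t0; have z0 := zeta_gt0 t.
have -> : D * expR (- ((p - 1) * t)) =
  2 * (p + 1) * ((2^-1 * expR (- ((p - 1) * t))) * (1 - (1 + b)^-1)) by rewrite /D; ring.
rewrite -[leRHS]mulrA -[leRHS]mulrA mulrA ler_wpM2l//; first by rewrite mulr_ge0//; plra.
by apply: ler_pM; rewrite ?mulr_ge0 ?expR_ge0 ?(ltW zb)//; plra.
Qed.

Lemma prof'0 : 0 < prof' 0.
Proof.
rewrite /prof' mulr_gt0 ?prof_gt0// zeta0 oppr_gt0.
have : 2^-1 < (1 + b)^-1 by rewrite ltf_pV2 ?posrE ?addr_gt0//; plra.
plra.
Qed.

End Profile.

(** The value c at 0 amounts to 4 zeta (1 - zeta) = T at t = 0, solvable since c below the critical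
    height means T < 1. The root (1 + q) / 2, larger than 1/2, is the one that gives b < 1. *)
Lemma ex_prof (R : realType) (p c : R) : 1 < p -> 0 < c -> c < critical_height p ->
  exists b : R, 0 < b /\ b < 1 /\ prof p b 0 = c.
Proof.
move=> hp hc0 hc.
pose T := 2 * c `^ (p - 1) / (p + 1).
have cs0 : 0 < c `^ (p - 1) by rewrite powR_gt0.
have T0 : 0 < T by rewrite divr_gt0 ?mulr_gt0//; lra.
have T1 : T < 1.
  rewrite ltr_pdivrMr ?mul1r; last by lra.
  have : c `^ (p - 1) < (critical_height p) `^ (p - 1).
    apply: gt0_ltr_powR => //; first by lra.
    - by rewrite nnegrE ltW.
    - by rewrite nnegrE powR_ge0.
  rewrite /critical_height -powRrM mulVf ?powRr1; [lra|lra|rewrite gt_eqF//; lra].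
pose q := Num.sqrt (1 - T).
have q0 : 0 < q by rewrite sqrtr_gt0; lra.
have q2 : q ^+ 2 = 1 - T by rewrite sqr_sqrtr//; lra.
have q1 : q < 1 by rewrite -(@ltr_pXn2r _ 2)// ?nnegrE ?(ltW q0)// q2 expr1n; lra.
exists ((1 - q) / (1 + q)).
have q10 : 1 + q != 0 by rewrite gt_eqF//; lra.
split; first by rewrite divr_gt0//; lra.
split; first by rewrite ltr_pdivrMr ?mul1r; lra.
rewrite /prof zeta0.
have e0 : 1 + (1 - q) / (1 + q) = 2 / (1 + q) by field.
have -> : 2 * (p + 1) * (1 + (1 - q) / (1 + q))^-1 * (1 - (1 + (1 - q) / (1 + q))^-1) =
  (p + 1) * (1 - q ^+ 2) / 2 by rewrite e0; field.
have -> : (p + 1) * (1 - q ^+ 2) / 2 = c `^ (p - 1).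
  by rewrite q2 /T; field; rewrite gt_eqF//; lra.
by rewrite -powRrM mulfV ?powRr1 ?ltW// gt_eqF//; lra.
Qed.

(** * The hypergeometric series and its dependence on the parameter g *)

Section Hypergeometric.
Context {R : realType} (L : R).
Hypothesis (hL : 0 <= L).
Implicit Types (g x : R).

(** Coefficients of the solution 1 + O(x) of x(1-x)f'' + (g-2x)f' + L f = 0. *)
Fixpoint hcoef g n : R :=
  if n is m.+1 then hcoef g m * ((m * m.+1)%:R - L) / (m.+1%:R * (m%:R + g)) else 1.

Lemma hcoefS g n : 0 < g ->
  n.+1%:R * (n%:R + g) * hcoef g n.+1 = ((n * n.+1)%:R - L) * hcoef g n.
Proof.
move=> g0 /=; have h1 : n.+1%:R != 0 :> R by rewrite pnatr_eq0.
have h2 : n%:R + g != 0 by rewrite gt_eqF// ltr_wpDl.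
by rewrite mulrC divfK ?mulf_neq0// mulrC.
Qed.

Lemma hcoef_step g n : 1 <= g -> `|hcoef g n.+1| <= (1 + L) * `|hcoef g n|.
Proof.
move=> g1 /=; rewrite -mulrA normrM mulrC ler_wpM2r//.
have d0 : 0 < n.+1%:R * (n%:R + g) by rewrite mulr_gt0 ?ltr0n// ltr_wpDl//; lra.
rewrite normrM (gtr0_norm (_ : 0 < (_)^-1)) ?invr_gt0// ler_pdivrMr//.
have n0 : 0 <= n%:R :> R by [].
apply: le_trans (ler_normB _ _) _; rewrite (ger0_norm hL) normr_nat natrM -natr1.
have h : n%:R * (n%:R + 1) + 1 <= (n%:R + 1) * (n%:R + g) by nra.
have : 0 <= L * ((n%:R + 1) * (n%:R + g) - 1).
  by rewrite mulr_ge0// subr_ge0; apply: le_trans h; rewrite lerDr mulr_ge0// addr_ge0.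
lra.
Qed.

Lemma hcoef_decr g n : 1 <= g -> L <= n%:R -> `|hcoef g n.+1| <= `|hcoef g n|.
Proof.
move=> g1 Ln /=; rewrite -mulrA normrM ler_piMr//.
have d0 : 0 < n.+1%:R * (n%:R + g) by rewrite mulr_gt0 ?ltr0n// ltr_wpDl//; lra.
rewrite normrM (gtr0_norm (_ : 0 < (_)^-1)) ?invr_gt0// ler_pdivrMr// mul1r.
have n0 : 0 <= n%:R :> R by [].
apply: le_trans (ler_normB _ _) _; rewrite (ger0_norm hL) normr_nat natrM -natr1.
nra.
Qed.

Let J : nat := Num.Def.archi_bound L.

(** The factor 1 + L is paid only up to the index [J], beyond which the sequence decreases. The
    resulting bound does not depend on g. *)
Lemma growth_bound (u : nat -> R) : (forall n, 0 <= u n) ->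
  (forall n, u n.+1 <= (1 + L) * u n) -> (forall n, L <= n%:R -> u n.+1 <= u n) ->
  forall n, u n <= (1 + L) ^+ J * u 0%N.
Proof.
move=> u0 us ud; have L1 : 1 <= 1 + L by rewrite lerDl.
have h n : (n <= J)%N -> u n <= (1 + L) ^+ n * u 0%N.
  elim: n => [|n IH] nJ; first by rewrite expr0 mul1r.
  apply: le_trans (us n) _; rewrite exprS -mulrA ler_wpM2l ?IH// 1?ltnW//.
  exact: le_trans L1.
elim=> [|n IH]; first by rewrite ler_peMl// exprn_ege1.
have [nJ|Jn] := leqP n.+1 J.
  by apply: le_trans (h _ nJ) _; rewrite ler_wpM2r// ler_weXn2l.
apply: le_trans (ud n _) IH.
by apply: le_trans (ltW (archi_boundP hL)) _; rewrite ler_nat.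
Qed.

Lemma hcoef_bound g n : 1 <= g -> `|hcoef g n| <= (1 + L) ^+ J.
Proof.
move=> g1; have := @growth_bound (fun n => `|hcoef g n|) _ _ _ n.
rewrite /= normr1 mulr1; apply => // m; [exact: hcoef_step|exact: hcoef_decr].
Qed.

(** All coefficients but the constant one inherit the factor 1 / g from the first, - L / g. This is
    why [hyp g x] tends to 1 as g grows, and hence why [psi k 0] is positive for large k. *)
Lemma hcoefS_bound g n : 1 <= g -> `|hcoef g n.+1| <= (1 + L) ^+ J * L / g.
Proof.
move=> g1; have := @growth_bound (fun n => `|hcoef g n.+1|) _ _ _ n.
have -> : `|hcoef g 1| = L / g.
  by rewrite /= mul0n sub0r mul1r mul1r add0r normrM normrN (ger0_norm hL)
     ger0_norm// invr_ge0; lra.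
rewrite mulrA; apply => // m; first exact: hcoef_step.
move=> Lm; apply: hcoef_decr => //; apply: le_trans Lm _; rewrite ler_nat//.
Qed.

Lemma bounded_hcoef g r : 1 <= g -> 0 <= r <= 1 -> bounded_coeffs (hcoef g) r.
Proof.
move=> g1 /andP[r0 r1]; exists ((1 + L) ^+ J) => n.
apply: le_trans (hcoef_bound n g1); rewrite ler_piMr// exprn_ile1//.
Qed.

Lemma pser0 (c : nat -> R) : pser c 0 = c 0%N.
Proof.
rewrite /pser /ssum; apply/cvg_lim => //; rewrite -(cvg_shiftn 1)/=.
rewrite [X in X @ _ --> _](_ : _ = (fun=> c 0%N)); first exact: cvg_cst.
apply/funext => n; rewrite addn1 /series/= big_nat_recl// expr0 mulr1 big1 ?addr0// => i _.
by rewrite expr0n mulr0.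
Qed.

Definition hyp g : R -> R := pser (hcoef g).
Definition hyp' g : R -> R := pser (pseries_diffs (hcoef g)).
Definition hyp'' g : R -> R := pser (pseries_diffs (pseries_diffs (hcoef g))).

Lemma drv_hyp g x : 1 <= g -> `|x| < 1 -> drv (hyp g) x (hyp' g x).
Proof.
by move=> g1; apply: drv_pser; apply: bounded_hcoef => //; rewrite ler01 lexx.
Qed.

Lemma bounded_hcoef' g x : 1 <= g -> `|x| < 1 ->
  exists2 r, `|x| < r & r < 1 /\ bounded_coeffs (pseries_diffs (hcoef g)) r.
Proof.
move=> g1 x1; have x0 := normr_ge0 x; exists ((`|x| + 1) / 2); first by lra.
split; first by lra.
by apply: (@bounded_diffs _ _ 1); [apply: bounded_hcoef => //; rewrite ler01 lexx|lra|lra].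
Qed.

Lemma drv_hyp' g x : 1 <= g -> `|x| < 1 -> drv (hyp' g) x (hyp'' g x).
Proof.
by move=> g1 x1; have [r xr [r1 br]] := bounded_hcoef' g1 x1; exact: drv_pser br xr.
Qed.

(* The partial sums of the coefficientwise equation telescope. *)
Lemma hyp_ode g x : 1 <= g -> `|x| < 1 ->
  x * (1 - x) * hyp'' g x + (g - 2 * x) * hyp' g x + L * hyp g x = 0.
Proof.
move=> g1 x1; have [r xr [r1 br]] := bounded_hcoef' g1 x1.
have x0 := normr_ge0 x.
have b0 : bounded_coeffs (hcoef g) 1 by apply: bounded_hcoef => //; rewrite ler01 lexx.
have b2 : bounded_coeffs (pseries_diffs (pseries_diffs (hcoef g))) ((`|x| + r) / 2).
  by apply: bounded_diffs br _ _; lra.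
set c := hcoef g; set d := pseries_diffs c; set e := pseries_diffs d.
have cvc : cvgn (series (fun n => c n * x ^+ n)).
  by have [M [cM dM]] := cvg_pser b0 x1; exact: cvg_dom dM.
have cvd : cvgn (series (fun n => d n * x ^+ n)).
  by have [M [cM dM]] := cvg_pser br xr; exact: cvg_dom dM.
have cve : cvgn (series (fun n => e n * x ^+ n)).
  have xr2 : `|x| < (`|x| + r) / 2 by lra.
  by have [M [cM dM]] := cvg_pser b2 xr2; exact: cvg_dom dM.
pose T n := x * (1 - x) * (e n * x ^+ n) + (g - 2 * x) * (d n * x ^+ n) + L * (c n * x ^+ n).
have -> : x * (1 - x) * hyp'' g x + (g - 2 * x) * hyp' g x + L * hyp g x = ssum T.
  rewrite /T ssumD; [|by apply: cvg_seriesD; exact: cvg_seriesZ|exact: cvg_seriesZ].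
  by rewrite ssumD ?ssumZ//; exact: cvg_seriesZ.
have SN N : series T N.+1 =
  x * (1 - x) * (e N * x ^+ N) - N.+2%:R * x * (d N * x ^+ N).
  rewrite /series/=; elim: N => [|N IH].
    rewrite big_nat1 /T /e /d /pseries_diffs.
    have := @hcoefS g 0 ltac:(lra); rewrite mul0n sub0r add0r mul1r -/c => h.
    rewrite !expr0 !mul1r !mulr1.
    have h' : L = - (g * c 1%N) by rewrite h [c 0%N]/= mulr1 opprK.
    rewrite [X in _ + X = _]h'; ring.
  rewrite big_nat_recr//= IH /T.
  have := @hcoefS g N.+1 ltac:(lra); rewrite -/c => h.
  have -> : L * (c N.+1 * x ^+ N.+1) =
    ((N.+1 * N.+2)%:R * c N.+1 - (N.+2%:R * (N.+1%:R + g) * c N.+2)) * x ^+ N.+1.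
    by rewrite h; ring.
  rewrite /e /d /pseries_diffs !exprS natrM -!natr1.
  ring.
have shift1 u : u n @[n --> \oo] --> (0 : R) -> u n.+1 @[n --> \oo] --> (0 : R).
  by rewrite (cvg_shiftS u).
have lime := cvg_series_cvg_0 cve.
have limd := shift1 _ (cvg_series_cvg_0 cvd).
(* In the remainder of [SN] the factor N + 3 is split as (N + 1) + 2, and (N + 1) d_(N+1) = e_N; so
   the remainder consists of terms of convergent series. *)
have key : x * (1 - x) * (e N.+1 * x ^+ N.+1) - (x ^+ 2 * (e N * x ^+ N) +
    2 * x * (d N.+1 * x ^+ N.+1)) @[N --> \oo] -->
    x * (1 - x) * 0 - (x ^+ 2 * 0 + 2 * x * 0).
  apply: cvgB; first by apply: cvgM; [exact: cvg_cst|exact: (shift1 _ lime)].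
  by apply: cvgD; apply: cvgM => //; exact: cvg_cst.
rewrite !mulr0 addr0 subr0 in key.
rewrite /ssum; apply/cvg_lim => //; rewrite -(cvg_shiftn 2).
apply: cvg_trans key; apply: near_eq_cvg; near=> N; rewrite /= addn2 SN; congr (_ - _).
by rewrite /e /pseries_diffs !exprS -[N.+3]addn2 natrD; ring.
Unshelve. all: by end_near.
Qed.

Lemma hyp_bounds r : 0 <= r < 1 -> exists K, 0 <= K /\
  forall g x, 1 <= g -> 0 <= x <= r ->
    `|hyp' g x| <= K / g /\ `|hyp g x - 1| <= K / g * x.
Proof.
move=> /andP[r0 r1].
have br : bounded_coeffs (pseries_diffs (fun=> 1 : R)) ((r + 1) / 2).
  by apply: (@bounded_diffs _ _ 1); [exists 1 => n; rewrite normr1 expr1n mulr1|lra|lra].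
have [|M [cM dM]] := @cvg_pser _ _ _ r br; first by rewrite ger0_norm//; lra.
set D := (1 + L) ^+ J * L; have D0 : 0 <= D by rewrite mulr_ge0// exprn_ge0// addr_ge0.
have M0 n : 0 <= M n by exact: le_trans (dM n).
have sM : 0 <= ssum M.
  have := @ssum_bound R (fun=> 0) M cM; move=> /(_ ltac:(by move=> n; rewrite normr0)).
  exact: le_trans.
have hd g x : 1 <= g -> 0 <= x <= r -> `|hyp' g x| <= D * ssum M / g.
  move=> g1 /andP[x0 xr]; rewrite mulrAC -ssumZ//.
  apply: ssum_bound; first exact: cvg_seriesZ.
  move=> n; rewrite /pseries_diffs.
  apply: le_trans (_ : D / g * `|n.+1%:R * r ^+ n| <= _); last first.
    rewrite ler_wpM2l ?divr_ge0//; first by lra.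
    by have := dM n; rewrite /pseries_diffs mulr1.
  rewrite mulrAC normrM [leLHS]mulrC ler_pM//; first exact: hcoefS_bound.
  by rewrite !normrM !normrX ler_wpM2l// lerXn2r ?nnegrE// (ger0_norm x0) (ger0_norm r0).
exists (D * ssum M); split; first by rewrite mulr_ge0.
move=> g x g1 xr; split; first exact: hd.
have /andP[x0 x1] := xr.
have -> : hyp g x - 1 = hyp g x - hyp g 0 by rewrite /hyp pser0.
have := @lipschitz_itv R (hyp g) (hyp' g) (D * ssum M / g) 0 x.
rewrite subr0 (ger0_norm x0) (min_idPl x0) (max_idPr x0); apply => y /andP[y0 yx].
  by apply: drv_hyp => //; rewrite ger0_norm//; lra.
by apply: hd => //; rewrite y0 (le_trans yx).
Qed.

Lemma cont_hcoef n g : 0 < g -> {for g, continuous (hcoef^~ n)}.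
Proof.
move=> g0; elim: n => [|n IH]; first exact: cvg_cst.
rewrite /continuous_at/=; apply: cvgM; first by apply: cvgM => //; exact: cvg_cst.
apply: cvgV; first by rewrite mulf_neq0 ?pnatr_eq0// gt_eqF// ltr_wpDl.
by apply: cvgM; [exact: cvg_cst|apply: cvgD; [exact: cvg_cst|exact: cvg_id]].
Qed.

Lemma cont_hyp x g : 1 < g -> 0 <= x < 1 -> {for g, continuous (hyp^~ x)}.
Proof.
move=> g1 /andP[x0 x1].
have b1 : bounded_coeffs (fun=> (1 + L) ^+ J) 1.
  by exists (`|(1 + L) ^+ J|) => n; rewrite expr1n mulr1.
have [|M [cM dM]] := @cvg_pser _ _ _ x b1; first by rewrite ger0_norm.
apply: (@cont_ssum _ _ (fun n g => hcoef g n * x ^+ n) M) => //.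
  near=> h => n; apply: le_trans (dM n); rewrite !normrM ler_wpM2r//.
  rewrite [leRHS]ger0_norm ?exprn_ge0 ?addr_ge0//; apply: hcoef_bound.
  by apply: ltW; near: h; exact: lt_nbhsr.
by move=> n; apply: cvgM; [apply: cont_hcoef; lra|exact: cvg_cst].
Unshelve. all: by end_near.
Qed.

End Hypergeometric.

(** * Uniqueness and Wronskians for y'' = V y *)

Section LinearODE.
Context {R : realType}.
Implicit Types (V y z : R -> R) (t : R).

(** The energy y^2 + y'^2 grows at most like exp ((1 + K) t), so it stays 0. *)
Lemma ode_zero V y y' K : (forall t, 0 <= t -> `|V t| <= K) ->
  (forall t, 0 <= t -> drv y t (y' t)) -> (forall t, 0 <= t -> drv y' t (V t * y t)) ->
  y 0 = 0 -> y' 0 = 0 -> forall t, 0 <= t -> y t = 0.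
Proof.
move=> VK dy dy' y0 y'0 T T0.
pose E t := - ((y t * y t + y' t * y' t) * expR (- ((1 + K) * t))).
have : E 0 <= E T.
  apply: (@mono_itv _ _ (fun t => - ((2 * y t * y' t + 2 * y' t * (V t * y t)) * expR (- ((1 + K) * t)) +
      (y t * y t + y' t * y' t) * (expR (- ((1 + K) * t)) * - ((1 + K) * 1))))) => // t /andP[t0 _].
    apply: drv_eq.
      apply: drvN; apply: drvM; first apply: drvD.
      - by apply: drvM; exact: dy.
      - by apply: drvM; exact: dy'.
      - by apply: drv_expR; apply: drvN; apply: drvZ; exact: drv_id.
    by rewrite /=; ring.
  have e0 := expR_ge0 (- ((1 + K) * t)); set e := expR _ in e0 *.
  have -> : - ((2 * y t * y' t + 2 * y' t * (V t * y t)) * e +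
     (y t * y t + y' t * y' t) * (e * - ((1 + K) * 1))) =
     ((y t - y' t) ^+ 2 + (K * (y t * y t + y' t * y' t) - 2 * V t * (y t * y' t))) * e by ring.
  apply: mulr_ge0 => //; apply: addr_ge0; first exact: sqr_ge0.
  have := VK t t0; rewrite ler_norml => /andP[v1 v2].
  have := sqr_ge0 (y t - y' t); have := sqr_ge0 (y t + y' t).
  rewrite !expr2 => h1 h2.
  have h3 : 0 <= (K - V t) * ((y t + y' t) * (y t + y' t)) by apply: mulr_ge0 => //; lra.
  have h4 : 0 <= (K + V t) * ((y t - y' t) * (y t - y' t)) by apply: mulr_ge0 => //; lra.
  lra.
rewrite /E y0 y'0 !mulr0 addr0 mul0r oppr0 oppr_ge0.
rewrite pmulr_lle0 ?expR_gt0// => h.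
apply/eqP; rewrite -sqrf_eq0 expr2 eq_le; apply/andP; split.
  by have := sqr_ge0 (y' T); rewrite expr2; lra.
by have := sqr_ge0 (y T); rewrite expr2.
Qed.

Lemma wronskian_cst V y y' z z' T : 0 <= T ->
  (forall t, 0 <= t -> drv y t (y' t)) -> (forall t, 0 <= t -> drv y' t (V t * y t)) ->
  (forall t, 0 <= t -> drv z t (z' t)) -> (forall t, 0 <= t -> drv z' t (V t * z t)) ->
  y T * z' T - y' T * z T = y 0 * z' 0 - y' 0 * z 0.
Proof.
move=> T0 dy dy' dz dz'; apply: (@drv_0_cst _ (fun t => y t * z' t - y' t * z t)) => t.
rewrite (min_idPr T0) => /andP[t0 _].
apply: drv_eq; first by apply: drvB; apply: drvM; [exact: dy|exact: dz'|exact: dy'|exact: dz].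
ring.
Qed.

End LinearODE.

(** * Decaying solutions of the linearized equation and the critical rate *)

Section Jost.
Context {R : realType} (p b : R).
Hypotheses (hp : 1 < p) (hb0 : 0 < b) (hb1 : b < 1).
Implicit Types (t x k : R).
Ltac plra := have ? := hp; have ? := hb0; have ? := hb1; lra.

Local Notation zeta := (zeta p b).
Local Notation pot := (pot p b).

(** Each derivative in t brings a factor p - 1 in the variable [zeta]. Dividing the equation by (p -
    1)^2 turns the coefficient of the potential into [hL] and the rate k into the shift 2 k / (p -
    1) of [gam]. *)
Definition hL : R := 2 * p * (p + 1) / (p - 1) ^+ 2.
Definition gam k : R := 1 + 2 * k / (p - 1).

(* The solution of [y'' = (k^2 - pot) y] asymptotic to [exp (- k t)]: in the
   variable [zeta], [exp (k t) y] solves the hypergeometric equation. *)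
Definition psi k t : R := expR (- (k * t)) * hyp hL (gam k) (zeta t).
Definition psi' k t : R := expR (- (k * t)) *
  (- k * hyp hL (gam k) (zeta t) - (p - 1) * zeta t * (1 - zeta t) * hyp' hL (gam k) (zeta t)).

Lemma hL_ge0 : 0 <= hL.
Proof. by rewrite /hL divr_ge0 ?sqr_ge0// mulr_ge0 ?mulr_ge0//; plra. Qed.

Lemma gam_ge k : 0 <= k -> 2 * k / (p - 1) <= gam k. Proof. by rewrite /gam; plra. Qed.

Lemma gam_gt1 k : 0 < k -> 1 < gam k.
Proof. by move=> k0; rewrite ltrDl divr_gt0 ?mulr_gt0//; plra. Qed.

Lemma norm_zeta t : `|zeta t| < 1.
Proof. by have := zeta_gt0 p hb0 t => z0; rewrite gtr0_norm ?zeta_lt1. Qed.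

Lemma drv_psi k t : 0 < k -> drv (psi k) t (psi' k t).
Proof.
move=> k0; apply: drv_eq.
  apply: drvM; first by apply: drv_expR; apply: drvN; apply: drvZ; exact: drv_id.
  apply: drv_comp; last exact: drv_zeta.
  by apply: drv_hyp; [exact: hL_ge0|exact: ltW (gam_gt1 k0)|exact: norm_zeta].
by rewrite /psi'; ring.
Qed.

Lemma drv_psi' k t : 0 < k -> drv (psi' k) t ((k ^+ 2 - pot t) * psi k t).
Proof.
move=> k0; have g1 := ltW (gam_gt1 k0); have zt := norm_zeta t.
have dh : drv (fun t => hyp hL (gam k) (zeta t)) t
    (hyp' hL (gam k) (zeta t) * (- (p - 1) * zeta t * (1 - zeta t))).
  by apply: drv_comp; [apply: drv_hyp => //; exact: hL_ge0|exact: drv_zeta].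
have dh' : drv (fun t => hyp' hL (gam k) (zeta t)) t
    (hyp'' hL (gam k) (zeta t) * (- (p - 1) * zeta t * (1 - zeta t))).
  by apply: drv_comp; [apply: drv_hyp' => //; exact: hL_ge0|exact: drv_zeta].
apply: drv_eq.
  apply: drvM; first by apply: drv_expR; apply: drvN; apply: drvZ; exact: drv_id.
  apply: drvB; first by apply: drvZ; exact: dh.
  apply: drvM dh'; apply: drvM; first by apply: drvZ; exact: drv_zeta.
  by apply: drvB (drv_cst _ _) (drv_zeta _ _ _).
have := hyp_ode hL_ge0 g1 zt; rewrite /psi /pot.
set f := hyp _ _ _; set f1 := hyp' _ _ _; set f2 := hyp'' _ _ _; set z := zeta t => e.
set E := expR _; have s0 : p - 1 != 0 by rewrite gt_eqF//; plra.
have e2 : 2 * p * (p + 1) * f =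
    - (p - 1) ^+ 2 * (z * (1 - z) * f2 + (gam k - 2 * z) * f1).
  have -> : z * (1 - z) * f2 + (gam k - 2 * z) * f1 = - (hL * f) by lra.
  by rewrite /hL; field.
have -> : (k ^+ 2 - 2 * p * (p + 1) * z * (1 - z)) * (E * f) =
  E * (k ^+ 2 * f - z * (1 - z) * (2 * p * (p + 1) * f)) by ring.
by rewrite e2 /gam; field.
Qed.

(** One constant has to serve all rates, since all modes are summed later. The third bound fixes the
    sign of [psi k] at infinity, the fourth its sign at 0 for large k. *)
Lemma psi_bounds : exists C, 1 <= C /\ forall k t, 1 <= k -> 0 <= t ->
  [/\ `|psi k t| <= C * expR (- (k * t)), `|psi' k t| <= C * k * expR (- (k * t)),
      `|expR (k * t) * psi k t - 1| <= C * expR (- ((p - 1) * t)) &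
      `|psi k 0 - 1| <= C / k].
Proof.
have r01 : 0 <= (1 + b)^-1 < 1.
  by rewrite invr_ge0 invf_lt1; plra.
have [K [K0 HK]] := hyp_bounds hL_ge0 r01.
have b10 : 0 < b^-1 by rewrite invr_gt0.
pose C := 1 + K + (p - 1) * K + K * b^-1 + K * (p - 1).
have s0 : 0 < p - 1 by plra.
have h1 : 0 <= (p - 1) * K by rewrite mulr_ge0// ltW.
have h2 : 0 <= K * b^-1 by rewrite mulr_ge0// ltW.
have h3 : 0 <= K * (p - 1) by rewrite mulr_ge0// ltW.
exists C; split; first by rewrite /C; lra.
move=> k t k1 t0; have k0 : 0 < k by lra.
have g1 := ltW (gam_gt1 k0).
have Kg : 0 <= K / gam k <= K.
  apply/andP; split; first by rewrite divr_ge0//; lra.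
  by rewrite ler_pdivrMr ?ler_peMr//; lra.
have zr s : 0 <= s -> 0 <= zeta s <= (1 + b)^-1.
  by move=> s1; rewrite ltW ?zeta_gt0//=; apply: zeta_le0.
have z0 := ltW (zeta_gt0 p hb0 t); have z1 := ltW (zeta_lt1 p hb0 t).
have [f'K fK] := HK (gam k) (zeta t) g1 (zr t t0).
set f := hyp _ _ _ in fK; set f' := hyp' _ _ _ in f'K.
have E0 := expR_ge0 (- (k * t)).
have fK1 : `|f - 1| <= K * zeta t.
  by apply: le_trans fK _; rewrite ler_wpM2r//; case/andP: Kg.
have fC : `|f| <= 1 + K.
  have := ler_normD (f - 1) 1; rewrite subrK normr1.
  have : K * zeta t <= K by rewrite ler_piMr.
  lra.
have f'C : `|f'| <= K by apply: le_trans f'K _; case/andP: Kg.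
split.
- rewrite /psi -/f normrM (ger0_norm E0) mulrC ler_wpM2r//.
  by apply: le_trans fC _; rewrite /C; lra.
- rewrite /psi' -/f -/f' normrM (ger0_norm E0) mulrC ler_wpM2r//.
  apply: le_trans (ler_normB _ _) _; rewrite !normrM normrN (gtr0_norm k0) (gtr0_norm s0).
  rewrite (ger0_norm z0) (ger0_norm (_ : 0 <= 1 - zeta t)); last by lra.
  have t1 : k * `|f| <= k * (1 + K) by rewrite ler_wpM2l// ltW.
  have t2 : (p - 1) * zeta t * (1 - zeta t) * `|f'| <= (p - 1) * K.
    apply: ler_pM => //; first by rewrite !mulr_ge0//; lra.
    rewrite -mulrA ler_piMr//; first exact: ltW.
    by rewrite mulr_ile1//; lra.
  have t3 : (p - 1) * K <= k * ((p - 1) * K) by rewrite ler_peMl.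
  have t4 : 0 <= k * (K * b^-1 + K * (p - 1)) by rewrite mulr_ge0 ?addr_ge0// ltW.
  by rewrite /C [X in _ <= X]mulrC; lra.
- rewrite /psi mulrA -expRD subrr expR0 mul1r -/f.
  apply: le_trans fK1 _.
  apply: le_trans (_ : K * (b^-1 * expR (- ((p - 1) * t))) <= _).
    by rewrite ler_wpM2l// zeta_ub.
  by rewrite mulrA ler_wpM2r ?expR_ge0// /C; lra.
- have [_ fK'] := HK (gam k) (zeta 0) g1 (zr 0 (lexx _)).
  rewrite /psi mulr0 oppr0 expR0 mul1r; apply: le_trans fK' _.
  apply: le_trans (_ : K / gam k <= _).
    by rewrite ler_piMr ?(ltW (zeta_lt1 _ _ _))//; case/andP: Kg.
  apply: le_trans (_ : K * (p - 1) / k <= _); last first.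
    by rewrite ler_wpM2r ?invr_ge0 ?(ltW k0)// /C; lra.
  rewrite -mulrA ler_wpM2l//.
  have -> : (p - 1) / k = (k / (p - 1))^-1 by rewrite invf_div.
  rewrite lef_pV2 ?posrE ?divr_gt0//; last by lra.
  apply: le_trans (gam_ge (ltW k0)); rewrite ler_wpM2r ?invr_ge0 ?(ltW s0)//; lra.
Qed.

Lemma pot_bound t : `|pot t| <= 2 * p * (p + 1).
Proof.
rewrite ger0_norm ?pot_ge0//; apply: le_trans (pot_le hp hb0 hb1 t) _.
by rewrite ler_piMr ?(ltW (zeta_lt1 _ _ _))// !mulr_ge0//; plra.
Qed.

Lemma ode_bound k t : `|k ^+ 2 - pot t| <= k ^+ 2 + 2 * p * (p + 1).
Proof.
apply: le_trans (ler_normB _ _) _; rewrite ger0_norm ?sqr_ge0// lerD2l; exact: pot_bound.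
Qed.

(** A double zero at 0 would make [psi k] vanish on the half line, against its asymptotics exp (- k
    t). *)
Lemma psi_neq0 k : 1 <= k -> psi k 0 = 0 -> psi' k 0 != 0.
Proof.
move=> k1 p0; apply/eqP => p'0; have k0 : 0 < k by lra.
have z : forall t, 0 <= t -> psi k t = 0.
  apply: (@ode_zero _ (fun t => k ^+ 2 - pot t) _ (psi' k) (k ^+ 2 + 2 * p * (p + 1)));
    [move=> t _|move=> t _|move=> t _|exact: p0|exact: p'0].
  - exact: ode_bound.
  - exact: drv_psi.
  - exact: drv_psi'.
have [C [C1 HC]] := psi_bounds.
suff : (1 : R) <= 0 by lra.
apply: (@le0_exp_decay _ _ C (p - 1)); first by plra.
move=> t t0; have [_ _ + _] := HC k t k1 t0.
by rewrite z// mulr0 sub0r normrN normr1.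
Qed.

(** For k = 1 the function [prof'] decays too, so its constant Wronskian with [psi 1] is 0 and, by
    uniqueness, [psi 1] is a multiple of it. Far out [psi 1] is positive and [prof'] negative, so
    the factor is negative; and [prof'] is positive at 0. *)
Lemma psi1_lt0 : psi 1 0 < 0.
Proof.
have [C [C1 HC]] := psi_bounds.
have dw t := drv_prof' hp hb0 hb1 t; have dw' t := drv_prof'' hp hb0 hb1 t.
set w1 := prof' p b in dw dw'; set w2 := (fun t => _) in dw dw'.
have w10 : 0 < w1 0 by apply: prof'0.
have dw2 t : drv w2 t ((1 ^+ 2 - pot t) * w1 t) by rewrite expr1n; exact: dw'.
have d1 t := @drv_psi 1 t ltr01; have d2 t := @drv_psi' 1 t ltr01.
have [D [D0 HD]] := prof_ub hp hb0 hb1.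
have w1D t : `|w1 t| <= D * expR (- t).
  rewrite /w1 /prof' normrM normrN (gtr0_norm (prof_gt0 hp hb0 hb1 t)).
  apply: le_trans (HD t); rewrite ler_piMl ?(ltW (prof_gt0 hp hb0 hb1 t))//.
  by have := zeta_gt0 p hb0 t; have := zeta_lt1 p hb0 t; rewrite ler_norml; lra.
have w2D t : `|w2 t| <= (2 * p + 3) * D * expR (- t).
  rewrite /w2 normrM (gtr0_norm (prof_gt0 hp hb0 hb1 t)) -[leRHS]mulrA -(mulrA _ (zeta t)).
  apply: ler_pM => //; first exact: ltW (prof_gt0 hp hb0 hb1 t).
  have z0 := zeta_gt0 p hb0 t; have z1 := zeta_lt1 p hb0 t.
  have : 0 <= 2 * (p + 1) * (zeta t * (1 - zeta t)) by rewrite !mulr_ge0//; plra.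
  have : 2 * (p + 1) * (zeta t * (1 - zeta t)) <= 2 * (p + 1).
    by rewrite ler_piMr ?mulr_ile1//; plra.
  move=> h1 h2; rewrite ler_norml; apply/andP; split; plra.
have W0 : psi 1 0 * w2 0 - psi' 1 0 * w1 0 = 0.
  apply/eqP; rewrite -normr_le0; set W := _ - _.
  apply: (@le0_exp_decay _ _ (C * ((2 * p + 3) * D) + C * D) 1) => // t t0.
  have -> : W = psi 1 t * w2 t - psi' 1 t * w1 t.
    by rewrite /W; apply/esym; apply: (@wronskian_cst _ (fun t => 1 ^+ 2 - pot t)) => [|s _|s _|s _|s _];
      [exact: t0|exact: d1|exact: d2|exact: dw|exact: dw2].
  have [p1 p2 _ _] := HC 1 t (lexx _) t0; rewrite mul1r mulr1 in p1 p2.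
  have e1 : expR (- t) <= 1 by rewrite -expR0 ler_expR oppr_le0.
  have E0 := expR_ge0 (- t); have C0 : 0 <= C by lra.
  have q1 : `|psi 1 t| <= C by apply: le_trans p1 _; rewrite ler_piMr.
  have q2 : `|psi' 1 t| <= C by apply: le_trans p2 _; rewrite ler_piMr.
  apply: le_trans (ler_normB _ _) _.
  rewrite (normrM (psi 1 t)) (normrM (psi' 1 t)) mul1r mulrDl -2!(mulrA C).
  by apply: lerD; apply: ler_pM.
pose lam := psi 1 0 / w1 0.
have z : forall t, 0 <= t -> psi 1 t - lam * w1 t = 0.
  apply: (@ode_zero _ (fun t => 1 ^+ 2 - pot t) _ (fun t => psi' 1 t - lam * w2 t)
      (1 ^+ 2 + 2 * p * (p + 1))) => [t _|t _|t _||].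
  - exact: ode_bound.
  - by apply: drvB; [exact: d1|apply: drvZ; exact: dw].
  - apply: drv_eq (drvB (d2 t) (drvZ lam (dw2 t))) _; by rewrite (mulrBr _ (psi 1 t)) (mulrCA lam).
  - by rewrite /lam divfK ?subrr// gt_eqF.
  - apply: (mulIf (_ : w1 0 != 0)); first by rewrite gt_eqF.
    have -> : (psi' 1 0 - lam * w2 0) * w1 0 = psi' 1 0 * w1 0 - lam * w1 0 * w2 0 by ring.
    by rewrite mul0r /lam divfK ?gt_eqF//; lra.
(* At such a t the summand C ensures [psi 1 t > 0], and 2 / b ensures [zeta t < 1/2], that is, a
   decreasing profile. *)
have [t t0 ht] : exists2 t, 0 <= t & (C + 2 / b) * expR (- ((p - 1) * t)) < 1.
  apply: contrapT => H; suff : (1 : R) <= 0 by lra.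
  apply: (@le0_exp_decay _ _ (C + 2 / b) (p - 1)); first by plra.
  by move=> t t0; rewrite leNgt; apply/negP => h; apply: H; exists t.
have e0 := expR_gt0 (- ((p - 1) * t)); set e := expR _ in ht e0.
have bi0 : 0 < b^-1 by rewrite invr_gt0.
have Ce : 0 < C * e by rewrite mulr_gt0//; lra.
have be : 0 < b^-1 * e by rewrite mulr_gt0.
have [_ _ p3 _] := HC 1 t (lexx _) t0.
rewrite -/e mul1r ler_norml in p3; case/andP: p3 => p3 _.
have pt : 0 < psi 1 t.
  by rewrite -(pmulr_rgt0 _ (expR_gt0 t)); lra.
have zt : zeta t < 2^-1.
  have := zeta_ub p hb0 t; rewrite -/e; lra.
have wt : w1 t < 0.
  by rewrite /w1 /prof' pmulr_llt0 ?prof_gt0// oppr_lt0; lra.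
have : 0 < lam * w1 t by have /eqP := z t t0; rewrite subr_eq0 => /eqP <-.
rewrite nmulr_lgt0// => lam0.
have -> : psi 1 0 = lam * w1 0 by rewrite /lam divfK// gt_eqF.
by rewrite pmulr_llt0.
Qed.

Lemma cont_psi0 k : 0 < k -> {for k, continuous (psi^~ 0)}.
Proof.
move=> k0.
have -> : psi^~ 0 = (fun k => hyp hL (gam k) (zeta 0)).
  by apply/funext => s; rewrite /psi mulr0 oppr0 expR0 mul1r.
apply: (@continuous_comp _ _ _ gam (fun g => hyp hL g (zeta 0))).
  apply: cvgD; first exact: cvg_cst.
  by apply: cvgM; [apply: cvgM; [exact: cvg_cst|exact: cvg_id]|exact: cvg_cst].
apply: cont_hyp; [exact: hL_ge0|exact: gam_gt1|].
by rewrite ltW ?zeta_gt0//= zeta_lt1.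
Qed.

(** The supremum of the rates with nonpositive [psi k 0]; continuity in k forces a zero there.
    Positivity beyond it will exclude resonance of the higher modes. *)
Lemma ex_critical : exists k0, [/\ 1 < k0, psi k0 0 = 0 & forall k, k0 < k -> 0 < psi k 0].
Proof.
have [C [C1 HC]] := psi_bounds.
have big k : 2 * C <= k -> 0 < psi k 0.
  move=> kC; have k1 : 1 <= k by lra.
  have [_ _ _] := HC k 0 k1 (lexx _).
  have : C / k <= 2^-1 by rewrite ler_pdivrMr; lra.
  by rewrite ler_norml => ? /andP[? ?]; lra.
pose S := [set k | 1 <= k /\ psi k 0 <= 0].
have S1 : S 1 by split => //; exact: ltW psi1_lt0.
have ubS : ubound S (2 * C).
  by move=> k [k1 pk]; rewrite leNgt; apply/negP => /ltW /big; lra.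
have hS : has_sup S by split; [exists 1|exists (2 * C)].
pose k0 := sup S.
have k01 : 1 <= k0 by apply: ub_le_sup => //; exists (2 * C).
have above k : k0 < k -> 0 < psi k 0.
  move=> kk; rewrite ltNge; apply/negP => pk.
  have : k <= k0 by apply: ub_le_sup; [exists (2 * C)|split => //; lra].
  by lra.
have ck := @cont_psi0 k0 ltac:(lra).
have z : psi k0 0 = 0.
  apply/eqP; rewrite eq_le; apply/andP; split; rewrite leNgt; apply/negP => h.
    have /cvgrPdist_lt /(_ _ h) [e /= e0 He] := ck.
    have [k [k1 pk] ke] := sup_adherent e0 hS.
    have kk0 : k <= k0 by apply: ub_le_sup; [exists (2 * C)|].
    have := He k; rewrite /ball_/= ger0_norm ?subr_ge0// => /(_ ltac:(rewrite /k0 in kk0 *; lra)).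
    by rewrite ltr_norml => /andP[? ?]; lra.
  have h' : 0 < - psi k0 0 by lra.
  have /cvgrPdist_lt /(_ _ h') [e /= e0 He] := ck.
  have := He (k0 + e / 2); rewrite /ball_/= opprD addrA subrr sub0r normrN gtr0_norm; last by lra.
  move=> /(_ ltac:(lra)); rewrite ltr_norml => /andP[? ?].
  by have := above (k0 + e / 2) ltac:(lra); lra.
exists k0; split => //; rewrite lt_neqAle k01 andbT; apply/eqP => e.
by have := psi1_lt0; rewrite e z ltxx.
Qed.

End Jost.

(** * Existence for linear initial value problems *)

Section LinearExistence.
Context {R : realType}.

Lemma continuous_half_limit_weight (W : R -> R) (u : nat -> R -> R) (a : R -> R) (K : R) :
  continuous W -> (forall x, 0 < W x) -> (forall n, continuous (u n)) ->
  (forall n x, `|a x - u n x| <= K / 2 ^+ n * W x) -> continuous a.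
Proof.
move=> cW W0 cu ua.
have cWV : continuous (fun x => (W x)^-1).
  by move=> x; apply: cvgV; [rewrite gt_eqF|exact: cW].
have -> : a = (fun x => a x * (W x)^-1 * W x).
  by apply/funext => x; rewrite divfK// gt_eqF.
apply: contM cW; apply: (@continuous_half_limit _ (fun n x => u n x * (W x)^-1) _ K).
  by move=> n; exact: contM.
move=> n x; rewrite -mulrBl normrM normfV (gtr0_norm (W0 x)) ler_pdivrMr//.
Qed.

(** Picard iteration on the whole half line at once: in the weight exp (l t) the double integration
    gains l^-2, and K / l^2 <= 1/2. *)
Lemma ode_ex (V : R -> R) (K A B : R) : continuous V -> (forall t, `|V t| <= K) ->
  exists y y' : R -> R, [/\ y 0 = A, y' 0 = B, continuous y & continuous y'] /\
   forall t, 0 <= t -> drv y t (y' t) /\ drv y' t (V t * y t).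
Proof.
move=> cV VK; have K0 : 0 <= K by exact: le_trans (VK 0).
pose l := 1 + 2 * K; have l1 : 1 <= l by rewrite /l; lra.
have l0 : 0 < l by lra.
(* Negative times are sent to 0, so that continuity and the contraction are stated on the whole
   line. *)
pose pt (t : R) := Num.max t 0.
have pt0 t : 0 <= pt t by rewrite le_max lexx orbT.
have ptE t : 0 <= t -> pt t = t by move=> t0; rewrite /pt; apply/max_idPl.
have cpt : continuous pt by exact: cont_maxr.
pose W t := expR (l * pt t).
have W0 t : 0 < W t by exact: expR_gt0.
have cW : continuous W by apply: cont_expR; exact: contZ.
pose Phi (a : R -> R) t := A + B * pt t + prim (prim (fun s => V s * a s)) (pt t).
have dE c s : drv (fun x => c / l * expR (l * x)) s (c * expR (l * s)).
  apply: drv_eq (drvZ _ (drv_expR (drvZ l (drv_id s)))) _.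
  by field; rewrite gt_eqF.
have [a [ca aE]] : exists a, continuous a /\ Phi a = a.
  apply: (@weighted_contraction _ _ W (fun a => continuous a) Phi (fun=> 0) (`|A| + `|B|)).
  - by move=> t; exact: ltW.
  - by rewrite addr_ge0.
  - by move=> t; exact: cvg_cst.
  - move=> a ca; apply: contD; first by apply: contD; [move=> ?; exact: cvg_cst|exact: contZ].
    apply: cont_comp => //; apply: cont_prim; apply: cont_prim; exact: contM.
  - move=> t; rewrite subr0 /Phi.
    have c0 : continuous (fun s => V s * 0) by apply: contM => // ?; exact: cvg_cst.
    have p0 s : 0 <= s -> prim (fun s => V s * 0) s = 0.
      move=> s0; rewrite (@prim_uniq _ _ (fun=> 0))// ?subr0// => x _.
      by rewrite mulr0; exact: drv_cst.
    rewrite (@prim_uniq _ _ (fun=> 0))//; last 2 first.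
    + exact: cont_prim.
    + by move=> x /andP[x0 _]; rewrite p0//; exact: drv_cst.
    rewrite subr0 addr0; apply: le_trans (ler_normD _ _) _.
    rewrite mulrDl normrM (ger0_norm (pt0 t)).
    have w1 : 1 + pt t <= W t.
      apply: le_trans (expR_ge1Dx _) _; rewrite ler_expR ler_peMl//.
    have := pt0 t => ?.
    by rewrite lerD// ?ler_peMr// ?ler_wpM2l//; lra.
  - move=> a b d ca cb d0 ab t; rewrite /Phi.
    have cVa : continuous (fun s => V s * a s) by exact: contM.
    have cVb : continuous (fun s => V s * b s) by exact: contM.
    have -> : A + B * pt t + prim (prim (fun s => V s * a s)) (pt t) -
      (A + B * pt t + prim (prim (fun s => V s * b s)) (pt t)) =
      prim (prim (fun s => V s * a s)) (pt t) - prim (prim (fun s => V s * b s)) (pt t) by lra.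
    set T := pt t; have T0 : 0 <= T := pt0 t.
    have inner s : 0 <= s ->
        `|prim (fun s => V s * a s) s - prim (fun s => V s * b s) s| <= K * d / l * expR (l * s).
      move=> s0.
      have := @dominated_incr _ (fun s => prim (fun s => V s * a s) s - prim (fun s => V s * b s) s)
        _ (fun s => V s * a s - V s * b s) _ 0 s s0 _ (fun x _ => dE (K * d) x).
      rewrite !prim0// subrr subr0 => H; apply: le_trans (H _ _) _.
      + by move=> x _; apply: drvB; exact: drv_prim.
      + move=> x /andP[x0 _]; rewrite -mulrBr normrM -mulrA.
        by apply: ler_pM => //; have := ab x; rewrite /W (ptE x).
      + by rewrite gerBl mulr_ge0 ?expR_ge0// divr_ge0 ?mulr_ge0// ltW.
    have := @dominated_incr _ (fun s => prim (prim (fun s => V s * a s)) s -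
          prim (prim (fun s => V s * b s)) s)
        _ (fun s => prim (fun s => V s * a s) s - prim (fun s => V s * b s) s)
        _ 0 T T0 _ (fun x _ => dE (K * d / l) x).
    rewrite !prim0; try exact: cont_prim.
    rewrite subrr subr0 => H; apply: le_trans (H _ _) _.
    + by move=> x _; apply: drvB; apply: drv_prim; exact: cont_prim.
    + by move=> x /andP[x0 _]; exact: inner.
    apply: le_trans (_ : K * d / l / l * expR (l * T) <= _).
      by rewrite gerBl mulr_ge0 ?expR_ge0// !divr_ge0 ?mulr_ge0// ltW.
    rewrite ler_wpM2r ?expR_ge0// -mulrA -invfM ler_pdivrMr ?mulr_gt0//.
    have : 2 * K * d <= l * l * d by rewrite ler_wpM2r// /l; nra.
    lra.
  - move=> u a cu ua; exact: (@continuous_half_limit_weight W u a _ cW W0 cu ua).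
have cVa : continuous (fun s => V s * a s) by exact: contM.
exists (fun t => A + B * t + prim (prim (fun s => V s * a s)) t).
exists (fun t => B + prim (fun s => V s * a s) t).
have dy t : drv (fun t => A + B * t + prim (prim (fun s => V s * a s)) t) t
    (B + prim (fun s => V s * a s) t).
  apply: drv_eq.
    apply: drvD; first by apply: drvD (drv_cst _ _) (drvZ _ (drv_id _)).
    by apply: drv_prim; exact: cont_prim.
  by rewrite add0r mulr1.
have dy' t : drv (fun t => B + prim (fun s => V s * a s) t) t (V t * a t).
  by apply: drv_eq (drvD (drv_cst _ _) (drv_prim _ cVa)) _; rewrite add0r.
split.
  split; [by rewrite mulr0 addr0 prim0 ?addr0//; exact: cont_prim|by rewrite prim0 ?addr0
         |exact: drv_continuous dy|exact: drv_continuous dy'].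
move=> t t0; split => //; apply: drv_eq (dy' t) _.
by rewrite -[in LHS]aE /Phi ptE.
Qed.

End LinearExistence.

(** * A growth bound uniform in the rate *)

Section Energy.
Context {R : realType} (p b : R).
Hypotheses (hp : 1 < p) (hb0 : 0 < b) (hb1 : b < 1).
Ltac plra := have ? := hp; have ? := hb0; have ? := hb1; lra.
Local Notation zeta := (zeta p b).
Local Notation pot := (pot p b).

(** The energy Q = y'^2 + k^2 y^2 satisfies Q' <= (2 k + pot) Q, using 2 |y y'| <= Q for k >= 1. The
    potential is integrated exactly, as pot = - Th zeta', and so costs at most the factor exp Th,
    whatever k is. *)
Lemma energy_bound (k D : R) (y y' : R -> R) : 1 <= k -> 0 <= D ->
  (forall t, 0 <= t -> drv y t (y' t)) ->
  (forall t, 0 <= t -> drv y' t ((k ^+ 2 - pot t) * y t)) ->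
  (y' 0 ^+ 2 + k ^+ 2 * y 0 ^+ 2) * expR (2 * p * (p + 1) / (p - 1)) <= D ^+ 2 ->
  forall t, 0 <= t -> `|y t| <= D / k * expR (k * t) /\ `|y' t| <= D * expR (k * t).
Proof.
move=> k1 D0 dy dy' y0D T T0.
have k0 : 0 < k by lra.
have s0 : 0 < p - 1 by plra.
pose Th := 2 * p * (p + 1) / (p - 1).
pose Q t := y' t ^+ 2 + k ^+ 2 * y t ^+ 2.
pose E t := - (Q t * expR (Th * zeta t - 2 * k * t)).
have : E 0 <= E T.
  apply: (@mono_itv _ _ (fun t => ((2 * k * (y' t - k * y t) ^+ 2 + 2 * pot t * (y t * y' t)) +
      Q t * pot t) * expR (Th * zeta t - 2 * k * t))) => // t /andP[t0 _].
    apply: drv_eq.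
      apply: drvN; apply: drvM.
        apply: drvD; first by apply: drvM; exact: dy'.
        by apply: drvZ; apply: drvM; exact: dy.
      apply: drv_expR; apply: drvB; first by apply: drvZ; exact: drv_zeta.
      by apply: drvZ; exact: drv_id.
    have -> : Th * (- (p - 1) * zeta t * (1 - zeta t)) = - pot t.
      by rewrite /Th /pot; field; rewrite gt_eqF.
    by rewrite /Q /= !expr2; ring.
  rewrite mulr_ge0 ?expR_ge0//.
  have P0 := pot_ge0 hp hb0 hb1 t; set P := pot t in P0 *.
  have h1 : 0 <= 2 * k * (y' t - k * y t) ^+ 2 by rewrite mulr_ge0 ?sqr_ge0//; lra.
  have h2 : 0 <= P * (y' t + y t) ^+ 2 by rewrite mulr_ge0 ?sqr_ge0.
  have h3 : 0 <= P * ((k ^+ 2 - 1) * y t ^+ 2).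
    rewrite mulr_ge0// mulr_ge0 ?sqr_ge0// subr_ge0 expr2; nra.
  rewrite /Q -addrA addr_ge0//.
  have -> : 2 * P * (y t * y' t) + (y' t ^+ 2 + k ^+ 2 * y t ^+ 2) * P =
   P * (y' t + y t) ^+ 2 + P * ((k ^+ 2 - 1) * y t ^+ 2) by ring.
  exact: addr_ge0.
rewrite /E lerN2 mulr0 subr0 => H.
have Th0 : 0 <= Th by rewrite /Th divr_ge0 ?mulr_ge0//; plra.
have z0 := zeta_gt0 p hb0 T; have z1 := zeta_lt1 p hb0 0.
have Qge0 t : 0 <= Q t by apply: addr_ge0; [exact: sqr_ge0|apply: mulr_ge0; exact: sqr_ge0].
have Q0 := Qge0 T.
have Q00 := Qge0 0.
have QD : Q T <= (D * expR (k * T)) ^+ 2.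
  have -> : (D * expR (k * T)) ^+ 2 = D ^+ 2 * expR (2 * k * T).
    have -> : 2 * k * T = k * T + k * T by ring.
    by rewrite expRD; ring.
  rewrite -(ler_pM2r (expR_gt0 (- (2 * k * T)))) -[leRHS]mulrA -expRD subrr expR0 mulr1.
  apply: le_trans y0D.
  apply: le_trans (_ : Q T * expR (Th * zeta T - 2 * k * T) <= _).
    by rewrite ler_wpM2l// ler_expR lerDr mulr_ge0// ltW.
  apply: le_trans H _; rewrite ler_wpM2l// ler_expR ler_piMr// ltW//.
have De : 0 <= D * expR (k * T) by rewrite mulr_ge0 ?expR_ge0.
split; last first.
  rewrite -(@ler_pXn2r _ 2)// ?nnegrE// -normrX ger0_norm ?sqr_ge0//.
  by apply: le_trans QD; rewrite /Q lerDl mulr_ge0 ?sqr_ge0.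
rewrite mulrAC ler_pdivlMr// -(@ler_pXn2r _ 2)// ?nnegrE ?mulr_ge0// ?(ltW k0)//.
rewrite exprMn -normrX ger0_norm ?sqr_ge0//.
by apply: le_trans QD; rewrite /Q mulrC lerDr sqr_ge0.
Qed.

End Energy.

(* [mf k] and [mg k] are a decaying and a growing solution of the linearized
   equation for the [k]-th mode; [mf1_zero] makes [k = 1] resonant. *)
Record mode_system {R : realType} (p b : R) := ModeSystem {
  mu : R;
  kap : nat -> R;
  mf : nat -> R -> R;
  mf' : nat -> R -> R;
  mg : nat -> R -> R;
  mg' : nat -> R -> R;
  mC : R;
  mc : R;
  mu_gt0 : 0 < mu;
  kap_sq : forall k, kap k ^+ 2 = 1 + k%:R ^+ 2 * mu;
  kap_ge1 : forall k, 1 <= kap k;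
  mc_gt0 : 0 < mc;
  mC_ge1 : 1 <= mC;
  kap_lb : forall k, (0 < k)%N -> mc * k.+1%:R <= kap k - 1;
  kap_ub : forall k, kap k <= mC * k.+1%:R;
  cont_mf : forall k, continuous (mf k);
  cont_mg : forall k, continuous (mg k);
  drv_mf : forall k t, 0 <= t -> drv (mf k) t (mf' k t);
  drv_mf' : forall k t, 0 <= t -> drv (mf' k) t ((kap k ^+ 2 - pot p b t) * mf k t);
  drv_mg : forall k t, 0 <= t -> drv (mg k) t (mg' k t);
  drv_mg' : forall k t, 0 <= t -> drv (mg' k) t ((kap k ^+ 2 - pot p b t) * mg k t);
  mode_wronskian : forall k t, 0 <= t -> mf k t * mg' k t - mf' k t * mg k t = 1;
  mf_bound : forall k t, 0 <= t -> `|mf k t| <= mC * expR (- (kap k * t));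
  mf'_bound : forall k t, 0 <= t -> `|mf' k t| <= mC * kap k * expR (- (kap k * t));
  mg_bound : forall k t, 0 <= t -> `|mg k t| <= mC / kap k * expR (kap k * t);
  mg'_bound : forall k t, 0 <= t -> `|mg' k t| <= mC * expR (kap k * t);
  mg_zero : forall k, k != 1%N -> mg k 0 = 0;
  mf1_zero : mf 1 0 = 0;
  mf1_neq0 : exists2 t, 0 < t & mf 1 t != 0
}.

Lemma mode_constants (R : realType) (m : R) (ka : nat -> R) : 0 < m -> (forall k, 0 <= ka k) ->
  (forall k, ka k ^+ 2 = 1 + k%:R ^+ 2 * m) -> exists2 c, 0 < c &
  (forall k, (0 < k)%N -> c * k.+1%:R <= ka k - 1) /\
  (forall k, ka k <= (1 + m) * k.+1%:R).
Proof.
(* This c satisfies c <= 1 and 8 c <= m, which is what (1 + c (k + 1))^2 <= 1 + m k^2 comes down to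
   for k >= 1. *)
move=> m0 ka0 ka2; exists (m / (8 + m)); first by rewrite divr_gt0//; lra.
set c := m / _.
have c0 : 0 < c by rewrite divr_gt0//; lra.
have c1 : c <= 1 by rewrite ler_pdivrMr; lra.
have cm : 8 * c <= m.
  by rewrite /c mulrA ler_pdivrMr; nra.
clearbody c.
split=> k.
- move=> k0; have k1 : 1 <= k%:R :> R by rewrite ler1n.
  suff : 1 + c * k.+1%:R <= ka k by lra.
  have kk0 : 0 <= 1 + c * k.+1%:R by rewrite addr_ge0// mulr_ge0// ltW.
  rewrite -(@ler_pXn2r _ 2)// ?nnegrE// ka2 -natr1.
  set x := k%:R in k1 *; rewrite !expr2.
  have h1 : c * (x + 1) <= 2 * c * x by nra.
  have h2 : c * (x + 1) * (c * (x + 1)) <= (2 * c * x) * (2 * c * x).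
    by apply: ler_pM => //; rewrite mulr_ge0//; lra.
  have h3 : (2 * c * x) * (2 * c * x) <= 4 * c * (x * x).
    have : c * (c * (x * x)) <= 1 * (c * (x * x)).
      by rewrite ler_wpM2r// !mulr_ge0//; lra.
    lra.
  have h4 : 4 * c * x <= 4 * c * (x * x) by rewrite ler_wpM2l ?mulr_ge0//; nra.
  have h5 : 8 * c * (x * x) <= m * (x * x) by rewrite ler_wpM2r// mulr_ge0//; lra.
  lra.
- have kk0 : 0 <= (1 + m) * k.+1%:R by rewrite mulr_ge0//; lra.
  rewrite -(@ler_pXn2r _ 2)// ?nnegrE// ka2 -natr1.
  have x0 : 0 <= k%:R :> R by []. set x := k%:R in x0 *; rewrite !expr2.
  have : 0 <= m * x by rewrite mulr_ge0// ltW.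
  have : 0 <= m * x * x by rewrite !mulr_ge0// ltW.
  have : 0 <= m * m by rewrite mulr_ge0// ltW.
  have : 0 <= m * m * x by rewrite !mulr_ge0// ltW.
  have : 0 <= m * m * x * x by rewrite !mulr_ge0// ltW.
  have : 0 <= x * x by rewrite mulr_ge0.
  lra.
Qed.

Lemma eventually_bounded (R : realType) (u : nat -> R) (B : R) (K : nat) :
  (forall k, 0 <= u k) -> (forall k, (K <= k)%N -> u k <= B) -> 0 <= B ->
  exists C, forall k, u k <= C.
Proof.
move=> u0 uB B0; exists (B + \sum_(i < K) u i) => k.
have s0 : 0 <= \sum_(i < K) u i by exact: sumr_ge0.
have [kK|/uB] := ltnP k K; last by lra.
have : u k <= \sum_(i < K) u i.
  by rewrite (bigD1 (Ordinal kK))//= lerDl sumr_ge0.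
lra.
Qed.

(** * Existence of the system of modes *)

Section ModeExistence.
Context {R : realType} (p b : R).
Hypotheses (hp : 1 < p) (hb0 : 0 < b) (hb1 : b < 1).
Ltac plra := have ? := hp; have ? := hb0; have ? := hb1; lra.

Lemma second_solution (k : R) (A B : R) : 1 <= k ->
  psi p b k 0 * B - psi' p b k 0 * A = 1 ->
  exists g g' : R -> R, [/\ continuous g, g 0 = A, g' 0 = B,
    (forall t, 0 <= t -> drv g t (g' t) /\ drv g' t ((k ^+ 2 - pot p b t) * g t)) &
    forall t, 0 <= t -> psi p b k t * g' t - psi' p b k t * g t = 1].
Proof.
move=> k1 W0; have k0 : 0 < k by lra.
have cV : continuous (fun t => k ^+ 2 - pot p b t).
  have cz : continuous (zeta p b) by apply: drv_continuous => t; exact: drv_zeta.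
  apply: contB; first by move=> ?; exact: cvg_cst.
  by apply: contM; [exact: contZ|apply: contB => // ?; exact: cvg_cst].
have [g [g' [[g0 g'0 cg _] dg]]] := ode_ex A B cV (ode_bound hp hb0 hb1 k).
exists g, g'; split => // t t0.
rewrite -W0 -g0 -g'0; apply: (@wronskian_cst _ (fun t => k ^+ 2 - pot p b t)) => [|s s0|s s0|s s0|s s0].
- exact: t0.
- exact: drv_psi.
- exact: drv_psi'.
- by case: (dg s s0).
- by case: (dg s s0).
Qed.

Lemma ex_mode_system : inhabited (mode_system p b).
Proof.
have [k0 [k01 pk0 above]] := ex_critical hp hb0 hb1.
have [C0 [C01 HC]] := psi_bounds hp hb0 hb1.
pose m := k0 ^+ 2 - 1; have m0 : 0 < m by rewrite /m expr2; nra.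
pose ka (k : nat) := Num.sqrt (1 + k%:R ^+ 2 * m).
have kr k : 1 <= 1 + k%:R ^+ 2 * m by rewrite lerDl mulr_ge0 ?sqr_ge0// ltW.
have ka2 k : ka k ^+ 2 = 1 + k%:R ^+ 2 * m by rewrite sqr_sqrtr// (le_trans ler01).
have ka1 k : 1 <= ka k by rewrite -sqrtr1 ler_wsqrtr.
have kage0 k : 0 <= ka k by exact: le_trans (ka1 k).
have kaone : ka 1%N = k0.
  by rewrite /ka expr1n mul1r /m addrC subrK sqrtr_sqr ger0_norm//; lra.
have [c c0 [kl ku]] := mode_constants m0 kage0 ka2.
have pn0 k : k != 1%N -> psi p b (ka k) 0 != 0.
  case: k => [_|[//|k] _].
    have -> : ka 0%N = 1 by rewrite /ka expr0n mul0r addr0 sqrtr1.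
    by rewrite lt_eqF//; exact: psi1_lt0.
  rewrite gt_eqF//; apply: above; rewrite -kaone /ka ltr_sqrt; last exact: lt_le_trans (kr _).
  by rewrite ltrD2l ltr_pM2r// ltrXn2r ?ltr_nat// nnegrE.
have pp0 : psi' p b k0 0 != 0 by apply: (psi_neq0 hp hb0 hb1) => //; lra.
(* Where [psi] is nonzero at 0, the second solution is made to vanish there. In the resonant mode
   the Wronskian forbids this: it prescribes the nonzero value - 1 / psi' at 0. *)
pose A (k : nat) := if k == 1%N then - (psi' p b k0 0)^-1 else 0.
pose B (k : nat) := if k == 1%N then 0 else (psi p b (ka k) 0)^-1.
have W0 k : psi p b (ka k) 0 * B k - psi' p b (ka k) 0 * A k = 1.
  rewrite /A /B; case: eqVneq => [->|k1]; last by rewrite mulr0 subr0 mulfV// pn0.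
  by rewrite mulr0 kaone mulrN opprK add0r mulfV.
have /choice[G HG] k := second_solution (ka1 k) (W0 k).
have {HG} /choice[G' HG] := HG.
pose Th := 2 * p * (p + 1) / (p - 1).
pose u k := (B k ^+ 2 + ka k ^+ 2 * A k ^+ 2) * expR Th.
have u0 k : 0 <= u k.
  by rewrite /u mulr_ge0 ?expR_ge0// addr_ge0 ?sqr_ge0// mulr_ge0 ?sqr_ge0.
have [D HD] : exists D, forall k, u k <= D.
  (* Beyond this index [ka k >= 2 * C0], hence [psi] is at least 1/2 at 0 and [B k] at most 2. *)
  pose K := (Num.Def.archi_bound (2 * C0 / c)).+2.
  apply: (@eventually_bounded _ _ (4 * expR Th) K) => [//|k Kk|]; last by rewrite mulr_ge0 ?expR_ge0.
  rewrite /u ler_wpM2r ?expR_ge0//.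
  have k1 : k != 1%N by case: k Kk => [|[]].
  rewrite /A /B (negbTE k1) expr0n mulr0 addr0.
  have kC : 2 * C0 <= ka k.
    have k00 : (0 < k)%N by exact: leq_trans Kk.
    apply: le_trans (_ : c * k.+1%:R <= _); last by have := kl k k00; lra.
    rewrite (mulrC c) -ler_pdivrMr//; apply: le_trans (ltW (archi_boundP _)) _.
      by rewrite divr_ge0 ?(ltW c0)//; lra.
    by rewrite ler_nat; exact: (leq_trans (leq_trans (leqnSn _) (leqnSn _)) (leqW Kk)).
  have [_ _ _] := HC (ka k) 0 (ka1 k) (lexx _).
  have : C0 / ka k <= 2^-1 by rewrite ler_pdivrMr; [lra|exact: lt_le_trans (ka1 k)].
  rewrite ler_norml => h1 /andP[h2 _].
  have h3 : 2^-1 <= psi p b (ka k) 0 by lra.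
  have h4 : (psi p b (ka k) 0)^-1 <= 2.
    by rewrite -[leRHS]invrK lef_pV2 ?posrE//; lra.
  have h5 : 0 <= (psi p b (ka k) 0)^-1 by rewrite invr_ge0; lra.
  have -> : 4 = 2 ^+ 2 :> R by rewrite expr2; lra.
  by rewrite lerXn2r ?nnegrE.
have D0 : 0 <= D by exact: le_trans (HD 0%N).
pose C := C0 + (1 + m) + (1 + D).
have C1 : 1 <= C by rewrite /C; lra.
have gb k t : 0 <= t -> `|G k t| <= C / ka k * expR (ka k * t) /\ `|G' k t| <= C * expR (ka k * t).
  move=> t0; have [cg gA gB dg _] := HG k.
  apply: (energy_bound hp hb0 hb1) => //.
  - by lra.
  - by move=> s /dg[].
  - by move=> s /dg[].
  - rewrite gA gB; apply: le_trans (HD k) _; rewrite expr2 /C; nra.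
have kg k : 0 < ka k by exact: lt_le_trans (ka1 k).
have kC k t : 0 <= ka k * expR (- (ka k * t)) by rewrite mulr_ge0 ?expR_ge0.
constructor; apply: (@ModeSystem _ _ _ m ka (fun k => psi p b (ka k)) (fun k => psi' p b (ka k))
  G G' C c).
- exact: m0.
- exact: ka2.
- exact: ka1.
- exact: c0.
- exact: C1.
- exact: kl.
- by move=> k; apply: le_trans (ku k) _; rewrite ler_wpM2r// /C; lra.
- by move=> k; apply: (@drv_continuous _ _ (psi' p b (ka k))) => t; exact: drv_psi.
- by move=> k; case: (HG k).
- by move=> k t _; exact: drv_psi.
- by move=> k t _; exact: drv_psi'.
- by move=> k t t0; case: (HG k) => _ _ _ /(_ t t0)[].
- by move=> k t t0; case: (HG k) => _ _ _ /(_ t t0)[].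
- by move=> k t t0; case: (HG k) => _ _ _ _ /(_ t t0).
- move=> k t t0; have [h _ _ _] := HC (ka k) t (ka1 k) t0.
  by apply: le_trans h _; rewrite ler_wpM2r ?expR_ge0// /C; lra.
- move=> k t t0; have [_ h _ _] := HC (ka k) t (ka1 k) t0.
  by apply: le_trans h _; rewrite -2!mulrA ler_wpM2r// /C; lra.
- by move=> k t t0; case: (gb k t t0).
- by move=> k t t0; case: (gb k t t0).
- by move=> k k1; case: (HG k) => _ -> _ _ _; rewrite /A (negbTE k1).
- by rewrite kaone.
- rewrite kaone; apply: contrapT => H.
  suff : (1 : R) <= 0 by lra.
  apply: (@le0_exp_decay _ _ C0 (p - 1)); first by plra.
  move=> t t0; have [_ _ + _] := HC k0 t (ltW k01) t0.
  have -> : psi p b k0 t = 0.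
    have [->//|t1] := eqVneq t 0.
    by apply/eqP/negPn/negP => h; apply: H; exists t => //; rewrite lt_neqAle eq_sym t1.
  by rewrite mulr0 sub0r normrN normr1.
Qed.

End ModeExistence.

(** * The Green operator of a single mode *)

Section Green.
Context {R : realType} (p b : R) (S : mode_system p b).
Hypotheses (hp : 1 < p) (hb0 : 0 < b) (hb1 : b < 1).
Implicit Types (F : R -> R) (k : nat) (t : R).

Local Notation f := (mf S).
Local Notation f' := (mf' S).
Local Notation g := (mg S).
Local Notation g' := (mg' S).
Local Notation ka := (kap S).
Local Notation C := (mC S).

(** Variation of constants, with the coefficient of the growing solution integrated from t to
    infinity so that the result decays. At 0 only the tail term is left: it vanishes through
    [mg_zero], or by orthogonality in the resonant mode. *)
Definition green k F t := f k t * prim (fun s => g k s * F s) t + g k t * tail (fun s => f k s * F s) t.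
Definition green' k F t := f' k t * prim (fun s => g k s * F s) t + g' k t * tail (fun s => f k s * F s) t.

Lemma kap_gt0 k : 0 < ka k. Proof. exact: lt_le_trans (kap_ge1 S k). Qed.

Lemma cont_gF k F : continuous F -> continuous (fun s => g k s * F s).
Proof. by move=> cF; apply: contM => //; exact: cont_mg. Qed.

Lemma cont_fF k F : continuous F -> continuous (fun s => f k s * F s).
Proof. by move=> cF; apply: contM => //; exact: cont_mf. Qed.

Lemma drv_green k F t : continuous F -> 0 <= t -> drv (green k F) t (green' k F t).
Proof.
move=> cF t0; apply: drv_eq.
  apply: drvD; apply: drvM.
  - exact: drv_mf.
  - by apply: drv_prim; exact: cont_gF.
  - exact: drv_mg.
  - by apply: drv_tail; exact: cont_fF.
by rewrite /green'; ring.
Qed.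

Lemma drv_green' k F t : continuous F -> 0 <= t ->
  drv (green' k F) t ((ka k ^+ 2 - pot p b t) * green k F t - F t).
Proof.
move=> cF t0; apply: drv_eq.
  apply: drvD; apply: drvM.
  - exact: drv_mf'.
  - by apply: drv_prim; exact: cont_gF.
  - exact: drv_mg'.
  - by apply: drv_tail; exact: cont_fF.
have := mode_wronskian S k t0 => w.
rewrite /green -[F t in RHS]mul1r -w; ring.
Qed.

Lemma cont_green k F : continuous F -> continuous (fun t => green k F (Num.max t 0)).
Proof.
move=> cF; have m0 t : 0 <= Num.max t 0 :> R by rewrite le_max lexx orbT.
move=> t; apply: (@continuous_comp _ _ _ (fun t => Num.max t 0) (green k F)).
  exact: cont_maxr.
by apply: drv_cont (drv_green k cF (m0 t)).
Qed.

(* For [k = 0] the homogeneous solution decays only like [exp (- t)], so the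
   forcing has to decay strictly faster. *)
Definition mrate k : R := if k == 0%N then p else 1.

Lemma mrate_ge1 k : 1 <= mrate k.
Proof. by rewrite /mrate; case: ifP => // _; exact: ltW. Qed.

Lemma fF_decay k F A : 0 <= A -> edec A (mrate k) F ->
  edec (C * A) (ka k + mrate k) (fun s => f k s * F s).
Proof.
move=> A0 HF t t0; rewrite normrM mulrDl opprD expRD mulrACA.
by apply: ler_pM => //; [exact: mf_bound|exact: HF].
Qed.

Lemma rate_gt0 k : 0 < ka k + mrate k.
Proof. by have := kap_ge1 S k; have := mrate_ge1 k; lra. Qed.

Lemma is_improper_fF k F A : continuous F -> 0 <= A -> edec A (mrate k) F ->
  is_improper (fun s => f k s * F s) (improper (fun s => f k s * F s)).
Proof.
by move=> cF A0 HF; apply: is_improperP (@cont_fF k F cF) (rate_gt0 k) (fF_decay A0 HF).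
Qed.

Lemma tail_fF k F A t : continuous F -> 0 <= A -> edec A (mrate k) F -> 0 <= t ->
  `|tail (fun s => f k s * F s) t| <= C * A / ka k * expR (- (ka k * t)) * expR (- t).
Proof.
move=> cF A0 HF t0.
apply: le_trans (tail_bound (@cont_fF k F cF) (rate_gt0 k) (fF_decay A0 HF) t0) _.
have C1 := mC_ge1 S; have k0 := kap_gt0 k; have r1 := mrate_ge1 k.
rewrite -[leRHS]mulrA -expRD; apply: ler_pM.
- by rewrite divr_ge0 ?mulr_ge0// ?(ltW (rate_gt0 k))//; lra.
- exact: expR_ge0.
- rewrite ler_wpM2l ?mulr_ge0//; first by lra.
  by rewrite lef_pV2 ?posrE ?rate_gt0//; lra.
- rewrite ler_expR mulrDl opprD lerD2l lerN2 ler_peMl//.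
Qed.

Lemma prim_gF_pos k F A t : (0 < k)%N -> continuous F -> 0 <= A -> edec A (mrate k) F -> 0 <= t ->
  `|prim (fun s => g k s * F s) t| <= C * A / (ka k * (ka k - 1)) * (expR (ka k * t) * expR (- t)).
Proof.
move=> kp cF A0 HF t0; have k0 := kap_gt0 k; have C1 := mC_ge1 S.
have k1 : 0 < ka k - 1.
  by apply: lt_le_trans (kap_lb S kp); rewrite mulr_gt0 ?mc_gt0.
have r1 : mrate k = 1 by rewrite /mrate; case: k kp {k0 k1 HF}.
have D0 : 0 <= C * A / (ka k * (ka k - 1)).
  by rewrite divr_ge0 ?mulr_ge0//; lra.
have := @prim_dom _ (fun s => g k s * F s)
  (fun s => C * A / (ka k * (ka k - 1)) * expR ((ka k - 1) * s))
  (fun s => C * A / ka k * expR ((ka k - 1) * s)) 0 t t0 (@cont_gF k F cF).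
rewrite prim0 ?subr0; last exact: cont_gF.
move=> H; apply: le_trans (H _ _) _.
- move=> s _; apply: drv_eq (drvZ _ (drv_expR (drvZ _ (drv_id _)))) _.
  by field; rewrite !gt_eqF.
- move=> s /andP[s0 _]; rewrite normrM mulrBl mul1r expRD mulrAC.
  rewrite -2!mulrA mulrA [X in _ <= X](_ : _ = (C / ka k * expR (ka k * s)) * (A * expR (- s))); last by ring.
  apply: ler_pM => //; first exact: mg_bound.
  by have := HF s s0; rewrite r1 mul1r.
- rewrite mulrBl mul1r expRD gerBl mulr0 mulr_ge0 ?expR_ge0//.
Qed.

(** Here [kap 0 = 1], so [mg 0] grows like exp t; against a forcing of rate p the integrand keeps
    the rate p - 1 and its integral stays bounded. *)
Lemma prim_gF_zero F A t : continuous F -> 0 <= A -> edec A (mrate 0) F -> 0 <= t ->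
  `|prim (fun s => g 0 s * F s) t| <= C * A / (p - 1).
Proof.
move=> cF A0 HF t0; have C1 := mC_ge1 S.
have s0 : 0 < p - 1 by have := hp; lra.
have ka0 : ka 0 = 1.
  have := kap_sq S 0; rewrite expr0n mul0r addr0 => /eqP; rewrite sqrf_eq1 => /orP[/eqP//|/eqP e].
  by have := kap_ge1 S 0; rewrite e; lra.
have := @prim_dom _ (fun s => g 0 s * F s)
  (fun s => - (C * A / (p - 1)) * expR (- ((p - 1) * s)))
  (fun s => C * A * expR (- ((p - 1) * s))) 0 t t0 (@cont_gF 0 F cF).
rewrite prim0 ?subr0; last exact: cont_gF.
move=> H; apply: le_trans (H _ _) _.
- by move=> s _; apply: drv_expN; rewrite gt_eqF.
- move=> s /andP[s1 _]; rewrite normrM.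
  have -> : C * A * expR (- ((p - 1) * s)) = (C / ka 0 * expR (ka 0 * s)) * (A * expR (- (p * s))).
    rewrite ka0 divr1 mul1r mulrACA -expRD; congr (_ * expR _); ring.
  by apply: ler_pM => //; [exact: mg_bound|exact: HF].
- rewrite mulr0 oppr0 expR0 mulr1 opprK addrC gerDl mulNr oppr_le0.
  by rewrite mulr_ge0 ?expR_ge0// divr_ge0 ?mulr_ge0//; lra.
Qed.

(** One factor 1 / ka comes from the size of [mg], another from the integration, and [ka k] is
    comparable with k + 1. The derivative loses one of the two. *)
Lemma green_bound : exists2 K, 0 < K & forall k F A, 0 <= A -> continuous F ->
  edec A (mrate k) F -> forall t, 0 <= t ->
    `|green k F t| <= K * A / k.+1%:R ^+ 2 * expR (- t) /\
    `|green' k F t| <= K * A / k.+1%:R * expR (- t).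
Proof.
have C1 := mC_ge1 S; have c0 := mc_gt0 S; have s0 : 0 < p - 1 by have := hp; lra.
set c := mc S in c0.
have CC : 0 < C ^+ 2 by rewrite exprn_gt0//; lra.
pose K := C ^+ 2 / (p - 1) + C ^+ 2 + 2 * C ^+ 2 / c ^+ 2 + 2 * C ^+ 2 / c.
have h1 : 0 < C ^+ 2 / (p - 1) by rewrite divr_gt0.
have h2 : 0 < 2 * C ^+ 2 / c ^+ 2 by rewrite divr_gt0 ?exprn_gt0// mulr_gt0.
have h3 : 0 < 2 * C ^+ 2 / c by rewrite divr_gt0 ?exprn_gt0// mulr_gt0.
exists K; first by rewrite /K; lra.
move=> k F A A0 cF HF t t0.
have k0 := kap_gt0 k; have k1 := kap_ge1 S k.
have Et := expR_ge0 (- t).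
have ee : expR (- (ka k * t)) * expR (ka k * t) = 1 by rewrite -expRD addrC subrr expR0.
have Ekm := expR_ge0 (- (ka k * t)); have Ekp := expR_ge0 (ka k * t).
have fb := mf_bound S k t0; have f'b := mf'_bound S k t0.
have gb := mg_bound S k t0; have g'b := mg'_bound S k t0.
have tb := tail_fF cF A0 HF t0.
rewrite /green /green'; set P := prim _ t; set T := tail _ t in tb.
have b1 : `|g k t * T| <= C ^+ 2 * A / ka k ^+ 2 * expR (- t).
  rewrite normrM; apply: le_trans (ler_pM _ _ gb tb) _ => //.
  rewrite [X in X <= _](_ : _ = C ^+ 2 * A / ka k ^+ 2 * expR (- t) *
     (expR (- (ka k * t)) * expR (ka k * t))); last by field; rewrite gt_eqF.
  by rewrite ee mulr1.
have b2 : `|g' k t * T| <= C ^+ 2 * A / ka k * expR (- t).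
  rewrite normrM; apply: le_trans (ler_pM _ _ g'b tb) _ => //.
  rewrite [X in X <= _](_ : _ = C ^+ 2 * A / ka k * expR (- t) *
     (expR (- (ka k * t)) * expR (ka k * t))); last by field; rewrite gt_eqF.
  by rewrite ee mulr1.
suff [b3 b4] : `|f k t * P| + `|g k t * T| <= K * A / k.+1%:R ^+ 2 * expR (- t) /\
    `|f' k t * P| + `|g' k t * T| <= K * A / k.+1%:R * expR (- t).
  by split; [apply: le_trans b3|apply: le_trans b4]; exact: ler_normD.
case: (posnP k) => [kz|kp].
- have ka0 : ka k = 1.
    have := kap_sq S k; rewrite kz expr0n mul0r addr0 => /eqP; rewrite sqrf_eq1 => /orP[/eqP//|/eqP e].
    by have := kap_ge1 S 0; rewrite e; lra.
  have Pb : `|P| <= C * A / (p - 1).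
    by move: HF; rewrite /P kz => HF; exact: prim_gF_zero.
  rewrite ka0 expr1n !divr1 in b1 b2.
  rewrite ka0 mul1r in fb; rewrite ka0 mul1r mulr1 in f'b.
  have e1 (u : R -> R) : `|u t| <= C * expR (- t) -> `|u t * P| <= C ^+ 2 / (p - 1) * (A * expR (- t)).
    move=> ub; rewrite normrM; apply: le_trans (ler_pM _ _ ub Pb) _ => //.
    by rewrite [X in X <= _](_ : _ = C ^+ 2 / (p - 1) * (A * expR (- t)))//; field; rewrite gt_eqF.
  have f1 := e1 _ fb; have f2 := e1 _ f'b.
  have AE : 0 <= A * expR (- t) by rewrite mulr_ge0.
  rewrite -mulrA in b1; rewrite -mulrA in b2.
  have KK : (C ^+ 2 / (p - 1) + C ^+ 2) * (A * expR (- t)) <= K * (A * expR (- t)).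
    by rewrite ler_wpM2r// /K; lra.
  have kn : k.+1%:R = 1 :> R by rewrite kz.
  rewrite kn expr1n !divr1 -!mulrA; split; apply: le_trans KK; rewrite mulrDl; exact: lerD.
- have cl := kap_lb S kp; rewrite -/c in cl.
  have n0 : 0 < k.+1%:R :> R by [].
  have cn0 : 0 < c * k.+1%:R by rewrite mulr_gt0.
  have km : 0 < ka k - 1 by lra.
  have Pb := prim_gF_pos kp cF A0 HF t0; rewrite -/P in Pb.
  have AE : 0 <= C ^+ 2 * (A * expR (- t)) by apply: mulr_ge0; [exact: ltW|exact: mulr_ge0].
  have i1 : (ka k)^-1 <= (c * k.+1%:R)^-1 by rewrite lef_pV2 ?posrE//; lra.
  have i2 : (ka k - 1)^-1 <= (c * k.+1%:R)^-1 by rewrite lef_pV2 ?posrE//; lra.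
  have j1 : 0 <= (ka k)^-1 by rewrite invr_ge0 ltW.
  have j2 : 0 <= (ka k - 1)^-1 by rewrite invr_ge0 ltW.
  have n2 : 0 < k.+1%:R ^+ 2 :> R by rewrite exprn_gt0.
  have sq : (c * k.+1%:R)^-1 * (c * k.+1%:R)^-1 = (c ^+ 2)^-1 / k.+1%:R ^+ 2.
    by field; rewrite !gt_eqF.
  have a1 : `|f k t * P| <= C ^+ 2 * (A * expR (- t)) * ((c ^+ 2)^-1 / k.+1%:R ^+ 2).
    rewrite normrM; apply: le_trans (ler_pM _ _ fb Pb) _ => //.
    rewrite [X in X <= _](_ : _ = C ^+ 2 * (A * expR (- t)) * ((ka k)^-1 * (ka k - 1)^-1) *
     (expR (- (ka k * t)) * expR (ka k * t))); last by field; rewrite !gt_eqF.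
    by rewrite ee mulr1 ler_wpM2l// -sq ler_pM.
  have a2 : `|f' k t * P| <= C ^+ 2 * (A * expR (- t)) * (c^-1 / k.+1%:R).
    rewrite normrM; apply: le_trans (ler_pM _ _ f'b Pb) _ => //.
    rewrite [X in X <= _](_ : _ = C ^+ 2 * (A * expR (- t)) * (ka k - 1)^-1 *
     (expR (- (ka k * t)) * expR (ka k * t))); last by field; rewrite !gt_eqF.
    by rewrite ee mulr1 ler_wpM2l// -invfM.
  have a3 : `|g k t * T| <= C ^+ 2 * (A * expR (- t)) * ((c ^+ 2)^-1 / k.+1%:R ^+ 2).
    apply: le_trans b1 _.
    rewrite [X in X <= _](_ : _ = C ^+ 2 * (A * expR (- t)) * ((ka k)^-1 * (ka k)^-1)); last first.
      by field; rewrite !gt_eqF.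
    by rewrite ler_wpM2l// -sq ler_pM.
  have a4 : `|g' k t * T| <= C ^+ 2 * (A * expR (- t)) * (c^-1 / k.+1%:R).
    apply: le_trans b2 _.
    rewrite [X in X <= _](_ : _ = C ^+ 2 * (A * expR (- t)) * (ka k)^-1); last first.
      by field; rewrite !gt_eqF.
    by rewrite ler_wpM2l// -invfM.
  have AE' : 0 <= A * expR (- t) by rewrite mulr_ge0.
  split.
  + apply: le_trans (lerD a1 a3) _.
    rewrite [X in X <= _](_ : _ = (2 * C ^+ 2 / c ^+ 2) * ((A * expR (- t)) / k.+1%:R ^+ 2)); last first.
      by field; rewrite !gt_eqF.
    rewrite [X in _ <= X](_ : _ = K * ((A * expR (- t)) / k.+1%:R ^+ 2)); last first.
      by field; rewrite !gt_eqF.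
    by rewrite ler_wpM2r ?divr_ge0 ?(ltW n2)// /K; lra.
  + apply: le_trans (lerD a2 a4) _.
    rewrite [X in X <= _](_ : _ = (2 * C ^+ 2 / c) * ((A * expR (- t)) / k.+1%:R)); last first.
      by field; rewrite !gt_eqF.
    rewrite [X in _ <= X](_ : _ = K * ((A * expR (- t)) / k.+1%:R)); last first.
      by field; rewrite !gt_eqF.
    by rewrite ler_wpM2r ?divr_ge0 ?(ltW n2)// /K; lra.
Qed.

Lemma greenB k F G A t : 0 <= A -> continuous F -> continuous G ->
  edec A (mrate k) F -> edec A (mrate k) G -> 0 <= t ->
  green k (fun s => F s - G s) t = green k F t - green k G t.
Proof.
move=> A0 cF cG HF HG t0; rewrite /green.
have -> : (fun s => g k s * (F s - G s)) = (fun s => g k s * F s - g k s * G s).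
  by apply/funext => s; rewrite mulrBr.
have -> : (fun s => f k s * (F s - G s)) = (fun s => f k s * F s - f k s * G s).
  by apply/funext => s; rewrite mulrBr.
rewrite primB//; try exact: cont_gF.
rewrite tailB//; try exact: cont_fF; try exact: is_improper_fF HF; try exact: is_improper_fF HG.
ring.
Qed.

Lemma green0 k F : continuous F ->
  k != 1%N \/ improper (fun s => f k s * F s) = 0 -> green k F 0 = 0.
Proof.
move=> cF H; rewrite /green prim0 ?mulr0 ?add0r; last exact: cont_gF.
case: H => [/(mg_zero S) ->|h]; first by rewrite mul0r.
by rewrite tail0 ?h ?mulr0//; exact: cont_fF.
Qed.

End Green.

(** * Cosine series *)

Section CosineSeries.
Context {R : realType}.
Implicit Types (g h : R -> R) (y : R) (k j n : nat).

Lemma cvg_inv_sq : cvgn (series (fun k => (k.+1%:R ^+ 2)^-1 : R)).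
Proof.
apply: nondecreasing_is_cvgn.
  apply/nondecreasing_seqP => n; rewrite /series/= big_nat_recr//= lerDl invr_ge0 sqr_ge0//.
exists 2 => _ [n _ <-]; rewrite /series/=.
(* A telescoping majorant: 1 / (n + 1)^2 <= 2 / (n + 1) - 2 / (n + 2). *)
apply: le_trans (_ : 2 - 2 / n.+1%:R <= _); last by rewrite gerBl divr_ge0.
elim: n => [|n IH]; first by rewrite big_geq// divr1 subrr.
rewrite big_nat_recr//=; apply: le_trans (lerD IH (lexx _)) _.
have : 0 <= n%:R :> R by [].
rewrite -[n.+2]addn2 -[n.+1]addn1 !natrD; set x := n%:R => x0.
suff : ((x + 1) ^+ 2)^-1 <= 2 / (x + 1) - 2 / (x + 2) by lra.
have -> : 2 / (x + 1) - 2 / (x + 2) = 2 / ((x + 1) * (x + 2)).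
  by field; rewrite !gt_eqF//; lra.
rewrite ler_pdivlMr ?mulr_gt0//; try lra.
rewrite mulrC ler_pdivrMr ?exprn_gt0//; first by rewrite expr2; nra.
by lra.
Qed.

(** The constant pi^2 / 6, through which bounds on coefficients become sup bounds. *)
Definition Zsq : R := ssum (fun k => (k.+1%:R ^+ 2)^-1).

Lemma Zsq_ge1 : 1 <= Zsq.
Proof.
have := @ssum_tail R (fun k => (k.+1%:R ^+ 2)^-1) _ 1 cvg_inv_sq.
rewrite /series/= big_nat1 expr1n invr1 -/Zsq => /(_ ltac:(by move=> n; rewrite ger0_norm ?invr_ge0 ?sqr_ge0)).
by move=> /(le_trans (normr_ge0 _)); rewrite subr_ge0.
Qed.

Lemma cvg_dom_sq (u : nat -> R) A : (forall k, `|u k| <= A / k.+1%:R ^+ 2) -> cvgn (series u).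
Proof. by apply: cvg_dom; apply: cvg_seriesZ; exact: cvg_inv_sq. Qed.

Lemma ssum_dom_sq (u : nat -> R) A : (forall k, `|u k| <= A / k.+1%:R ^+ 2) -> `|ssum u| <= A * Zsq.
Proof.
move=> uA; rewrite /Zsq -ssumZ; last exact: cvg_inv_sq.
by apply: ssum_bound => //; apply: cvg_seriesZ; exact: cvg_inv_sq.
Qed.

(** The power 4 leaves the summable k^-2 after the two derivations in [csum'']. *)
Definition dec4 A (r : nat -> R) := forall k, `|r k| <= A / k.+1%:R ^+ 4.

Definition csum (r : nat -> R) y := ssum (fun k => r k * cos (k%:R * y)).
Definition csum' (r : nat -> R) y := ssum (fun k => - (k%:R * r k) * sin (k%:R * y)).
Definition csum'' (r : nat -> R) y := ssum (fun k => - (k%:R ^+ 2 * r k) * cos (k%:R * y)).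

Lemma norm_cos_le1 (x : R) : `|cos x| <= 1.
Proof. by rewrite ler_norml cos_geN1 cos_le1. Qed.

Lemma norm_sin_le1 (x : R) : `|sin x| <= 1.
Proof. by rewrite ler_norml sin_geN1 sin_le1. Qed.

Lemma dec4_sq A r j k : (j <= 2)%N -> dec4 A r -> `|k%:R ^+ j * r k| <= A / k.+1%:R ^+ 2.
Proof.
move=> j2 rA; rewrite normrM normrX normr_nat.
apply: le_trans (_ : k.+1%:R ^+ 2 * (A / k.+1%:R ^+ 4) <= _); last first.
  rewrite [leLHS](_ : _ = A / k.+1%:R ^+ 2)//.
  have e (N : R) : N != 0 -> N ^+ 2 * (A / N ^+ 4) = A / N ^+ 2 by move=> N0; field.
  by rewrite e ?pnatr_eq0.
apply: ler_pM => //; apply: le_trans (_ : k.+1%:R ^+ j <= _).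
  by rewrite lerXn2r ?nnegrE// ler_nat.
by rewrite ler_weXn2l// ler1n.
Qed.

Lemma dec4_trig A r j k (u : R) : (j <= 2)%N -> dec4 A r -> `|u| <= 1 ->
  `|k%:R ^+ j * r k * u| <= A / k.+1%:R ^+ 2.
Proof.
move=> j2 rA u1; apply: le_trans (dec4_sq k j2 rA).
by rewrite [leLHS]normrM ler_piMr.
Qed.

Lemma csum_term A r k y : dec4 A r -> `|r k * cos (k%:R * y)| <= A / k.+1%:R ^+ 2.
Proof.
by move=> rA; have := @dec4_trig A r 0 k (cos (k%:R * y)) isT rA (norm_cos_le1 _); rewrite expr0 mul1r.
Qed.

Lemma csum'_term A r k y : dec4 A r -> `|- (k%:R * r k) * sin (k%:R * y)| <= A / k.+1%:R ^+ 2.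
Proof.
by move=> rA; have := @dec4_trig A r 1 k (sin (k%:R * y)) isT rA (norm_sin_le1 _);
  rewrite expr1 mulNr normrN.
Qed.

Lemma csum''_term A r k y : dec4 A r -> `|- (k%:R ^+ 2 * r k) * cos (k%:R * y)| <= A / k.+1%:R ^+ 2.
Proof.
by move=> rA; have := @dec4_trig A r 2 k (cos (k%:R * y)) isT rA (norm_cos_le1 _);
  rewrite mulNr normrN.
Qed.

Lemma drv_csum A r y : dec4 A r -> drv (csum r) y (csum' r y).
Proof.
move=> rA; have cM := cvg_seriesZ (c:=A) cvg_inv_sq.
apply: (@drv_ssum _ (fun k y => r k * cos (k%:R * y)) (fun k y => - (k%:R * r k) * sin (k%:R * y))
  _ _ y 1 ltr01 cM cM).
- move=> k x _; apply: drv_eq (drvZ _ (drv_cos (drvZ _ (drv_id _)))) _; ring.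
- by move=> k x _; exact: csum'_term.
- by move=> k; exact: csum_term.
Qed.

Lemma drv_csum' A r y : dec4 A r -> drv (csum' r) y (csum'' r y).
Proof.
move=> rA; have cM := cvg_seriesZ (c:=A) cvg_inv_sq.
apply: (@drv_ssum _ (fun k y => - (k%:R * r k) * sin (k%:R * y))
  (fun k y => - (k%:R ^+ 2 * r k) * cos (k%:R * y)) _ _ y 1 ltr01 cM cM).
- move=> k x _; apply: drv_eq (drvZ _ (drv_sin (drvZ _ (drv_id _)))) _; ring.
- by move=> k x _; exact: csum''_term.
- by move=> k; exact: csum'_term.
Qed.

Lemma csum_bound A r y : dec4 A r -> `|csum r y| <= A * Zsq.
Proof. by move=> rA; apply: ssum_dom_sq => k; exact: csum_term. Qed.

Lemma csum'_bound A r y : dec4 A r -> `|csum' r y| <= A * Zsq.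
Proof. by move=> rA; apply: ssum_dom_sq => k; exact: csum'_term. Qed.

Lemma csum''_bound A r y : dec4 A r -> `|csum'' r y| <= A * Zsq.
Proof. by move=> rA; apply: ssum_dom_sq => k; exact: csum''_term. Qed.

Lemma csumB A B r r' y : dec4 A r -> dec4 B r' ->
  csum r y - csum r' y = csum (fun k => r k - r' k) y.
Proof.
move=> rA rB; rewrite /csum -ssumB; first by congr ssum; apply/funext => k; rewrite mulrBl.
- by apply: (@cvg_dom_sq _ A) => k; exact: csum_term.
- by apply: (@cvg_dom_sq _ B) => k; exact: csum_term.
Qed.

Lemma csum'B A B r r' y : dec4 A r -> dec4 B r' ->
  csum' r y - csum' r' y = csum' (fun k => r k - r' k) y.
Proof.
move=> rA rB; rewrite /csum' -ssumB; first by congr ssum; apply/funext => k; ring.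
- by apply: (@cvg_dom_sq _ A) => k; exact: csum'_term.
- by apply: (@cvg_dom_sq _ B) => k; exact: csum'_term.
Qed.

Lemma csum''B A B r r' y : dec4 A r -> dec4 B r' ->
  csum'' r y - csum'' r' y = csum'' (fun k => r k - r' k) y.
Proof.
move=> rA rB; rewrite /csum'' -ssumB; first by congr ssum; apply/funext => k; ring.
- by apply: (@cvg_dom_sq _ A) => k; exact: csum''_term.
- by apply: (@cvg_dom_sq _ B) => k; exact: csum''_term.
Qed.

Lemma sin_natpi k : sin (k%:R * pi) = 0 :> R.
Proof.
elim: k => [|k IH]; first by rewrite mul0r sin0.
by rewrite -natr1 mulrDl mul1r sinDpi IH oppr0.
Qed.

Lemma csum'_0 r : csum' r 0 = 0.
Proof.
rewrite /csum' (_ : (fun k => _) = (fun k => 0 * (0 : R))).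
  rewrite ssumZ ?mul0r//; apply: (@cvg_dom_sq _ 0) => k; rewrite normr0 mul0r//.
by apply/funext => k; rewrite mulr0 sin0 mulr0 mul0r.
Qed.

Lemma csum'_pi r : csum' r pi = 0.
Proof.
rewrite /csum' (_ : (fun k => _) = (fun k => 0 * (0 : R))).
  rewrite ssumZ ?mul0r//; apply: (@cvg_dom_sq _ 0) => k; rewrite normr0 mul0r//.
by apply/funext => k; rewrite sin_natpi mulr0 mul0r.
Qed.

Definition cosn k y : R := cos (k%:R * y).

Lemma cont_cosn k : continuous (cosn k).
Proof. by apply: cont_comp; [exact: continuous_cos|apply: contZ => x; exact: cvg_id]. Qed.

(** The cosine coefficient of the even, 2 pi-periodic function that agrees with g on [0, pi]. *)
Definition cc g k : R := (if k == 0%N then 1 else 2) / pi * prim (fun y => g y * cosn k y) pi.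

Lemma cont_gcos g k : continuous g -> continuous (fun y => g y * cosn k y).
Proof. by move=> cg; apply: contM => //; exact: cont_cosn. Qed.

Lemma cc_bound g k B : continuous g -> (forall y, 0 <= y <= pi -> `|g y| <= B) -> `|cc g k| <= 2 * B.
Proof.
move=> cg gB; have p0 : 0 < pi :> R by exact: pi_gt0.
have B0 : 0 <= B by apply: le_trans (gB 0 _); rewrite ?lexx ?pi_ge0.
rewrite /cc normrM; have h : `|prim (fun y => g y * cosn k y) pi| <= B * pi.
  apply: prim_bound => //; [exact: ltW|exact: cont_gcos|move=> x xp].
  by rewrite normrM -[B]mulr1; apply: ler_pM => //; [exact: gB|exact: norm_cos_le1].
have h2 : `|(if k == 0%N then 1 else 2) / pi : R| <= 2 / pi.
  by rewrite ger0_norm; [rewrite ler_pM2r ?invr_gt0//|rewrite divr_ge0 ?(ltW p0)//]; case: ifP => _; lra.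
apply: le_trans (ler_pM _ _ h2 h) _ => //.
have e (q : R) : q != 0 -> 2 / q * (B * q) = 2 * B by move=> q0; field.
by rewrite e ?gt_eqF.
Qed.

Lemma ccB g h k : continuous g -> continuous h -> cc (fun y => g y - h y) k = cc g k - cc h k.
Proof.
move=> cg ch; rewrite /cc -mulrBr -primB ?pi_ge0//; try exact: cont_gcos.
by congr (_ * prim _ _); apply/funext => y; rewrite mulrBl.
Qed.

(** Two integrations by parts: the boundary terms vanish with the sine in the first and with g' in
    the second. The constant 8 absorbs (k + 1)^2 <= 4 k^2 for k >= 1. *)
Lemma cc_decay g (g' g'' : R -> R) B k : (forall y, drv g y (g' y)) -> (forall y, drv g' y (g'' y)) ->
  g' 0 = 0 -> g' pi = 0 -> (forall y, 0 <= y <= pi -> `|g y| <= B) ->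
  (forall y, 0 <= y <= pi -> `|g'' y| <= B) -> `|cc g k| <= 8 * B / k.+1%:R ^+ 2.
Proof.
move=> dg dg' g'0 g'p gB g''B.
have cg : continuous g by exact: drv_continuous dg.
have p0 : 0 < pi :> R by exact: pi_gt0.
have B0 : 0 <= B by apply: le_trans (gB 0 _); rewrite ?lexx ?pi_ge0.
case: k => [|k].
  by rewrite expr1n divr1; apply: le_trans (cc_bound _ cg gB) _; lra.
set x := k.+1%:R : R; have x1 : 1 <= x by rewrite ler1n.
have x0 : x != 0 by rewrite gt_eqF//; lra.
pose H y := prim (fun y => g y * cosn k.+1 y) y - (x^-1 * (g y * sin (x * y)) + (x ^+ 2)^-1 * (g' y * cos (x * y))).
have dH y : drv H y (- (x ^+ 2)^-1 * (g'' y * cos (x * y))).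
  apply: drv_eq.
    apply: drvB; first by apply: drv_prim; exact: cont_gcos.
    by apply: drvD; apply: drvZ; apply: drvM;
      [exact: dg|apply: drv_sin; apply: drvZ; exact: drv_id
      |exact: dg'|apply: drv_cos; apply: drvZ; exact: drv_id].
  by rewrite /cosn -/x; field.
have := @lipschitz_itv _ H _ ((x ^+ 2)^-1 * B) 0 pi (fun y _ => dH y).
rewrite (min_idPl (ltW p0)) (max_idPr (ltW p0)) subr0 (gtr0_norm p0).
have -> : H 0 = 0.
  by rewrite /H prim0 ?mulr0 ?sin0 ?g'0 ?mul0r ?mulr0 ?addr0 ?subr0//; exact: cont_gcos.
have -> : H pi = prim (fun y => g y * cosn k.+1 y) pi.
  by rewrite /H g'p sin_natpi mul0r !mulr0 addr0 subr0.
rewrite subr0 => HB.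
have {}HB : `|prim (fun y => g y * cosn k.+1 y) pi| <= (x ^+ 2)^-1 * B * pi.
  apply: HB => y yp; rewrite normrM normrN (ger0_norm (_ : 0 <= (x ^+ 2)^-1)) ?invr_ge0 ?sqr_ge0//.
  rewrite ler_wpM2l ?invr_ge0 ?sqr_ge0// normrM -[B]mulr1.
  by apply: ler_pM => //; [exact: g''B|exact: norm_cos_le1].
rewrite /cc/= normrM (gtr0_norm (_ : 0 < 2 / pi)) ?divr_gt0//.
apply: le_trans (ler_wpM2l _ HB) _; first by rewrite divr_ge0// ltW.
have e (q z : R) : q != 0 -> z != 0 -> 2 / q * ((z ^+ 2)^-1 * B * q) = 2 * B / z ^+ 2.
  by move=> q0 z0; field; rewrite ?z0.
rewrite e ?gt_eqF//.
have -> : k.+2%:R = x + 1 by rewrite natr1.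
clearbody x; have x00 : 0 < x by lra.
rewrite ler_pdivrMr ?exprn_gt0// mulrAC ler_pdivlMr ?exprn_gt0//; last by lra.
have : 0 <= B * ((4 * x ^+ 2) - (x + 1) ^+ 2).
  by rewrite mulr_ge0// subr_ge0 !expr2; nra.
lra.
Qed.

End CosineSeries.

(** * A continuous function is the sum of its cosine series *)

Section FourierInversion.
Context {R : realType}.
Implicit Types (g h d : R -> R) (y : R) (k j n : nat).

Let pi0 : 0 < pi :> R. Proof. exact: pi_gt0. Qed.

Lemma cont_sum (I : Type) (F : I -> R -> R) (s : seq I) : (forall i, continuous (F i)) ->
  continuous (fun y => \sum_(i <- s) F i y).
Proof.
move=> cF; elim: s => [|i s IH].
  by under eq_fun do rewrite big_nil; move=> ?; exact: cvg_cst.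
by under eq_fun do rewrite big_cons; exact: contD.
Qed.

Lemma contX g n : continuous g -> continuous (fun y => g y ^+ n).
Proof.
move=> cg; elim: n => [|n IH]; first by move=> ?; exact: cvg_cst.
by under eq_fun do rewrite exprS; exact: contM.
Qed.

Lemma cos_anti (x y : R) : 0 <= x -> y <= pi -> x <= y -> cos y <= cos x.
Proof.
move=> x0 yp; rewrite le_eqVlt => /orP[/eqP->//|xy].
by apply: ltW; rewrite ltr_cos ?in_itv/=; lra.
Qed.

Lemma prim_cosn_ne j k : j != k -> prim (fun y => cosn j y * cosn k y) pi = 0 :> R.
Proof.
move=> jk; have d0 : j%:R - k%:R != 0 :> R by rewrite subr_eq0 eqr_nat.
have s0 : j%:R + k%:R != 0 :> R.
  rewrite -natrD pnatr_eq0 addn_eq0; apply/negP => /andP[/eqP j0 /eqP k0].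
  by move: jk; rewrite j0 k0.
pose G y : R := 2^-1 * ((j%:R - k%:R)^-1 * sin ((j%:R - k%:R) * y) +
   (j%:R + k%:R)^-1 * sin ((j%:R + k%:R) * y)).
rewrite (@prim_uniq _ _ G) ?(ltW pi0)//.
- rewrite /G !mulr0 sin0 !mulr0 addr0 mulr0 subr0 mulrBl mulrDl sinB sinD !sin_natpi.
  by rewrite !(mul0r, mulr0, subrr, addr0).
- by apply: contM; exact: cont_cosn.
- move=> y _; apply: drv_eq.
    by apply: drvZ; apply: drvD; apply: drvZ; apply: drv_sin; apply: drvZ; exact: drv_id.
  rewrite /cosn (_ : (j%:R - k%:R) * y = j%:R * y - k%:R * y); last by ring.
  rewrite (_ : (j%:R + k%:R) * y = j%:R * y + k%:R * y); last by ring.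
  rewrite cosB cosD.
  move: d0 s0; set a := j%:R; set b := k%:R; clearbody a b => d0 s0.
  by field; rewrite ?d0 ?s0.
Qed.

Lemma prim_cosn_eq k : prim (fun y => cosn k y * cosn k y) pi = (if k == 0%N then pi else pi / 2) :> R.
Proof.
have cc : continuous (fun y => cosn k y * cosn k y : R) by apply: contM; exact: cont_cosn.
case: eqVneq cc => [->|k0] cc.
  rewrite (@prim_uniq _ _ (fun y => y)) ?(ltW pi0)//; first by rewrite subr0.
  by move=> y _; apply: drv_eq (drv_id y) _; rewrite /cosn mul0r cos0 mulr1.
have kn0 : k%:R != 0 :> R by rewrite pnatr_eq0.
pose G y : R := 2^-1 * y + (2 * k%:R)^-1 * (sin (k%:R * y) * cos (k%:R * y)).
rewrite (@prim_uniq _ _ G) ?(ltW pi0)//.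
- by rewrite /G sin_natpi !mulr0 sin0 !mul0r !mulr0 !addr0 subr0 mulrC.
- move=> y _; apply: drv_eq.
    apply: drvD; first by apply: drvZ; exact: drv_id.
    by apply: drvZ; apply: drvM; [apply: drv_sin|apply: drv_cos]; apply: drvZ; exact: drv_id.
  have := cos2Dsin2 (k%:R * y); rewrite /cosn.
  set s := sin _; set c := cos _; clearbody s c.
  move: kn0; set a := k%:R; clearbody a => a0 e.
  have -> : c * c = 2^-1 * (s ^+ 2 + c ^+ 2) + 2^-1 * (c * c - s * s) by rewrite !expr2; lra.
  by rewrite [s ^+ 2 + _]addrC e; field; rewrite ?a0.
Qed.

Lemma prim_sum (I : finType) (F : I -> R -> R) b : 0 <= b -> (forall i, continuous (F i)) ->
  prim (fun y => \sum_i F i y) b = \sum_i prim (F i) b.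
Proof.
move=> b0 cF; rewrite (@prim_uniq _ _ (fun y => \sum_i prim (F i) y))//.
- by rewrite [X in _ - X]big1 ?subr0// => i _; rewrite prim0.
- exact: cont_sum.
- move=> x _; suff H (s : seq I) : drv (fun y => \sum_(i <- s) prim (F i) y) x (\sum_(i <- s) F i x).
    by have := H (index_enum I).
  elim: s => [|i s IH].
    by rewrite big_nil; under eq_fun do rewrite big_nil; exact: drv_cst.
  rewrite big_cons; under eq_fun do rewrite big_cons.
  by apply: drvD => //; exact: drv_prim.
Qed.

Definition cos_orth d := forall k, prim (fun y => d y * cosn k y) pi = 0.

(** The formula 2 cos y cos (k y) = cos ((k + 1) y) + cos ((k - 1) y) lowers the power j by one; for
    k = 0 the factor cos y is itself [cosn 1]. *)
Lemma cos_orth_pow d j k : continuous d -> cos_orth d ->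
  prim (fun y => d y * cos y ^+ j * cosn k y) pi = 0.
Proof.
move=> cd od; have cX i : continuous (fun y => d y * cos y ^+ i).
  by apply: contM => //; apply: contX; exact: continuous_cos.
elim: j k => [|j IH] k.
  by rewrite -[RHS](od k); congr (prim _ _); apply/funext => y; rewrite expr0 mulr1.
case: k => [|k].
  rewrite -[RHS](IH 1%N); congr (prim _ _); apply/funext => y.
  by rewrite /cosn mul0r mul1r cos0 mulr1 exprSr mulrA.
have -> : (fun y => d y * cos y ^+ j.+1 * cosn k.+1 y) =
    (fun y => 2^-1 * (d y * cos y ^+ j * cosn k.+2 y) + 2^-1 * (d y * cos y ^+ j * cosn k y)).
  apply/funext => y; rewrite /cosn exprSr.
  have -> : k.+2%:R * y = k.+1%:R * y + y by rewrite -natr1; ring.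
  have -> : k%:R * y = k.+1%:R * y - y by rewrite -natr1; ring.
  by rewrite cosD cosB; field.
have cXk m : continuous (fun y => d y * cos y ^+ j * cosn m y) by apply: contM => //; exact: cont_cosn.
by rewrite primD ?(ltW pi0)//; [rewrite !primZ ?(ltW pi0)// !IH mulr0 addr0|exact: contZ|exact: contZ].
Qed.

Lemma cos_orth_poly d (q : {poly R}) : continuous d -> cos_orth d ->
  prim (fun y => d y * q.[cos y]) pi = 0.
Proof.
move=> cd od.
have -> : (fun y => d y * q.[cos y]) =
    (fun y => \sum_(i < size q) q`_i * (d y * cos y ^+ i * cosn 0 y)).
  apply/funext => y; rewrite horner_coef mulr_sumr; apply: eq_bigr => i _.
  by rewrite /cosn mul0r cos0 mulr1 mulrCA.
have cX i : continuous (fun y => d y * cos y ^+ i * cosn 0 y).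
  by apply: contM; [apply: contM => //; apply: contX; exact: continuous_cos|exact: cont_cosn].
rewrite prim_sum ?(ltW pi0)//; last by move=> i; apply: contZ; exact: cX.
by rewrite big1// => i _; rewrite primZ ?(ltW pi0)// cos_orth_pow// mulr0.
Qed.

Lemma le0_geom (x K q : R) : 0 <= q -> q < 1 -> (forall n, x <= K * q ^+ n) -> x <= 0.
Proof.
move=> q0 q1 H; rewrite leNgt; apply/negP => x0.
have K0 : 0 < K by have := H 0%N; rewrite expr0 mulr1; exact: lt_le_trans.
pose B := K * (1 - q)^-1.
have := archi_boundP (_ : 0 <= B / x); rewrite divr_ge0 ?(ltW x0)//; last first.
  by rewrite mulr_ge0 ?invr_ge0 ?(ltW K0)// subr_ge0 ltW.
move=> /(_ isT); set n := Num.Def.archi_bound _; rewrite ltr_pdivrMr// => h.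
have := H n; have := natmul_exp_le n q0 q1.
have : n%:R * x <= n%:R * (K * q ^+ n) by rewrite ler_wpM2l// H.
rewrite mulrCA => h1 h2 _.
have : K * (n%:R * q ^+ n) <= B by rewrite ler_wpM2l// ltW.
lra.
Qed.

(* Integrating d against (1 - ((cos y - cos y0) / 2)^2)^n concentrates at y0. *)
Lemma cos_orth_le0 d y0 : continuous d -> cos_orth d -> 0 <= y0 <= pi -> d y0 <= 0.
Proof.
move=> cd od /andP[y00 y0p]; rewrite leNgt; apply/negP => d0.
pose e := d y0 / 2; have e0 : 0 < e by rewrite divr_gt0.
have /cvgrPdist_lt /(_ e e0) [dl /= dl0 near0] := cd y0.
have near y : `|y0 - y| < dl -> e <= d y.
  by move=> /near0; rewrite ltr_norml /e => /andP[_]; lra.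
pose a := cos y0.
have p0 := pi0.
have [r [r0 [r2 far]]] : exists r, 0 < r /\ r < 2 /\
   forall y, 0 <= y <= pi -> dl <= `|y0 - y| -> r <= `|cos y - a|.
  pose r1 := if y0 + dl <= pi then a - cos (y0 + dl) else 1.
  pose r2 := if 0 <= y0 - dl then cos (y0 - dl) - a else 1.
  have r10 : 0 < r1.
    rewrite /r1; case: ifP => // h; rewrite subr_gt0 ltr_cos ?in_itv/=; lra.
  have r20 : 0 < r2.
    rewrite /r2; case: ifP => // h; rewrite subr_gt0 ltr_cos ?in_itv/=; lra.
  exists (Num.min 1 (Num.min r1 r2)); rewrite !lt_min r10 r20 ltr01.
  split=> //; split; first by rewrite gt_min; apply/orP; left; lra.
  move=> y /andP[y1 y2]; case/orP: (le_total y0 y) => h.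
    rewrite distrC ger0_norm ?subr_ge0// => h2.
    have h3 : y0 + dl <= pi by lra.
    rewrite !ge_min; apply/orP; right; apply/orP; left.
    rewrite /r1 h3 distrC; apply: le_trans (ler_norm _).
    by rewrite lerD2l lerN2 cos_anti//; lra.
  rewrite ger0_norm ?subr_ge0// => h2.
  have h3 : 0 <= y0 - dl by lra.
  rewrite !ge_min; apply/orP; right; apply/orP; right.
  rewrite /r2 h3; apply: le_trans (ler_norm _).
  by rewrite lerD2r cos_anti//; lra.
have closec y : `|cos y - a| <= `|y0 - y|.
  rewrite distrC /a -[leRHS]mul1r.
  apply: (@lipschitz_itv _ cos (fun x => - sin x * 1)) => x _.
    by apply: drv_cos; exact: drv_id.
  by rewrite mulr1 normrN norm_sin_le1.
have aB y : `|cos y - a| <= 2.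
  apply: le_trans (ler_normB _ _) _.
  by have := norm_cos_le1 y; have := norm_cos_le1 y0; rewrite /a; lra.
(* Within distance d2 of y0: dl / 2 keeps d above e, r / 2 keeps the kernel above q1, and pi / 2
   lets an interval of this length fit on one side of y0. *)
pose d2 := Num.min (dl / 2) (Num.min (r / 2) (pi / 2)).
have d20 : 0 < d2 by rewrite !lt_min !divr_gt0.
have d2l : d2 < dl.
  by apply: le_lt_trans (_ : dl / 2 < _); [rewrite ge_min lexx|lra].
have d2r : d2 <= r / 2 by rewrite !ge_min lexx orbT.
have d2p : d2 <= pi / 2 by rewrite !ge_min lexx !orbT.
(* An interval of length d2 inside [0, pi] with y0 as an end point; it lies to the right or to the
   left of y0 according to the half in which y0 lies. *)
have [al [be [al0 [albe [bep nearI]]]]] : exists al be, 0 <= al /\ be = al + d2 /\ be <= pi /\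
    forall y, al <= y <= be -> `|y0 - y| <= d2.
  case/orP: (le_total y0 (pi / 2)) => h.
    exists y0, (y0 + d2); split => //; split => //; split; first by lra.
    by move=> y yy; rewrite distrC ger0_norm; lra.
  exists (y0 - d2), y0; split; first by lra.
  split; first by lra.
  by split => // y yy; rewrite ger0_norm; lra.
have [B HB] : exists B, forall y, 0 <= y <= pi -> `|d y| <= B.
  have [|c _ Hc] := @EVT_max R (fun y => `|d y|) 0 pi (ltW p0).
    by apply: continuous_subspaceT => x; apply: cvg_norm; exact: cd.
  by exists `|d c| => y yp; apply: Hc; rewrite in_itv.
have B0 : 0 <= B by apply: le_trans (HB 0 _); rewrite ?lexx ?(ltW p0).
pose q := 1 - r ^+ 2 / 4; pose q1 := 1 - r ^+ 2 / 16.
have rr : 0 < r ^+ 2 < 4 by rewrite exprn_gt0//= expr2; nra.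
have q0 : 0 <= q by rewrite /q; lra.
have q10 : 0 < q1 by rewrite /q1; lra.
have qq1 : q < q1 by rewrite /q /q1; lra.
pose K y := 1 - ((cos y - a) / 2) ^+ 2.
have Kn y : K y = 1 - `|cos y - a| ^+ 2 / 4.
  by rewrite /K -normrX ger0_norm ?sqr_ge0//; field.
have sqm x y : 0 <= x -> x <= y -> x ^+ 2 <= y ^+ 2 :> R.
  by move=> x0 xy; rewrite lerXn2r ?nnegrE// (le_trans x0).
have K0 y : 0 <= K y.
  by rewrite Kn; have := sqm _ _ (normr_ge0 _) (aB y); rewrite [2 ^+ 2]expr2; lra.
have Kfar y : 0 <= y <= pi -> dl <= `|y0 - y| -> K y <= q.
  move=> yp h; rewrite Kn /q; have := far y yp h.
  by move=> /(sqm _ _ (ltW r0)); lra.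
have Knear y : `|y0 - y| <= d2 -> q1 <= K y.
  move=> h; have h2 : `|cos y - a| <= r / 2 by apply: le_trans (closec y) (le_trans h d2r).
  rewrite Kn /q1; have := sqm _ _ (normr_ge0 _) h2.
  by rewrite expr_div_n [2 ^+ 2]expr2; lra.
(* The integral is 0, but it is at least e d2 q1^n - B pi q^n with q < q1. *)
suff : e * d2 <= 0 by rewrite pmulr_rle0// leNgt d20.
apply: (@le0_geom _ (B * pi) (q / q1)); first by rewrite divr_ge0// ltW.
  by rewrite ltr_pdivrMr ?mul1r.
move=> n; rewrite expr_div_n mulrA ler_pdivlMr ?exprn_gt0//.
pose G y := d y * K y ^+ n.
have cG : continuous G.
  apply: contM => //; apply: contX.
  apply: contB; first by move=> ?; exact: cvg_cst.
  apply: (@contX (fun y => (cos y - a) / 2)).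
  apply: contM; last by move=> ?; exact: cvg_cst.
  by apply: contB; [exact: continuous_cos|move=> ?; exact: cvg_cst].
have G0 : prim G pi = 0.
  pose P : {poly R} := (1 - ((2^-1)%:P * ('X - a%:P)) ^+ 2) ^+ n.
  rewrite -(cos_orth_poly P cd od); congr (prim _ _); apply/funext => y.
  rewrite /G /P /K !hornerE; congr (_ * _ ^+ _).
  by rewrite (mulrC (2^-1)).
have lowG y : 0 <= y <= pi -> - (B * q ^+ n) <= G y.
  move=> yp; have [h|h] := ltP `|y0 - y| dl.
    apply: le_trans (_ : 0 <= _); first by rewrite oppr_le0 mulr_ge0 ?exprn_ge0.
    by rewrite mulr_ge0 ?exprn_ge0//; exact: le_trans (ltW e0) (near y h).
  have := HB y yp; rewrite ler_norml => /andP[h1 _].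
  have h2 : K y ^+ n <= q ^+ n by rewrite lerXn2r ?nnegrE ?K0// Kfar.
  apply: le_trans (_ : - B * K y ^+ n <= _).
    by rewrite mulNr lerN2 ler_wpM2l.
  by rewrite /G ler_wpM2r// exprn_ge0.
have seg x y m : x <= y -> (forall z, x <= z <= y -> m <= G z) -> m * (y - x) <= prim G y - prim G x.
  move=> xy mG; rewrite mulrBr -subr_ge0.
  suff h : prim G x - m * x <= prim G y - m * y by lra.
  apply: (@mono_itv _ (fun z => prim G z - m * z) (fun z => G z - m * 1)) => // z zz.
    by apply: drvB; [exact: drv_prim|apply: drvZ; exact: drv_id].
  by rewrite mulr1 subr_ge0 mG.
have s1 := seg 0 al (- (B * q ^+ n)) al0.
have s2 := seg al be (e * q1 ^+ n) ltac:(lra).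
have s3 := seg be pi (- (B * q ^+ n)) bep.
have {}s1 := s1 (fun z zz => lowG z ltac:(lra)).
have {}s3 := s3 (fun z zz => lowG z ltac:(lra)).
have {}s2 : e * q1 ^+ n * (be - al) <= prim G be - prim G al.
  apply: s2 => z zz; have h := nearI z zz.
  apply: ler_pM; [exact: ltW|by rewrite exprn_ge0// ltW| |].
    by apply: near; exact: le_lt_trans h d2l.
  by rewrite lerXn2r ?nnegrE ?K0 ?(ltW q10)// Knear.
rewrite prim0// subr0 in s1; rewrite G0 sub0r in s3.
have bea : be - al = d2 by lra.
rewrite bea in s2.
have : 0 <= B * q ^+ n * d2 by rewrite !mulr_ge0 ?exprn_ge0// ltW.
have : B * q ^+ n * al + B * q ^+ n * (pi - be) = B * q ^+ n * pi - B * q ^+ n * d2.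
  by rewrite albe; ring.
lra.
Qed.

Lemma cos_orth_eq0 d y : continuous d -> cos_orth d -> 0 <= y <= pi -> d y = 0.
Proof.
move=> cd od yp; apply/eqP; rewrite eq_le cos_orth_le0//=.
rewrite -oppr_le0; apply: (@cos_orth_le0 (fun y => - d y)) => //.
  by move=> x; apply: cvgN; exact: cd.
move=> k; have -> : (fun y => - d y * cosn k y) = (fun y => -1 * (d y * cosn k y)).
  by apply/funext => x; ring.
rewrite primZ ?(ltW pi0)// ?od ?mulr0//; exact: cont_gcos.
Qed.

(** The k-th coefficient of g minus a partial sum is 0 once the sum contains mode k. By uniform
    convergence all coefficients of the difference with the full series vanish, and [cos_orth_eq0]
    applies. *)
Lemma fourier_inversion g B y : continuous g -> (forall k, `|cc g k| <= B / k.+1%:R ^+ 2) ->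
  0 <= y <= pi -> g y = ssum (fun k => cc g k * cosn k y).
Proof.
move=> cg gB yp.
pose S y := ssum (fun k => cc g k * cosn k y).
have tB k x : `|cc g k * cosn k x| <= B / k.+1%:R ^+ 2.
  rewrite normrM; apply: le_trans (gB k); rewrite ler_piMr//; exact: norm_cos_le1.
have cM : cvgn (series (fun k => B / k.+1%:R ^+ 2 : R)) by apply: cvg_seriesZ; exact: cvg_inv_sq.
have cS : continuous S.
  move=> x; apply: (@cont_ssum _ _ (fun k x => cc g k * cosn k x) _ x cM).
    by near=> z => k; exact: tB.
  by move=> k; apply: contZ; exact: cont_cosn.
have cd : continuous (fun y => g y - S y) by exact: contB.
apply/eqP; rewrite -subr_eq0; apply/eqP; apply: (cos_orth_eq0 cd) => // k.
apply/eqP; rewrite -normr_le0.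
pose SN N x := \sum_(j < N) cc g j * cosn j x.
have cSN N : continuous (SN N).
  by apply: cont_sum => i; apply: contZ; exact: cont_cosn.
have part N : (k < N)%N -> prim (fun y => (g y - SN N y) * cosn k y) pi = 0.
  move=> kN.
  have -> : (fun y => (g y - SN N y) * cosn k y) = (fun y => g y * cosn k y -
      \sum_(j < N) cc g j * (cosn j y * cosn k y)).
    apply/funext => x; rewrite mulrBl mulr_suml; congr (_ - _).
    by apply: eq_bigr => j _; rewrite mulrA.
  have ccc j : continuous (fun y => cosn j y * cosn k y : R) by apply: contM; exact: cont_cosn.
  rewrite primB ?(ltW pi0)//; [|exact: cont_gcos|]; last first.
    by apply: cont_sum => i; apply: contZ; exact: ccc.
  rewrite prim_sum ?(ltW pi0)//; last by move=> i; apply: contZ; exact: ccc.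
  rewrite (bigD1 (Ordinal kN))//= big1 ?addr0; last first.
    by move=> i ik; rewrite primZ ?(ltW pi0)// prim_cosn_ne ?mulr0.
  rewrite primZ ?(ltW pi0)// prim_cosn_eq /cc.
  set P := prim _ _; have e (z : R) : z != 0 -> 1 / z * P * z = P by move=> z0; field.
  have e2 (z : R) : z != 0 -> 2 / z * P * (z / 2) = P by move=> z0; field.
  by case: ifP => _; rewrite ?e ?e2 ?subrr// gt_eqF.
apply/ler_addgt0Pl => ep ep0; rewrite addr0.
have ep1 : 0 < ep / pi by rewrite divr_gt0.
have /cvgrPdist_le /(_ _ ep1) [N0 _ HN] : series (fun k => B / k.+1%:R ^+ 2 : R) @ \oo --> ssum (fun k => B / k.+1%:R ^+ 2 : R) by [].
pose N := maxn N0 k.+1.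
have {}HN : ssum (fun k => B / k.+1%:R ^+ 2 : R) - series (fun k => B / k.+1%:R ^+ 2 : R) N <= ep / pi.
  by have := HN N (leq_maxl _ _); exact: le_trans (ler_norm _).
have cf1 : continuous (fun y => (g y - S y) * cosn k y) by exact: cont_gcos.
have cf2 : continuous (fun y => (g y - SN N y) * cosn k y).
  by apply: cont_gcos; exact: contB.
rewrite -[X in `|X|]subr0 -(part N) ?leq_maxr// -primB ?(ltW pi0)//.
have -> : ep = ep / pi * pi by rewrite divfK// gt_eqF.
apply: prim_bound; [exact: ltW|exact: contB|move=> x xp].
rewrite -mulrBl normrM -[ep / pi]mulr1; apply: ler_pM => //; last exact: norm_cos_le1.
apply: le_trans HN.
have := ssum_tail N cM (fun k => tB k x).
rewrite -/(S x) [series _ N](_ : _ = SN N x); last by rewrite /series/= big_mkord.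
have -> : g x - S x - (g x - SN N x) = - (S x - SN N x) by ring.
by rewrite normrN.
Unshelve. all: by end_near.
Qed.

End FourierInversion.

(** * Cosine coefficients of the nonlinearity *)

Section Composition.
Context {R : realType} (p : R).
Implicit Types (x y a d : R) (r : nat -> R) (k j : nat).

(** The remainder in (w + u)^p = w^p + p w^(p-1) u + w^p nl (u / w). *)
Definition nl x : R := (1 + x) `^ p - 1 - p * x.
Definition nl' x : R := p * ((1 + x) `^ (p - 1) - 1).
Definition nl'' x : R := p * (p - 1) * (1 + x) `^ (p - 2).
Definition nl''' x : R := p * (p - 1) * (p - 2) * (1 + x) `^ (p - 3).

Lemma nl0 : nl 0 = 0. Proof. by rewrite /nl addr0 powR1 mulr0 !subr0 subrr. Qed.
Lemma nl'0 : nl' 0 = 0. Proof. by rewrite /nl' addr0 powR1 subrr mulr0. Qed.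

Lemma drv_1D x : drv (fun x : R => 1 + x) x 1.
Proof. by apply: drv_eq (drvD (drv_cst _ _) (drv_id _)) _; rewrite add0r. Qed.

Lemma drv_nl x : -1 < x -> drv nl x (nl' x).
Proof.
move=> x1; have x0 : 0 < 1 + x by lra.
apply: drv_eq.
  apply: drvB; last by apply: drvZ; exact: drv_id.
  by apply: drvB; [exact: (@drv_powR _ (fun x => 1 + x) x 1 _ x0 (drv_1D x))|exact: drv_cst].
by rewrite /nl'; ring.
Qed.

Lemma drv_nl' x : -1 < x -> drv nl' x (nl'' x).
Proof.
move=> x1; have x0 : 0 < 1 + x by lra.
apply: drv_eq.
  by apply: drvZ; apply: drvB; [exact: (@drv_powR _ (fun x => 1 + x) x 1 _ x0 (drv_1D x))|exact: drv_cst].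
have -> : p - 1 - 1 = p - 2 by ring.
by rewrite /nl''; ring.
Qed.

Lemma drv_nl'' x : -1 < x -> drv nl'' x (nl''' x).
Proof.
move=> x1; have x0 : 0 < 1 + x by lra.
apply: drv_eq.
  by apply: drvZ; exact: (@drv_powR _ (fun x => 1 + x) x 1 _ x0 (drv_1D x)).
have -> : p - 2 - 1 = p - 3 by ring.
by rewrite /nl'''; ring.
Qed.

(** On this range |ln (1 + x)| <= ln 2, so the sign of q does not matter. *)
Lemma powR_bound (q : R) : exists2 K, 0 < K & forall x, `|x| <= 2^-1 -> `|(1 + x) `^ q| <= K.
Proof.
exists (expR (`|q| * ln 2)); first exact: expR_gt0.
move=> x; rewrite ler_norml => /andP[x1 x2]; have x0 : 0 < 1 + x by lra.
rewrite ger0_norm ?powR_ge0// /powR gt_eqF// ler_expR.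
apply: le_trans (ler_norm _) _; rewrite normrM ler_wpM2l//.
rewrite ler_norml; apply/andP; split.
  by rewrite -lnV ?posrE// ler_ln ?posrE//; lra.
by rewrite ler_ln ?posrE//; lra.
Qed.

(** For |x| <= 1/2 the base 1 + x stays away from 0, so all derivatives are bounded. The extra
    factor a in the last bound comes from [nl' 0 = 0]; it is the quadratic smallness behind the
    contraction. *)
Lemma nl_bounds : exists2 K, 1 <= K &
  (forall x, `|x| <= 2^-1 -> `|nl'' x| <= K) /\
  (forall x y, `|x| <= 2^-1 -> `|y| <= 2^-1 -> `|nl'' x - nl'' y| <= K * `|x - y|) /\
  (forall x y, `|x| <= 2^-1 -> `|y| <= 2^-1 -> `|nl' x - nl' y| <= K * `|x - y|) /\
  (forall a x y, a <= 2^-1 -> `|x| <= a -> `|y| <= a -> `|nl x - nl y| <= K * a * `|x - y|).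
Proof.
have [K1 K10 H1] := powR_bound (p - 2); have [K2 K20 H2] := powR_bound (p - 3).
pose K := 1 + `|p * (p - 1)| * K1 + `|p * (p - 1) * (p - 2)| * K2.
have k1 : 0 <= `|p * (p - 1)| * K1 by rewrite mulr_ge0// ltW.
have k2 : 0 <= `|p * (p - 1) * (p - 2)| * K2 by rewrite mulr_ge0// ltW.
have btw (a x y z : R) : `|x| <= a -> `|y| <= a -> Num.min y x <= z <= Num.max y x -> `|z| <= a.
  rewrite !ler_norml => /andP[x1 x2] /andP[y1 y2] /andP[z1 z2].
  move: z1 z2; rewrite ge_min le_max; clear -x1 x2 y1 y2; move=> /orP[] h1 /orP[] h2; apply/andP; split; lra.
have b2 x : `|x| <= 2^-1 -> `|nl'' x| <= K.
  move=> x1; rewrite /nl'' normrM; apply: le_trans (ler_wpM2l (normr_ge0 _) (H1 x x1)) _.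
  by rewrite /K; lra.
have b3 x : `|x| <= 2^-1 -> `|nl''' x| <= K.
  move=> x1; rewrite /nl''' normrM; apply: le_trans (ler_wpM2l (normr_ge0 _) (H2 x x1)) _.
  by rewrite /K; lra.
have pos (z : R) : `|z| <= 2^-1 -> -1 < z by rewrite ler_norml => /andP[? _]; lra.
have l1 x y : `|x| <= 2^-1 -> `|y| <= 2^-1 -> `|nl' x - nl' y| <= K * `|x - y|.
  move=> x1 y1; apply: (@lipschitz_itv _ _ nl'') => z /(btw _ _ _ _ x1 y1) z1.
    by apply: drv_nl'; exact: pos.
  exact: b2.
exists K; first by rewrite /K; lra.
split; first exact: b2.
split.
  move=> x y x1 y1; apply: (@lipschitz_itv _ _ nl''') => z /(btw _ _ _ _ x1 y1) z1.
    by apply: drv_nl''; exact: pos.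
  exact: b3.
split; first exact: l1.
move=> a x y a1 xa ya; apply: (@lipschitz_itv _ _ nl') => z /(btw _ _ _ _ xa ya) za.
  by apply: drv_nl; apply: pos; exact: le_trans a1.
have z1 : `|z| <= 2^-1 by exact: le_trans a1.
have := l1 z 0 z1; rewrite normr0 nl'0 !subr0 => /(_ ltac:(lra)) h.
by apply: le_trans h _; rewrite ler_wpM2l// /K; lra.
Qed.

Lemma dec4_norm_le A r y : A * Zsq <= 2^-1 -> dec4 A r -> `|csum r y| <= 2^-1.
Proof. by move=> A1 rA; exact: le_trans (csum_bound y rA) A1. Qed.

Definition comp r y := nl (csum r y).

Lemma cont_comp_nl A r : A * Zsq <= 2^-1 -> dec4 A r -> continuous (comp r).
Proof.
move=> A1 rA; apply: (@drv_continuous _ _ (fun y => nl' (csum r y) * csum' r y)) => y.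
apply: drv_comp; last exact: drv_csum rA.
by apply: drv_nl; have := dec4_norm_le y A1 rA; rewrite ler_norml => /andP[? _]; lra.
Qed.

(* Two integrations by parts in y turn the C^2 Lipschitz bound into a k^-2 gain. *)
Lemma comp_lipschitz : exists2 K, 0 < K & forall A d r r', A * Zsq <= 2^-1 ->
  dec4 A r -> dec4 A r' -> dec4 d (fun k => r k - r' k) ->
  forall k, `|cc (comp r) k - cc (comp r') k| <= K * A * d / k.+1%:R ^+ 2.
Proof.
have [K K1 [Hb2 [Hl2 [Hl1 Hl0]]]] := nl_bounds.
have Z1 : 1 <= Zsq :> R := Zsq_ge1.
(* Here 40 = 8 * 5: the constant of [cc_decay] times the sum 1 + 2 + 1 + 1 of the contributions [t1]
   to [t4], in units of K a e. *)
exists (40 * K * Zsq ^+ 2); first by rewrite !mulr_gt0 ?exprn_gt0//; lra.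
move=> A d r r' A1 rA r'A rd k.
rewrite -ccB; [|exact: cont_comp_nl rA|exact: cont_comp_nl r'A].
have A0 : 0 <= A by have := rA 0%N; rewrite expr1n divr1; exact: le_trans.
have d0 : 0 <= d by have := rd 0%N; rewrite expr1n divr1; exact: le_trans.
pose a := A * Zsq; pose e := d * Zsq.
have a0 : 0 <= a by rewrite mulr_ge0//; lra.
have e0 : 0 <= e by rewrite mulr_ge0//; lra.
have r1 y : `|csum r y| <= a := csum_bound y rA.
have r2 y : `|csum' r y| <= a := csum'_bound y rA.
have r3 y : `|csum'' r y| <= a := csum''_bound y rA.
have q1 y : `|csum r' y| <= a := csum_bound y r'A.
have q2 y : `|csum' r' y| <= a := csum'_bound y r'A.
have q3 y : `|csum'' r' y| <= a := csum''_bound y r'A.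
have s1 y : `|csum r y - csum r' y| <= e by rewrite (csumB y rA r'A); exact: csum_bound.
have s2 y : `|csum' r y - csum' r' y| <= e by rewrite (csum'B y rA r'A); exact: csum'_bound.
have s3 y : `|csum'' r y - csum'' r' y| <= e by rewrite (csum''B y rA r'A); exact: csum''_bound.
have h1 y : `|csum r y| <= 2^-1 := le_trans (r1 y) A1.
have h2 y : `|csum r' y| <= 2^-1 := le_trans (q1 y) A1.
have pos (z : R) : `|z| <= 2^-1 -> -1 < z by rewrite ler_norml => /andP[? _]; lra.
pose g' (q : nat -> R) y := nl' (csum q y) * csum' q y.
pose g'' (q : nat -> R) y := nl'' (csum q y) * csum' q y * csum' q y + nl' (csum q y) * csum'' q y.
have dg q y : dec4 A q -> drv (comp q) y (g' q y).
  move=> qA; apply: drv_comp; last exact: drv_csum qA.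
  by apply: drv_nl; apply: pos; exact: dec4_norm_le A1 qA.
have dg' q y : dec4 A q -> drv (g' q) y (g'' q y).
  move=> qA; apply: drvM; last exact: drv_csum' qA.
  apply: drv_comp; last exact: drv_csum qA.
  by apply: drv_nl'; apply: pos; exact: dec4_norm_le A1 qA.
have K0 : 0 < K by lra.
have ae0 : 0 <= a * e by exact: mulr_ge0.
have -> : 40 * K * Zsq ^+ 2 * A * d = 8 * (5 * K * (a * e)) by rewrite /a /e; ring.
apply: (@cc_decay _ _ (fun y => g' r y - g' r' y) (fun y => g'' r y - g'' r' y)).
- by move=> y; apply: drvB; exact: dg.
- by move=> y; apply: drvB; exact: dg'.
- by rewrite (_ : g' r 0 = 0) 1?(_ : g' r' 0 = 0) ?subrr// /g' csum'_0 mulr0.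
- by rewrite (_ : g' r pi = 0) 1?(_ : g' r' pi = 0) ?subrr// /g' csum'_pi mulr0.
- move=> y _; apply: le_trans (Hl0 a _ _ A1 (r1 y) (q1 y)) _.
  apply: le_trans (_ : K * a * e <= _); first by rewrite ler_wpM2l// mulr_ge0// ltW.
  have : 0 <= K * (a * e) by rewrite mulr_ge0// ltW.
  lra.
- move=> y _.
  have t1 : `|(nl'' (csum r y) - nl'' (csum r' y)) * (csum' r y * csum' r y)| <= K * e * (a * a).
    rewrite !normrM; apply: ler_pM; rewrite ?mulr_ge0//; last by apply: ler_pM.
    by apply: le_trans (Hl2 _ _ (h1 y) (h2 y)) _; rewrite ler_wpM2l// ltW.
  have t2 : `|nl'' (csum r' y) * ((csum' r y - csum' r' y) * (csum' r y + csum' r' y))| <= K * (e * (2 * a)).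
    rewrite (normrM (nl'' _)) (normrM (csum' r y - _)); apply: ler_pM => //; first exact: Hb2.
    apply: ler_pM => //; apply: le_trans (ler_normD _ _) _.
    by have := r2 y; have := q2 y; lra.
  have t3 : `|(nl' (csum r y) - nl' (csum r' y)) * csum'' r y| <= K * e * a.
    rewrite normrM; apply: ler_pM => //.
    by apply: le_trans (Hl1 _ _ (h1 y) (h2 y)) _; rewrite ler_wpM2l// ltW.
  have t4 : `|nl' (csum r' y) * (csum'' r y - csum'' r' y)| <= K * a * e.
    rewrite normrM; apply: ler_pM => //.
    have := Hl1 _ 0 (h2 y); rewrite normr0 nl'0 !subr0 => /(_ ltac:(lra)) h.
    by apply: le_trans h _; rewrite ler_wpM2l// ltW.
  have -> : g'' r y - g'' r' y =
    (nl'' (csum r y) - nl'' (csum r' y)) * (csum' r y * csum' r y) +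
    nl'' (csum r' y) * ((csum' r y - csum' r' y) * (csum' r y + csum' r' y)) +
    (nl' (csum r y) - nl' (csum r' y)) * csum'' r y +
    nl' (csum r' y) * (csum'' r y - csum'' r' y).
    rewrite /g''; move: (nl'' (csum r y)) (nl'' (csum r' y)) (nl' (csum r y)) (nl' (csum r' y)).
    move: (csum' r y) (csum' r' y) (csum'' r y) (csum'' r' y) => *; ring.
  apply: le_trans (ler_normD _ _) _.
  apply: le_trans (lerD (ler_normD _ _) (lexx _)) _.
  apply: le_trans (lerD (lerD (ler_normD _ _) (lexx _)) (lexx _)) _.
  have t5 : K * e * (a * a) <= K * e * a.
    rewrite ler_wpM2l//; first by rewrite mulr_ge0// ltW.
    by rewrite ler_piMl//; apply: le_trans A1 _; lra.
  by lra.
Qed.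

(** The right side involves the sup distance of the cosine sums alone. This is the form in which
    continuity in t is obtained, in [cont_coef_family]. *)
Lemma comp_sup_lipschitz A : A * Zsq <= 2^-1 -> exists2 K, 0 < K &
  forall r r' D, dec4 A r -> dec4 A r' -> (forall y, `|csum r y - csum r' y| <= D) ->
  forall k, `|cc (comp r) k - cc (comp r') k| <= K * D.
Proof.
move=> A1; have [K K1 [_ [_ [_ Hl0]]]] := nl_bounds.
exists (2 * K); first by lra.
move=> r r' D rA r'A rD k.
rewrite -ccB; [|exact: cont_comp_nl rA|exact: cont_comp_nl r'A].
have D0 : 0 <= D by exact: le_trans (rD 0).
rewrite -mulrA; apply: cc_bound.
  by apply: contB; [exact: cont_comp_nl rA|exact: cont_comp_nl r'A].
move=> y _; apply: le_trans (Hl0 2^-1 _ _ (lexx _) (dec4_norm_le y A1 rA) (dec4_norm_le y A1 r'A)) _.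
apply: ler_pM => //; first by rewrite mulr_ge0; lra.
by lra.
Qed.

Lemma cc_comp0 k : cc (comp (fun=> 0)) k = 0.
Proof.
have c0 y0 : comp (fun=> 0) y0 = 0.
  rewrite /comp (_ : csum _ _ = 0) ?nl0//; apply/eqP; rewrite -normr_le0.
  apply: le_trans (@csum_bound _ 0 _ _ _) _; last by rewrite mul0r.
  by move=> j; rewrite normr0 mul0r.
rewrite /cc (_ : (fun y => _) = (fun=> 0)); last by apply/funext => z; rewrite c0 mul0r.
rewrite (@prim_uniq _ _ (fun=> 0)) ?pi_ge0//; [by rewrite subrr mulr0|by move=> ?; exact: cvg_cst|].
by move=> z _; exact: drv_cst.
Qed.

Lemma comp_inversion A r y : A * Zsq <= 2^-1 -> dec4 A r -> 0 <= y <= pi ->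
  comp r y = ssum (fun k => cc (comp r) k * cosn k y).
Proof.
move=> A1 rA yp; have [K K0 HK] := comp_lipschitz.
have A0 : 0 <= A by have := rA 0%N; rewrite expr1n divr1; exact: le_trans.
have z4 : dec4 A (fun=> 0 : R) by move=> k; rewrite normr0 divr_ge0// exprn_ge0.
apply: (@fourier_inversion _ _ (K * A * A)) => //; first exact: cont_comp_nl rA.
move=> k; have := HK A A r (fun=> 0) A1 rA z4 _ k.
by rewrite cc_comp0 subr0; apply => j; rewrite subr0.
Qed.

End Composition.

(** * Bifurcation of periodic solutions *)

Section Contraction.
Context {R : realType} (p b : R) (S : mode_system p b).
Hypotheses (hp : 1 < p) (hb0 : 0 < b) (hb1 : b < 1).
Ltac plra := have ? := hp; have ? := hb0; have ? := hb1; lra.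

Implicit Types (t : R) (k : nat).
Local Notation w := (prof p b).
Local Notation C := (mC S).
Local Notation phi := (mf S 1).

(** Heights are clamped at 0, so that unknowns and forcing terms are continuous on the whole line,
    as [prim] and [green] expect. *)
Definition pos (t : R) : R := Num.max t 0.

Lemma pos_ge0 t : 0 <= pos t. Proof. by rewrite le_max lexx orbT. Qed.
Lemma posE t : 0 <= t -> pos t = t. Proof. by move=> t0; apply/max_idPl. Qed.
Lemma cont_pos : continuous pos. Proof. exact: cont_maxr. Qed.

(* [a None] is the shift of the squared frequency from [mu S], and
   [a (Some (k, t))] the correction to the [k]-th mode, divided by the
   amplitude [eps]. *)
Definition unknown := option (nat * R) -> R.
Implicit Types (a : unknown).

Definition weight (x : option (nat * R)) : R :=
  if x is Some (k, t) then expR (- pos t) / k.+1%:R ^+ 4 else 1.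

Lemma weight_gt0 x : 0 < weight x.
Proof. by case: x => [[k t]|]//=; rewrite divr_gt0 ?expR_gt0 ?exprn_gt0. Qed.

Lemma weight_le1 x : weight x <= 1.
Proof.
case: x => [[k t]|]//=; rewrite ler_pdivrMr ?exprn_gt0// mul1r.
apply: le_trans (_ : 1 <= _); last by rewrite exprn_ege1// ler1n.
by rewrite -expR0 ler_expR oppr_le0 pos_ge0.
Qed.

Definition profile_coef a k t : R := (if k == 1%N then phi (pos t) else 0) + a (Some (k, t)).

Definition ratio_coef (eps : R) a t k : R := eps * profile_coef a k t / w (pos t).

Definition nonlin (eps : R) a k t : R := w (pos t) `^ p * cc (comp p (ratio_coef eps a t)) k.

Definition ip (F : R -> R) : R := improper (fun s => phi s * F s).

(** The forcing of the correction to mode k, divided by eps: the nonlinearity minus the frequency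
    shift acting on the correction. The shift acting on [phi] itself is added in [forcing]. *)
Definition raw (eps : R) a k t : R :=
  nonlin eps a k t / eps - k%:R ^+ 2 * a None * a (Some (k, t)).

(* The frequency shift that makes the forcing of mode 1 orthogonal to [phi]. *)
Definition newm (eps : R) a : R := ip (raw eps a 1) / ip phi.

(** The new shift [newm], not the old [a None], multiplies [phi]; so orthogonality holds for every
    admissible a, and every iterate of [step] vanishes at height 0. At a fixed point the two shifts
    agree. *)
Definition forcing (eps : R) a k t : R :=
  raw eps a k t - (if k == 1%N then newm eps a * phi (pos t) else 0).

Definition step (eps : R) a : unknown := fun x =>
  if x is Some (k, t) then green S k (forcing eps a k) (pos t) else newm eps a.

Definition admissible (eta : R) a := (forall x, `|a x| <= eta * weight x) /\
  forall k, continuous (fun t => a (Some (k, t))).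

Lemma phi_bound t : 0 <= t -> `|phi t| <= C * expR (- t).
Proof.
move=> t0; apply: le_trans (mf_bound S 1 t0) _.
rewrite ler_wpM2l; [by []|by have := mC_ge1 S; lra|].
by rewrite ler_expR lerN2 ler_peMl// kap_ge1.
Qed.

Lemma cont_phi_pos : continuous (fun t => phi (pos t)).
Proof. by apply: cont_comp; [exact: cont_mf|exact: cont_pos]. Qed.

Lemma phi_sq_gt0 : 0 < ip phi.
Proof.
have [t1 t10 ft1] := mf1_neq0 S.
have cff : continuous (fun s => phi s * phi s) by apply: contM; exact: cont_mf.
have C1 := mC_ge1 S.
have imp : is_improper (fun s => phi s * phi s) (ip phi).
  apply: (@is_improperP _ _ (C * C) 1) => // t t0; rewrite normrM mul1r.
  apply: le_trans (_ : (C * expR (- t)) * (C * 1) <= _); last by rewrite mulr1 mulrAC.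
  apply: ler_pM => //; first exact: phi_bound.
  apply: le_trans (phi_bound t0) _; rewrite ler_wpM2l//; first by lra.
  by rewrite -expR0 ler_expR oppr_le0.
have g0 t : 0 <= t -> 0 <= phi t * phi t by move=> _; rewrite -expr2 sqr_ge0.
apply: lt_le_trans (improper_ge_prim (ltW (addr_gt0 t10 ltr01)) cff imp g0).
pose e := phi t1 * phi t1; have e0 : 0 < e by rewrite /e -expr2 exprn_even_gt0.
have /cvgrPdist_lt /(_ (e / 2) ltac:(by rewrite divr_gt0)) [dl /= dl0 near0] := cff t1.
pose d := Num.min (dl / 2) 1; have d0 : 0 < d by rewrite lt_min ltr01 divr_gt0.
have d1 : d <= 1 by rewrite ge_min lexx orbT.
have d2 : d < dl by apply: le_lt_trans (_ : dl / 2 < _); [rewrite ge_min lexx|lra].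
apply: lt_le_trans (_ : e / 2 * d <= _); first by rewrite mulr_gt0// divr_gt0.
have m1 : 0 <= prim (fun s => phi s * phi s) t1.
  by apply: prim_ge0 => //; [exact: ltW|move=> x /andP[x0 _]; exact: g0].
have m2 : prim (fun s => phi s * phi s) t1 - e / 2 * t1 <=
          prim (fun s => phi s * phi s) (t1 + d) - e / 2 * (t1 + d).
  apply: (@mono_itv _ (fun x => prim (fun s => phi s * phi s) x - e / 2 * x)
     (fun x => phi x * phi x - e / 2 * 1)); first by rewrite lerDl ltW.
    by move=> x _; apply: drvB; [exact: drv_prim|apply: drvZ; exact: drv_id].
  move=> x /andP[x1 x2]; have := near0 x; rewrite /ball_/= distrC ger0_norm ?subr_ge0//.
  by move=> /(_ ltac:(lra)); rewrite -/e ltr_norml => /andP[_]; lra.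
have m3 : prim (fun s => phi s * phi s) (t1 + d) <= prim (fun s => phi s * phi s) (t1 + 1).
  apply: (@mono_itv _ _ (fun s => phi s * phi s)); first by rewrite lerD2l.
    by move=> x _; exact: drv_prim.
  by move=> x /andP[x1 _]; apply: g0; lra.
lra.
Qed.

Lemma cont_prof_pos : continuous (fun t => w (pos t)).
Proof.
apply: cont_comp; last exact: cont_pos.
by apply: drv_continuous => t; exact: (drv_prof hp hb0 hb1).
Qed.

Lemma cont_prof_pow : continuous (fun t => w (pos t) `^ p).
Proof.
move=> t; apply: (@continuous_comp _ _ _ (fun t => w (pos t)) (fun y => y `^ p)).
  exact: cont_prof_pos.
have dp : drv (fun y : R => y `^ p) (w (pos t)) (p * w (pos t) `^ (p - 1)).
  by apply: is_derive1_powR; exact: prof_gt0.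
exact: drv_cont dp.
Qed.

(** The l^1 distance of the coefficient sequences is continuous in t by domination, and it controls
    the sup distance of their cosine sums. *)
Lemma cont_coef_family (A : R) (r : R -> nat -> R) k : A * Zsq <= 2^-1 ->
  (forall t, dec4 A (r t)) -> (forall j, continuous (r^~ j)) ->
  continuous (fun t => cc (comp p (r t)) k).
Proof.
move=> A1 rA cr t; have [K K0 HK] := comp_sup_lipschitz p A1.
have A0 : 0 <= A by have := rA t 0%N; rewrite expr1n divr1; exact: le_trans.
have dM s j : `|r s j - r t j| <= (2 * A) / j.+1%:R ^+ 2.
  have h s' : `|r s' j| <= A / j.+1%:R ^+ 2.
    by have := dec4_sq j (leq0n 2) (rA s'); rewrite expr0 mul1r.
  apply: le_trans (ler_normB _ _) _.
  rewrite [X in _ <= X](_ : _ = A / j.+1%:R ^+ 2 + A / j.+1%:R ^+ 2); last by ring.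
  exact: lerD (h s) (h t).
have cM : cvgn (series (fun j => (2 * A) / j.+1%:R ^+ 2 : R)) by apply: cvg_seriesZ; exact: cvg_inv_sq.
have lim0 : {for t, continuous (fun s => ssum (fun j => `|r s j - r t j|))}.
  apply: (@cont_ssum _ _ (fun j s => `|r s j - r t j|) _ t cM).
    by near=> s => j; rewrite normr_id; exact: dM.
  by move=> j; apply: cvg_norm; apply: cvgB; [exact: cr|exact: cvg_cst].
have z0 : ssum (fun j => `|r t j - r t j|) = 0.
  rewrite (_ : (fun j => _) = (fun j => 0 * (0 : R))); last first.
    by apply/funext => j; rewrite subrr normr0 mulr0.
  by rewrite ssumZ ?mul0r//; apply: (@cvg_dom_sq _ _ 0) => j; rewrite normr0 mul0r.
apply/cvgrPdist_le => e e0.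
have eK : 0 < e / K by rewrite divr_gt0.
have /cvgrPdist_le /(_ _ eK) H := lim0.
near=> s.
have hs : `|ssum (fun j => `|r t j - r t j|) - ssum (fun j => `|r s j - r t j|)| <= e / K by near: s.
rewrite z0 in hs.
rewrite distrC; apply: le_trans (HK (r s) (r t) (e / K) (rA s) (rA t) _ k) _; last first.
  by rewrite mulrC divfK// gt_eqF.
move=> y; rewrite (csumB y (rA s) (rA t)).
rewrite sub0r normrN in hs; apply: le_trans (le_trans (ler_norm _) hs).
apply: ssum_bound.
  by apply: cvg_dom cM _ => j; rewrite normr_id; exact: dM.
by move=> j; rewrite normrM ler_piMr// norm_cos_le1.
Unshelve. all: by end_near.
Qed.

Lemma profile_coef_bound eta a k t : eta <= 1 -> admissible eta a ->
  `|profile_coef a k t| <= (16 * C + 1) * expR (- pos t) / k.+1%:R ^+ 4.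
Proof.
move=> e1 [aw _]; rewrite /profile_coef; apply: le_trans (ler_normD _ _) _.
have := aw (Some (k, t)); rewrite /weight => h.
have E0 := expR_ge0 (- pos t).
have e4 : 0 <= expR (- pos t) / k.+1%:R ^+ 4 by rewrite divr_ge0 ?exprn_ge0.
have h1 : `|a (Some (k, t))| <= expR (- pos t) / k.+1%:R ^+ 4.
  by apply: le_trans h _; rewrite ler_piMl.
rewrite mulrDl mul1r [X in _ <= X]mulrDl; apply: lerD => //.
case: eqVneq => [->|_].
  apply: le_trans (phi_bound (pos_ge0 t)) _.
  have -> : 2 ^+ 4 = 16 :> R by rewrite -natrX.
  rewrite ler_pdivlMr; last by lra.
  lra.
rewrite normr0 divr_ge0 ?exprn_ge0// mulr_ge0//.
by have := mC_ge1 S; lra.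
Qed.

Variable cw : R.
Hypotheses (cw0 : 0 < cw) (cwP : forall t, 0 <= t -> cw * expR (- t) <= w t).

(** The bound on u / (eps w): 16 C covers [phi] in mode 1, where (k + 1)^4 = 16, the 1 covers the
    correction since eta <= 1, and cw is the lower constant of the profile. *)
Definition B0 : R := (16 * C + 1) / cw.

Lemma B0_gt0 : 0 < B0.
Proof. by rewrite /B0 divr_gt0//; have := mC_ge1 S; have := cw0; lra. Qed.

Lemma over_profile (x D : R) t k : 0 <= D -> `|x| <= D * expR (- pos t) / k.+1%:R ^+ 4 ->
  `|x / w (pos t)| <= D / cw / k.+1%:R ^+ 4.
Proof.
move=> D0 h; have w0 := prof_gt0 hp hb0 hb1 (pos t).
rewrite normrM normfV (gtr0_norm w0) ler_pdivrMr//.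
apply: le_trans h _.
have -> : D / cw / k.+1%:R ^+ 4 * w (pos t) = D / cw * w (pos t) / k.+1%:R ^+ 4 by ring.
rewrite ler_wpM2r ?invr_ge0 ?exprn_ge0//.
have -> : D * expR (- pos t) = D / cw * (cw * expR (- pos t)).
  by field; exact: lt0r_neq0.
by rewrite ler_wpM2l ?divr_ge0 ?(ltW cw0)// cwP// pos_ge0.
Qed.

Lemma dec4_ratio eps eta a t : 0 <= eps -> eta <= 1 -> admissible eta a ->
  dec4 (eps * B0) (ratio_coef eps a t).
Proof.
move=> e0 e1 adm k; rewrite /ratio_coef -mulrA normrM (ger0_norm e0) -!mulrA ler_wpM2l//.
rewrite /B0 [X in _ <= X](_ : _ = (16 * C + 1) / cw / k.+1%:R ^+ 4); last by ring.
by apply: over_profile; [have := mC_ge1 S; lra|exact: profile_coef_bound adm].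
Qed.

Lemma dec4_ratioB eps d a a' t : 0 <= eps -> 0 <= d ->
  (forall x, `|a x - a' x| <= d * weight x) ->
  dec4 (eps * (d / cw)) (fun k => ratio_coef eps a t k - ratio_coef eps a' t k).
Proof.
move=> e0 d0 h k; rewrite /ratio_coef /profile_coef.
set u := (if _ then _ else _).
have -> : eps * (u + a (Some (k, t))) / w (pos t) - eps * (u + a' (Some (k, t))) / w (pos t) =
  eps * ((a (Some (k, t)) - a' (Some (k, t))) / w (pos t)) by ring.
rewrite normrM (ger0_norm e0) -mulrA ler_wpM2l//.
by apply: over_profile => //; have := h (Some (k, t)); rewrite /weight mulrA.
Qed.

Lemma cont_ratio eps eta a k : admissible eta a -> continuous (fun t => ratio_coef eps a t k).
Proof.
move=> [_ ca]; rewrite /ratio_coef /profile_coef; apply: contM; last first.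
  by move=> t; apply: cvgV; [rewrite gt_eqF// prof_gt0|exact: cont_prof_pos].
apply: contZ; apply: contD => //.
by case: eqVneq => _; [exact: cont_phi_pos|move=> ?; exact: cvg_cst].
Qed.

Lemma prof_pow_bound : exists2 K, 0 < K & forall t, 0 <= t -> w t `^ p <= K * expR (- (p * t)).
Proof.
have [D [D0 HD]] := prof_ub hp hb0 hb1; exists (D `^ p); first by rewrite powR_gt0.
move=> t t0; have -> : expR (- (p * t)) = expR (- t) `^ p.
  by rewrite -expRM; congr expR; ring.
rewrite -powRM ?expR_ge0 ?(ltW D0)//; apply: ge0_ler_powR; rewrite ?nnegrE; [plra| | |].
- exact: ltW (prof_gt0 hp hb0 hb1 t).
- by rewrite mulr_ge0 ?expR_ge0 ?(ltW D0).
- exact: HD.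
Qed.

Lemma nonlin_lipschitz : exists2 K, 0 < K & forall eps e r r' t k, 0 <= eps ->
  eps * B0 * Zsq <= 2^-1 -> dec4 (eps * B0) r -> dec4 (eps * B0) r' ->
  dec4 e (fun k => r k - r' k) -> 0 <= t ->
  `|w t `^ p * cc (comp p r) k - w t `^ p * cc (comp p r') k| <=
     K * eps * e * expR (- (p * t)) / k.+1%:R ^+ 2.
Proof.
have [K1 K10 HK1] := comp_lipschitz p; have [K2 K20 HK2] := prof_pow_bound.
exists (K2 * (K1 * B0)); first by rewrite mulr_gt0// mulr_gt0// B0_gt0.
move=> eps e r r' t k e0 small rA r'A re t0.
rewrite -mulrBr normrM (ger0_norm (powR_ge0 _ _)).
apply: le_trans (ler_pM (powR_ge0 _ _) (normr_ge0 _) (HK2 t t0) (HK1 _ e r r' small rA r'A re k)) _.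
rewrite [X in X <= _](_ : _ = K2 * (K1 * B0) * eps * e * expR (- (p * t)) / k.+1%:R ^+ 2)//.
by ring.
Qed.

Lemma cont_raw eps eta a k : 0 <= eps -> eta <= 1 -> eps * B0 * Zsq <= 2^-1 ->
  admissible eta a -> continuous (raw eps a k).
Proof.
move=> e0 e1 small adm; apply: contB.
  apply: contM; last by move=> ?; exact: cvg_cst.
  apply: contM; first exact: cont_prof_pow.
  apply: (@cont_coef_family (eps * B0)) => // [t|j]; first exact: dec4_ratio adm.
  exact: cont_ratio adm.
by apply: contZ; case: adm.
Qed.

Lemma cont_forcing eps eta a k : 0 <= eps -> eta <= 1 -> eps * B0 * Zsq <= 2^-1 ->
  admissible eta a -> continuous (forcing eps a k).
Proof.
move=> e0 e1 small adm; apply: contB; first exact: cont_raw adm.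
case: eqVneq => _; last by move=> ?; exact: cvg_cst.
by apply: contZ; exact: cont_phi_pos.
Qed.

Lemma expR_rate k t : 0 <= t -> expR (- (p * t)) <= expR (- (mrate p k * t)).
Proof.
move=> t0; rewrite ler_expR lerN2 ler_wpM2r// /mrate.
by case: ifP => // _; exact: ltW.
Qed.

Lemma ip_bound F A : continuous F -> 0 <= A -> edec A 1 F -> `|ip F| <= C * A.
Proof.
move=> cF A0 HF; have C1 := mC_ge1 S.
have HF' : edec A (mrate p 1) F by [].
have := tail_fF S hp cF A0 HF' (lexx 0).
rewrite tail0; last exact: (@cont_fF _ _ _ S 1 F cF).
rewrite mulr0 oppr0 expR0 !mulr1 => h; apply: le_trans h _.
rewrite ler_pdivrMr ?ler_peMr ?mulr_ge0 ?kap_ge1//; first by lra.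
exact: kap_gt0.
Qed.

Lemma admissible0 eta : 0 <= eta -> admissible eta (fun=> 0).
Proof.
move=> e0; split; first by move=> x; rewrite normr0 mulr_ge0// ltW// weight_gt0.
by move=> k t; exact: cvg_cst.
Qed.

Lemma expR_rate_pos k t : (0 < k)%N -> expR (- t) = expR (- (mrate p k * t)).
Proof. by case: k => // k _; rewrite /mrate/= mul1r. Qed.

(** Both terms are quadratic. In the nonlinearity one power of eps survives the division by eps; the
    product of the shift and the correction contributes eta. *)
Lemma raw_lipschitz : exists2 K, 0 < K & forall eps eta d a a' k t, 0 < eps -> 0 <= eta <= 1 ->
  eps * B0 * Zsq <= 2^-1 -> admissible eta a -> admissible eta a' -> 0 <= d ->
  (forall x, `|a x - a' x| <= d * weight x) -> 0 <= t ->
  `|raw eps a k t - raw eps a' k t| <= K * (eps + eta) * d * expR (- (mrate p k * t)) / k.+1%:R ^+ 2.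
Proof.
have [K K0 HK] := nonlin_lipschitz; have cw0' := cw0.
exists (K / cw + 2); first by rewrite addr_gt0// divr_gt0.
move=> eps eta d a a' k t e0 /andP[eta0 eta1] small adm adm' d0 aa t0.
have n2 : 0 < k.+1%:R ^+ 2 :> R by rewrite exprn_gt0.
have E0 := expR_ge0 (- (mrate p k * t)).
pose X := d * expR (- (mrate p k * t)) / k.+1%:R ^+ 2.
have X0 : 0 <= X by rewrite divr_ge0 ?(ltW n2)// mulr_ge0.
have h1 : `|nonlin eps a k t / eps - nonlin eps a' k t / eps| <= K / cw * eps * X.
  rewrite -mulrBl normrM normfV (gtr0_norm e0) ler_pdivrMr//.
  rewrite /nonlin posE//.
  apply: le_trans (HK eps (eps * (d / cw)) _ _ t k (ltW e0) small _ _ _ t0) _.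
  - exact: dec4_ratio (ltW e0) eta1 adm.
  - exact: dec4_ratio (ltW e0) eta1 adm'.
  - exact: dec4_ratioB (ltW e0) d0 aa.
  have -> : K / cw * eps * X * eps = K * eps * (eps * (d / cw)) * expR (- (mrate p k * t)) / k.+1%:R ^+ 2.
    by rewrite /X; ring.
  rewrite ler_wpM2r ?invr_ge0 ?(ltW n2)// ler_wpM2l//; last exact: expR_rate.
  have d1 : 0 <= d / cw by rewrite divr_ge0// ltW.
  by apply: mulr_ge0; apply: mulr_ge0 => //; exact: ltW.
have h2 : `|k%:R ^+ 2 * a None * a (Some (k, t)) - k%:R ^+ 2 * a' None * a' (Some (k, t))| <= 2 * eta * X.
  (* For k = 0 the product disappears with its factor k^2. Otherwise it would decay only like exp (-
     t), too slowly for the rate p that mode 0 demands. *)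
  case: (posnP k) => [->|kp]; first by rewrite expr0n !mul0r subrr normr0 !mulr_ge0.
  have [aw _] := adm; have [aw' _] := adm'.
  have m1 := aw None; have z1 := aw' (Some (k, t)); have dm := aa None; have dz := aa (Some (k, t)).
  rewrite /weight posE// ?mulr1 in m1 z1 dm dz.
  set Y := expR (- t) / k.+1%:R ^+ 4 in z1 dz.
  have Y0 : 0 <= Y by rewrite divr_ge0 ?expR_ge0 ?exprn_ge0.
  have -> : k%:R ^+ 2 * a None * a (Some (k, t)) - k%:R ^+ 2 * a' None * a' (Some (k, t)) =
    k%:R ^+ 2 * (a None * (a (Some (k, t)) - a' (Some (k, t))) + (a None - a' None) * a' (Some (k, t))) by ring.
  rewrite normrM normrX normr_nat.
  have hh : `|a None * (a (Some (k, t)) - a' (Some (k, t))) + (a None - a' None) * a' (Some (k, t))|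
      <= 2 * eta * d * Y.
    apply: le_trans (ler_normD _ _) _; rewrite !normrM.
    have -> : 2 * eta * d * Y = eta * (d * Y) + d * (eta * Y) by ring.
    by apply: lerD; apply: ler_pM.
  apply: le_trans (ler_wpM2l _ hh) _; first exact: sqr_ge0.
  have -> : 2 * eta * X = k.+1%:R ^+ 2 * (2 * eta * d * Y).
    rewrite /X /Y -(expR_rate_pos _ kp).
    have e (N : R) : N != 0 -> 2 * eta * (d * expR (- t) / N ^+ 2) =
       N ^+ 2 * (2 * eta * d * (expR (- t) / N ^+ 4)) by move=> N0; field.
    by rewrite e.
  rewrite ler_wpM2r ?mulr_ge0// lerXn2r ?nnegrE// ler_nat//.
rewrite /raw.
have -> : nonlin eps a k t / eps - k%:R ^+ 2 * a None * a (Some (k, t)) -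
   (nonlin eps a' k t / eps - k%:R ^+ 2 * a' None * a' (Some (k, t))) =
   (nonlin eps a k t / eps - nonlin eps a' k t / eps) -
   (k%:R ^+ 2 * a None * a (Some (k, t)) - k%:R ^+ 2 * a' None * a' (Some (k, t))) by ring.
apply: le_trans (ler_normB _ _) _; apply: le_trans (lerD h1 h2) _.
have -> : (K / cw + 2) * (eps + eta) * d * expR (- (mrate p k * t)) / k.+1%:R ^+ 2 =
  (K / cw + 2) * (eps + eta) * X by rewrite /X; ring.
have kc : 0 <= K / cw by rewrite divr_ge0// ltW.
have : 0 <= K / cw * eta * X by apply: mulr_ge0 => //; exact: mulr_ge0.
clearbody X.
have : 0 <= eps * X by rewrite mulr_ge0// ltW.
lra.
Qed.

(** Without correction only the nonlinearity at eps phi / w is left; it is of order eps^2 before the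
    division by eps. *)
Lemma raw_zero : exists2 K, 0 < K & forall eps k t, 0 < eps ->
  eps * B0 * Zsq <= 2^-1 -> 0 <= t ->
  `|raw eps (fun=> 0) k t| <= K * eps * expR (- (mrate p k * t)) / k.+1%:R ^+ 2.
Proof.
have [K K0 HK] := nonlin_lipschitz; have B00 := B0_gt0.
exists (K * B0); first by rewrite mulr_gt0.
move=> eps k t e0 small t0.
have eB : 0 <= eps * B0 by rewrite mulr_ge0// ltW.
have n2 : 0 < k.+1%:R ^+ 2 :> R by rewrite exprn_gt0.
rewrite /raw !mulr0 subr0 normrM normfV (gtr0_norm e0) ler_pdivrMr// /nonlin posE//.
have d1 : dec4 (eps * B0) (ratio_coef eps (fun=> 0) t).
  by apply: (@dec4_ratio _ 0) => //; [exact: ltW|exact: admissible0].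
have d2 : dec4 (eps * B0) (fun=> 0 : R).
  by move=> j; rewrite normr0 divr_ge0// exprn_ge0.
have := HK eps (eps * B0) _ (fun=> 0) t k (ltW e0) small d1 d2 _ t0.
rewrite cc_comp0 mulr0 subr0 => h.
apply: le_trans (h _) _; first by move=> j; rewrite subr0; exact: d1.
have -> : K * B0 * eps * expR (- (mrate p k * t)) / k.+1%:R ^+ 2 * eps =
   K * eps * (eps * B0) * expR (- (mrate p k * t)) / k.+1%:R ^+ 2 by ring.
rewrite ler_wpM2r ?invr_ge0 ?(ltW n2)// ler_wpM2l ?expR_rate//.
by rewrite mulr_ge0// mulr_ge0// ltW.
Qed.

Lemma raw_decay eps eta a k : 0 < eps -> 0 <= eta <= 1 -> eps * B0 * Zsq <= 2^-1 ->
  admissible eta a -> exists2 A, 0 <= A & edec A (mrate p k) (raw eps a k).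
Proof.
move=> e0 eta1 small adm; have [K K0 HK] := raw_lipschitz; have [K' K'0 HK'] := raw_zero.
have /andP[eta0 _] := eta1.
exists (K * (eps + eta) * eta + K' * eps).
  by rewrite addr_ge0// ?mulr_ge0 ?addr_ge0// ltW.
move=> t t0; have adm0 := admissible0 eta0.
have aa x : `|a x - 0| <= eta * weight x by rewrite subr0; case: adm.
have h1 := HK eps eta eta a (fun=> 0) k t e0 eta1 small adm adm0 eta0 aa t0.
have h2 := HK' eps k t e0 small t0.
rewrite -[X in `|X|](subrK (raw eps (fun=> 0) k t)).
apply: le_trans (ler_normD _ _) _; rewrite mulrDl; apply: lerD.
- apply: le_trans h1 _; rewrite ler_pdivrMr ?exprn_gt0// ler_peMr//.
    by rewrite mulr_ge0 ?expR_ge0// mulr_ge0// mulr_ge0 ?addr_ge0// ltW.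
  by rewrite exprn_ege1// ler1n.
- apply: le_trans h2 _; rewrite ler_pdivrMr ?exprn_gt0// ler_peMr//.
    by rewrite mulr_ge0 ?expR_ge0// mulr_ge0// ltW.
  by rewrite exprn_ege1// ler1n.
Qed.

Lemma ip_improper F A : continuous F -> 0 <= A -> edec A 1 F ->
  is_improper (fun s => phi s * F s) (ip F).
Proof.
move=> cF A0 HF; have HF' : edec A (mrate p 1) F by [].
exact: (is_improper_fF S hp cF A0 HF').
Qed.

Lemma ipB F G A : continuous F -> continuous G -> 0 <= A -> edec A 1 F -> edec A 1 G ->
  ip (fun t => F t - G t) = ip F - ip G.
Proof.
move=> cF cG A0 HF HG; rewrite /ip -improperB.
- by congr improper; apply/funext => s; rewrite mulrBr.
- exact: (@cont_fF _ _ _ S 1 F cF).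
- exact: (@cont_fF _ _ _ S 1 G cG).
- exact: ip_improper HF.
- exact: ip_improper HG.
Qed.

Lemma newm_lipschitz : exists2 K, 0 < K & forall eps eta d a a', 0 < eps -> 0 <= eta <= 1 ->
  eps * B0 * Zsq <= 2^-1 -> admissible eta a -> admissible eta a' -> 0 <= d ->
  (forall x, `|a x - a' x| <= d * weight x) ->
  `|newm eps a - newm eps a'| <= K * (eps + eta) * d.
Proof.
have [K K0 HK] := raw_lipschitz; have C1 := mC_ge1 S; have n0 := phi_sq_gt0.
exists (C * K / ip phi); first by rewrite divr_gt0// mulr_gt0//; lra.
move=> eps eta d a a' e0 eta1 small adm adm' d0 aa.
have /andP[eta0 etale] := eta1.
have ca : continuous (raw eps a 1) := cont_raw (ltW e0) etale small adm.
have ca' : continuous (raw eps a' 1) := cont_raw (ltW e0) etale small adm'.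
have [A A0 HA] := raw_decay 1 e0 eta1 small adm.
have [A' A'0 HA'] := raw_decay 1 e0 eta1 small adm'.
have inc B B' F : B <= B' -> edec B (mrate p 1) F -> edec B' (mrate p 1) F.
  by move=> BB HB t t0; apply: le_trans (HB t t0) _; rewrite ler_wpM2r ?expR_ge0.
rewrite /newm -mulrBl -(@ipB _ _ (A + A'))//; [|exact: addr_ge0| |]; last 2 first.
- by apply: inc HA; rewrite lerDl.
- by apply: inc HA'; rewrite lerDr.
rewrite normrM normfV (gtr0_norm n0) ler_pdivrMr//.
have D0 : 0 <= K * (eps + eta) * d by rewrite mulr_ge0// mulr_ge0 ?addr_ge0// ltW.
apply: le_trans (@ip_bound _ (K * (eps + eta) * d) _ D0 _) _; first exact: contB.
  move=> t t0; apply: le_trans (HK eps eta d a a' 1 t e0 eta1 small adm adm' d0 aa t0) _.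
  rewrite ler_pdivrMr ?exprn_gt0// ler_peMr//; first by rewrite mulr_ge0 ?expR_ge0.
  by rewrite exprn_ege1// ler1n.
rewrite [X in _ <= X](_ : _ = C * (K * (eps + eta) * d))//.
by field; exact: lt0r_neq0.
Qed.

Lemma newm_zero : exists2 K, 0 < K & forall eps, 0 < eps -> eps * B0 * Zsq <= 2^-1 ->
  `|newm eps (fun=> 0)| <= K * eps.
Proof.
have [K K0 HK] := raw_zero; have C1 := mC_ge1 S; have n0 := phi_sq_gt0.
exists (C * K / ip phi); first by rewrite divr_gt0// mulr_gt0//; lra.
move=> eps e0 small; rewrite /newm normrM normfV (gtr0_norm n0) ler_pdivrMr//.
have D0 : 0 <= K * eps by rewrite mulr_ge0// ltW.
apply: le_trans (@ip_bound _ (K * eps) _ D0 _) _.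
- exact: cont_raw (ltW e0) ler01 small (admissible0 (lexx 0)).
- move=> t t0; apply: le_trans (HK eps 1%N t e0 small t0) _.
  rewrite ler_pdivrMr ?exprn_gt0// ler_peMr//; first by rewrite mulr_ge0 ?expR_ge0.
  by rewrite exprn_ege1// ler1n.
rewrite [X in _ <= X](_ : _ = C * (K * eps))//.
by field; exact: lt0r_neq0.
Qed.

Lemma phi_mode_bound (x : R) k t : 0 <= t ->
  `|if k == 1%N then x * phi (pos t) else 0| <= 4 * C * `|x| * expR (- (mrate p k * t)) / k.+1%:R ^+ 2.
Proof.
move=> t0; have C1 := mC_ge1 S; case: eqVneq => [->|_].
  have -> : 2 ^+ 2 = 4 :> R by rewrite -natrX.
  rewrite -(expR_rate_pos _ (ltn0Sn 0)) posE// normrM.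
  rewrite [X in _ <= X](_ : _ = `|x| * (C * expR (- t))); last by field.
  by rewrite ler_wpM2l// phi_bound.
rewrite normr0 divr_ge0 ?exprn_ge0// mulr_ge0 ?expR_ge0// mulr_ge0// mulr_ge0//; lra.
Qed.

Lemma forcing_lipschitz : exists2 K, 0 < K & forall eps eta d a a' k t, 0 < eps -> 0 <= eta <= 1 ->
  eps * B0 * Zsq <= 2^-1 -> admissible eta a -> admissible eta a' -> 0 <= d ->
  (forall x, `|a x - a' x| <= d * weight x) -> 0 <= t ->
  `|forcing eps a k t - forcing eps a' k t| <=
     K * (eps + eta) * d / k.+1%:R ^+ 2 * expR (- (mrate p k * t)).
Proof.
have [K K0 HK] := raw_lipschitz; have [K' K'0 HK'] := newm_lipschitz; have C1 := mC_ge1 S.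
exists (K + 4 * C * K'); first by rewrite addr_gt0// mulr_gt0// mulr_gt0//; lra.
move=> eps eta d a a' k t e0 eta1 small adm adm' d0 aa t0.
have h1 := HK eps eta d a a' k t e0 eta1 small adm adm' d0 aa t0.
have h2 := HK' eps eta d a a' e0 eta1 small adm adm' d0 aa.
have h3 := phi_mode_bound (newm eps a - newm eps a') k t0.
rewrite /forcing.
have -> : raw eps a k t - (if k == 1%N then newm eps a * phi (pos t) else 0) -
  (raw eps a' k t - (if k == 1%N then newm eps a' * phi (pos t) else 0)) =
  (raw eps a k t - raw eps a' k t) -
  (if k == 1%N then (newm eps a - newm eps a') * phi (pos t) else 0).
  by case: ifP => _; ring.
apply: le_trans (ler_normB _ _) _; apply: le_trans (lerD h1 h3) _.
set E := expR _; have E0 : 0 <= E by exact: expR_ge0.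
have X0 : 0 <= E / k.+1%:R ^+ 2 by rewrite divr_ge0 ?exprn_ge0.
have -> : (K + 4 * C * K') * (eps + eta) * d / k.+1%:R ^+ 2 * E =
  K * (eps + eta) * d * E / k.+1%:R ^+ 2 + 4 * C * (K' * (eps + eta) * d) * (E / k.+1%:R ^+ 2) by ring.
rewrite lerD2l -mulrA ler_wpM2r// ler_wpM2l//; lra.
Qed.

Lemma forcing_zero : exists2 K, 0 < K & forall eps k t, 0 < eps -> eps * B0 * Zsq <= 2^-1 ->
  0 <= t -> `|forcing eps (fun=> 0) k t| <= K * eps / k.+1%:R ^+ 2 * expR (- (mrate p k * t)).
Proof.
have [K K0 HK] := raw_zero; have [K' K'0 HK'] := newm_zero; have C1 := mC_ge1 S.
exists (K + 4 * C * K'); first by rewrite addr_gt0// mulr_gt0// mulr_gt0//; lra.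
move=> eps k t e0 small t0.
have h1 := HK eps k t e0 small t0; have h2 := HK' eps e0 small.
have h3 := phi_mode_bound (newm eps (fun=> 0)) k t0.
rewrite /forcing; apply: le_trans (ler_normB _ _) _; apply: le_trans (lerD h1 h3) _.
set E := expR _; have E0 : 0 <= E by exact: expR_ge0.
have X0 : 0 <= E / k.+1%:R ^+ 2 by rewrite divr_ge0 ?exprn_ge0.
have -> : (K + 4 * C * K') * eps / k.+1%:R ^+ 2 * E =
  K * eps * E / k.+1%:R ^+ 2 + 4 * C * (K' * eps) * (E / k.+1%:R ^+ 2) by ring.
rewrite lerD2l -mulrA ler_wpM2r// ler_wpM2l//; lra.
Qed.

Lemma forcing_decay eps eta a k : 0 < eps -> 0 <= eta <= 1 -> eps * B0 * Zsq <= 2^-1 ->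
  admissible eta a -> exists2 A, 0 <= A & edec A (mrate p k) (forcing eps a k).
Proof.
move=> e0 eta1 small adm; have [A A0 HA] := raw_decay k e0 eta1 small adm.
have C1 := mC_ge1 S.
exists (A + 4 * C * `|newm eps a|).
  by rewrite addr_ge0// mulr_ge0// mulr_ge0//; lra.
move=> t t0; apply: le_trans (ler_normB _ _) _; rewrite mulrDl; apply: lerD; first exact: HA.
apply: le_trans (phi_mode_bound _ _ t0) _.
rewrite ler_pdivrMr ?exprn_gt0// ler_peMr//.
  by rewrite mulr_ge0 ?expR_ge0// mulr_ge0// mulr_ge0//; lra.
by rewrite exprn_ege1// ler1n.
Qed.

Lemma step_lipschitz : exists2 K, 0 < K & forall eps eta d a a', 0 < eps -> 0 <= eta <= 1 ->
  eps * B0 * Zsq <= 2^-1 -> admissible eta a -> admissible eta a' -> 0 <= d ->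
  (forall x, `|a x - a' x| <= d * weight x) ->
  forall x, `|step eps a x - step eps a' x| <= K * (eps + eta) * d * weight x.
Proof.
have [K K0 HK] := forcing_lipschitz; have [K' K'0 HK'] := newm_lipschitz.
have [G G0 HG] := green_bound S hp.
exists (G * K + K'); first by rewrite addr_gt0// mulr_gt0.
move=> eps eta d a a' e0 eta1 small adm adm' d0 aa x.
have /andP[eta0 etale] := eta1.
have ee : 0 <= eps + eta by rewrite addr_ge0// ltW.
case: x => [[k t]|]; last first.
  rewrite /= mulr1; apply: le_trans (HK' eps eta d a a' e0 eta1 small adm adm' d0 aa) _.
  by rewrite ler_wpM2r// ler_wpM2r// lerDr mulr_ge0// ltW.
rewrite /= ; have t0 := pos_ge0 t.
have ca : continuous (forcing eps a k) := cont_forcing (ltW e0) etale small adm.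
have ca' : continuous (forcing eps a' k) := cont_forcing (ltW e0) etale small adm'.
have [A A0 HA] := forcing_decay k e0 eta1 small adm.
have [A' A'0 HA'] := forcing_decay k e0 eta1 small adm'.
have inc B B' F : B <= B' -> edec B (mrate p k) F -> edec B' (mrate p k) F.
  by move=> BB HB s s0; apply: le_trans (HB s s0) _; rewrite ler_wpM2r ?expR_ge0.
have HA1 : edec (A + A') (mrate p k) (forcing eps a k) by apply: inc HA; rewrite lerDl.
have HA2 : edec (A + A') (mrate p k) (forcing eps a' k) by apply: inc HA'; rewrite lerDr.
rewrite -(greenB S hp (addr_ge0 A0 A'0) ca ca' HA1 HA2 t0).
have D0 : 0 <= K * (eps + eta) * d / k.+1%:R ^+ 2.
  by rewrite divr_ge0 ?exprn_ge0// mulr_ge0// mulr_ge0// ltW.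
have [h _] := HG k _ _ D0 (contB ca ca')
  (fun s s0 => HK eps eta d a a' k s e0 eta1 small adm adm' d0 aa s0) (pos t) t0.
apply: le_trans h _.
have X0 : 0 <= (eps + eta) * d * (expR (- pos t) / k.+1%:R ^+ 4).
  by rewrite mulr_ge0 ?mulr_ge0// divr_ge0 ?expR_ge0 ?exprn_ge0.
have e (N : R) : N != 0 -> G * (K * (eps + eta) * d / N ^+ 2) / N ^+ 2 * expR (- pos t) =
  G * K * ((eps + eta) * d * (expR (- pos t) / N ^+ 4)) by move=> N0; field.
rewrite e// [X in _ <= X](_ : _ = (G * K + K') * ((eps + eta) * d * (expR (- pos t) / k.+1%:R ^+ 4))); last by ring.
by rewrite ler_wpM2r// lerDl ltW.
Qed.

Lemma step_zero : exists2 K, 0 < K & forall eps, 0 < eps -> eps * B0 * Zsq <= 2^-1 ->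
  forall x, `|step eps (fun=> 0) x| <= K * eps * weight x.
Proof.
have [K K0 HK] := forcing_zero; have [K' K'0 HK'] := newm_zero.
have [G G0 HG] := green_bound S hp.
exists (G * K + K'); first by rewrite addr_gt0// mulr_gt0.
move=> eps e0 small x; case: x => [[k t]|]; last first.
  rewrite /= mulr1; apply: le_trans (HK' eps e0 small) _.
  by rewrite ler_wpM2r// ?(ltW e0)// lerDr mulr_ge0// ltW.
rewrite /=; have t0 := pos_ge0 t.
have ca : continuous (forcing eps (fun=> 0) k) :=
  cont_forcing (ltW e0) ler01 small (admissible0 (lexx 0)).
have D0 : 0 <= K * eps / k.+1%:R ^+ 2.
  by rewrite divr_ge0 ?exprn_ge0// mulr_ge0// ltW.
have [h _] := HG k _ _ D0 ca (fun s s0 => HK eps k s e0 small s0) (pos t) t0.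
apply: le_trans h _.
have X0 : 0 <= eps * (expR (- pos t) / k.+1%:R ^+ 4).
  by rewrite mulr_ge0 ?(ltW e0)// divr_ge0 ?expR_ge0 ?exprn_ge0.
have e (N : R) : N != 0 -> G * (K * eps / N ^+ 2) / N ^+ 2 * expR (- pos t) =
  G * K * (eps * (expR (- pos t) / N ^+ 4)) by move=> N0; field.
rewrite e// [X in _ <= X](_ : _ = (G * K + K') * (eps * (expR (- pos t) / k.+1%:R ^+ 4))); last by ring.
by rewrite ler_wpM2r// lerDl ltW.
Qed.

Lemma cont_step eps eta a k : 0 < eps -> 0 <= eta <= 1 -> eps * B0 * Zsq <= 2^-1 ->
  admissible eta a -> continuous (fun t => step eps a (Some (k, t))).
Proof.
move=> e0 /andP[eta0 eta1] small adm.
apply: (@cont_green _ _ _ S); exact: cont_forcing (ltW e0) eta1 small adm.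
Qed.

(** The last two conditions give, respectively, the contraction factor 1/2 and an image of 0 within
    eta / 2; together they map the ball of radius eta into itself. *)
Lemma fixed_point : exists2 K, 0 < K & forall eps eta, 0 < eps -> 0 < eta <= 1 ->
  eps * B0 * Zsq <= 2^-1 -> K * (eps + eta) <= 2^-1 -> K * eps <= eta / 2 ->
  exists a, admissible eta a /\ step eps a = a.
Proof.
have [K1 K10 HK1] := step_lipschitz; have [K2 K20 HK2] := step_zero.
exists (K1 + K2); first by rewrite addr_gt0.
move=> eps eta e0 /andP[eta0 eta1] small c1 c2.
have eta01 : 0 <= eta <= 1 by rewrite (ltW eta0).
have ee : 0 <= eps + eta by rewrite addr_ge0 ?ltW.
have c1' : K1 * (eps + eta) <= 2^-1 by apply: le_trans c1; rewrite ler_wpM2r// lerDl ltW.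
have c2' : K2 * eps <= eta / 2 by apply: le_trans c2; rewrite ler_wpM2r ?(ltW e0)// lerDr ltW.
have w0 x := ltW (weight_gt0 x).
have adm0 := admissible0 (ltW eta0).
have base x : `|step eps (fun=> 0) x| <= eta / 2 * weight x.
  by apply: le_trans (HK2 eps e0 small x) _; rewrite ler_wpM2r.
have contr a a' d : admissible eta a -> admissible eta a' -> 0 <= d ->
    (forall x, `|a x - a' x| <= d * weight x) ->
    forall x, `|step eps a x - step eps a' x| <= d / 2 * weight x.
  move=> adm adm' d0 aa x.
  apply: le_trans (HK1 eps eta d a a' e0 eta01 small adm adm' d0 aa x) _.
  rewrite ler_wpM2r// mulrC ler_wpM2l//.
apply: (@weighted_contraction _ _ weight (admissible eta) (step eps) (fun=> 0) (eta / 2)) => //.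
- by rewrite divr_ge0// ltW.
- move=> a adm; split; last by move=> k; exact: cont_step small adm.
  move=> x; have aa y : `|a y - 0| <= eta * weight y by rewrite subr0; case: adm.
  have h1 := contr a (fun=> 0) eta adm adm0 (ltW eta0) aa x; have h2 := base x.
  rewrite -[X in `|X|](subrK (step eps (fun=> 0) x)).
  apply: le_trans (ler_normD _ _) _; apply: le_trans (lerD h1 h2) _.
  by rewrite -mulrDl -splitr.
- by move=> x; rewrite subr0.
- move=> u a admu ua; split.
    move=> x; rewrite -subr_le0; apply: (@le0_half _ _ (2 * (eta / 2) * weight x)) => n.
    have [h _] := admu n; have := h x; have := ua n x.
    have := ler_normD (a x - u n x) (u n x); rewrite subrK => h1 h2 h3.
    rewrite lerBlDr; apply: le_trans h1 (lerD _ h3).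
    by rewrite mulrAC.
  move=> k; apply: (@continuous_half_limit _ (fun n t => u n (Some (k, t))) _ (2 * (eta / 2))).
    by move=> n; case: (admu n).
  move=> n t; apply: le_trans (ua n (Some (k, t))) _.
  by rewrite ler_piMr ?weight_le1// divr_ge0 ?exprn_ge0// mulr_ge0// divr_ge0// ltW.
Qed.

(** A single A for all modes with an explicit k^-2, as required to sum the first and second
    derivatives of the modes in t. *)
Lemma forcing_bound eps eta a : 0 < eps -> 0 <= eta <= 1 -> eps * B0 * Zsq <= 2^-1 ->
  admissible eta a -> exists2 A, 0 <= A &
  forall k, edec (A / k.+1%:R ^+ 2) (mrate p k) (forcing eps a k).
Proof.
move=> e0 eta1 small adm; have /andP[eta0 _] := eta1.
have [K K0 HK] := forcing_lipschitz; have [K' K'0 HK'] := forcing_zero.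
exists (K * (eps + eta) * eta + K' * eps).
  by rewrite addr_ge0// ?mulr_ge0 ?addr_ge0// ltW.
move=> k t t0; have adm0 := admissible0 eta0.
have aa x : `|a x - 0| <= eta * weight x by rewrite subr0; case: adm.
have h1 := HK eps eta eta a (fun=> 0) k t e0 eta1 small adm adm0 eta0 aa t0.
have h2 := HK' eps k t e0 small t0.
rewrite -[X in `|X|](subrK (forcing eps (fun=> 0) k t)).
apply: le_trans (ler_normD _ _) _; apply: le_trans (lerD h1 h2) _.
by rewrite -!mulrDl.
Qed.

Lemma forcing_orthogonal eps eta a : 0 < eps -> 0 <= eta <= 1 -> eps * B0 * Zsq <= 2^-1 ->
  admissible eta a -> improper (fun s => phi s * forcing eps a 1 s) = 0.
Proof.
move=> e0 eta1 small adm; have /andP[eta0 etale] := eta1.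
have ca : continuous (raw eps a 1) := cont_raw (ltW e0) etale small adm.
have [A A0 HA] := raw_decay 1 e0 eta1 small adm.
have C1 := mC_ge1 S; have n0 := phi_sq_gt0.
have cp : continuous (fun t => newm eps a * phi (pos t)) by apply: contZ; exact: cont_phi_pos.
pose D := `|newm eps a| * C; have D0 : 0 <= D by rewrite mulr_ge0//; lra.
have HD : edec D 1 (fun t => newm eps a * phi (pos t)).
  by move=> t t0; rewrite posE// normrM mul1r -mulrA ler_wpM2l// phi_bound.
have inc B B' F : B <= B' -> edec B 1 F -> edec B' 1 F.
  by move=> BB HB t t0; apply: le_trans (HB t t0) _; rewrite ler_wpM2r ?expR_ge0.
have H1 : edec (A + D) 1 (raw eps a 1) by apply: inc HA; rewrite lerDl.
have H2 : edec (A + D) 1 (fun t => newm eps a * phi (pos t)) by apply: inc HD; rewrite lerDr.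
have := ipB ca cp (addr_ge0 A0 D0) H1 H2; rewrite /ip => ->.
have cpp : continuous (fun s => phi s * phi (pos s)) by apply: contM; [exact: cont_mf|exact: cont_phi_pos].
have -> : (fun s => phi s * (newm eps a * phi (pos s))) = (fun s => newm eps a * (phi s * phi (pos s))).
  by apply/funext => s; rewrite mulrCA.
have cff : continuous (fun s => phi s * phi s) by apply: contM; exact: cont_mf.
have e : improper (fun s => phi s * phi (pos s)) = ip phi.
  rewrite /ip -(tail0 cpp) -(tail0 cff); apply: eq_tail => // x x0.
  by rewrite posE.
rewrite improperZ//; last first.
  apply: (@ip_improper _ C); [exact: cont_phi_pos|by lra|].
  by move=> t t0; rewrite posE// mul1r phi_bound.
by rewrite e /newm divfK ?subrr// gt_eqF.
Qed.

End Contraction.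

(** The exponents 4, 3, 2 make all second derivatives of the sum over k converge: each derivative in
    y costs a factor k, each one in t lowers the exponent by one. A bounds the distance to w, a the
    ratio to w. *)
Record periodic_modes {R : realType} (p b om : R) (u u' u'' : nat -> R -> R) (A B a : R) : Prop :=
  PeriodicModes {
  pm_drv : forall k t, 0 <= t -> drv (u k) t (u' k t);
  pm_drv' : forall k t, 0 <= t -> drv (u' k) t (u'' k t);
  pm_cont'' : forall k t, 0 <= t -> {for t, continuous (u'' k)};
  pm_bound : forall k t, 0 <= t -> `|u k t| <= A * expR (- t) / k.+1%:R ^+ 4;
  pm_bound' : forall k t, 0 <= t -> `|u' k t| <= B / k.+1%:R ^+ 3;
  pm_bound'' : forall k t, 0 <= t -> `|u'' k t| <= B / k.+1%:R ^+ 2;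
  pm_zero : forall k, u k 0 = 0;
  pm_small : a * Zsq <= 2^-1;
  pm_ratio : forall t, 0 <= t -> dec4 a (fun k => u k t / prof p b t);
  pm_eq : forall k t, 0 <= t -> u'' k t = (1 + k%:R ^+ 2 * om ^+ 2 - pot p b t) * u k t -
     prof p b t `^ p * cc (comp p (fun k => u k t / prof p b t)) k
}.

Lemma ssum_single {R : realType} (f : nat -> R) j : (forall k, k != j -> f k = 0) -> ssum f = f j.
Proof.
move=> f0; apply/cvg_lim => //; apply: cvg_near_cst.
exists j.+1 => // n /= jn; rewrite /series/= big_mkord (bigD1 (Ordinal jn))//= big1 ?addr0//.
by move=> i ij; apply: f0.
Qed.

Lemma ex_periodic_modes (R : realType) (p b : R) : 1 < p -> 0 < b -> b < 1 ->
  exists2 T : R, 0 < T & forall d, 0 < d -> exists om u u' u'' A B a,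
    [/\ 0 < om, periodic_modes p b om u u' u'' A B a, A * Zsq <= d &
        csum (u ^~ T) 0 <> csum (u ^~ T) pi].
Proof.
move=> hp hb0 hb1; have [S] := ex_mode_system hp hb0 hb1.
(* T is fixed before d, so that the ranges of all the solutions are compared at one and the same
   height. *)
have [T T0 fT] := mf1_neq0 S; exists T => // d d0.
have [cw [cw0 cwP]] := prof_lb hp hb0 hb1.
have [K K0 HK] := fixed_point S hp hb0 hb1 cw0 cwP.
have [G G0 HG] := green_bound S hp.
have C1 := mC_ge1 S; set C := mC S in C1.
have Z1 : 1 <= Zsq :> R := Zsq_ge1.
have m0 := mu_gt0 S.
have B00 := B0_gt0 S cw0; set B := B0 S cw in B00.
have Z0 : 0 < Zsq :> R by lra.
have fT0 : 0 < `|mf S 1 T| by rewrite normr_gt0.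
(* The four bounds serve, in this order, the a priori estimates, the contraction, the positivity of
   the squared frequency, and the dominance of [phi] over the corrections at height T. *)
pose eta := Num.min (Num.min 1 (4 * K)^-1) (Num.min (mu S / 2) (`|mf S 1 T| / (2 * Zsq))).
have eta0 : 0 < eta.
  by rewrite !lt_min ltr01 invr_gt0 mulr_gt0//= !divr_gt0// mulr_gt0.
have eta1 : eta <= 1 by rewrite !ge_min lexx.
have etaK : eta <= (4 * K)^-1 by rewrite !ge_min lexx !orbT.
have etam : eta <= mu S / 2 by rewrite !ge_min lexx !orbT.
have etaf : eta <= `|mf S 1 T| / (2 * Zsq) by rewrite !ge_min lexx !orbT.
pose D := 16 * C + 1; have D0 : 0 < D by rewrite /D; lra.
(* The four bounds serve, in this order, the contraction, the invariance of the ball of radius eta,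
   the ratio to w below 1/2, and the required distance d. *)
pose eps := Num.min (Num.min (4 * K)^-1 (eta / (2 * K))) (Num.min (2 * (B * Zsq))^-1 (d / (D * Zsq))).
have eps0 : 0 < eps.
  rewrite !lt_min; apply/andP; split; apply/andP; split; rewrite ?invr_gt0 ?divr_gt0//.
  - by rewrite mulr_gt0.
  - by rewrite mulr_gt0.
  - by rewrite mulr_gt0// mulr_gt0.
  - by rewrite mulr_gt0.
have e1 : eps <= (4 * K)^-1 by rewrite !ge_min lexx.
have e2 : eps <= eta / (2 * K) by rewrite !ge_min lexx !orbT.
have e3 : eps <= (2 * (B * Zsq))^-1 by rewrite !ge_min lexx !orbT.
have e4 : eps <= d / (D * Zsq) by rewrite !ge_min lexx !orbT.
have small : eps * B * Zsq <= 2^-1.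
  rewrite -mulrA; apply: le_trans (ler_wpM2r _ e3) _; first by rewrite mulr_ge0 ?ltW.
  by rewrite invfM mulfVK// gt_eqF// mulr_gt0.
have k1 : K * (eps + eta) <= 2^-1.
  apply: le_trans (_ : K * ((4 * K)^-1 + (4 * K)^-1) <= _).
    by rewrite ler_wpM2l ?(ltW K0)// lerD.
  rewrite [X in X <= _](_ : _ = 2^-1)//; field; exact: lt0r_neq0.
have k2 : K * eps <= eta / 2.
  apply: le_trans (ler_wpM2l (ltW K0) e2) _.
  rewrite [X in X <= _](_ : _ = eta / 2)//; field; exact: lt0r_neq0.
have eta01 : 0 < eta <= 1 by rewrite eta0.
have eta01' : 0 <= eta <= 1 by rewrite ltW.
have [a [adm fix_a]] := HK eps eta eps0 eta01 small k1 k2.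
have [F F0 HF] := forcing_bound hp hb0 hb1 cw0 cwP eps0 eta01' small adm.
have cF k : continuous (forcing S eps a k).
  exact: (cont_forcing hp hb0 hb1 cw0 cwP (ltW eps0) eta1 small adm).
pose Z k t := green S k (forcing S eps a k) t.
pose Z' k t := green' S k (forcing S eps a k) t.
have aZ k t : 0 <= t -> a (Some (k, t)) = Z k t.
  by move=> t0; rewrite -[in LHS]fix_a /step posE.
have am : newm S eps a = a None by rewrite -[in RHS]fix_a.
have [aw ca] := adm.
have om0 : 0 < mu S + a None.
  have := aw None; rewrite /= mulr1 ler_norml => /andP[h _]; clear -h etam m0; lra.
pose om := Num.sqrt (mu S + a None).
have om2 : om ^+ 2 = mu S + a None by rewrite sqr_sqrtr// ltW.
pose u k t := eps * ((if k == 1%N then mf S 1 t else 0) + Z k t).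
pose u' k t := eps * ((if k == 1%N then mf' S 1 t else 0) + Z' k t).
pose u'' k t := (kap S k ^+ 2 - pot p b t) * u k t - eps * forcing S eps a k t.
have uE k t : 0 <= t -> u k t = eps * profile_coef S a k t.
  by move=> t0; rewrite /u /profile_coef posE// aZ.
have ratE t : 0 <= t -> (fun k => u k t / prof p b t) = ratio_coef S eps a t.
  by move=> t0; apply/funext => k; rewrite /ratio_coef (posE t0) (uE _ _ t0).
have du k t : 0 <= t -> drv (u k) t (u' k t).
  move=> t0; apply: drvZ; apply: drvD; last by apply: drv_green.
  by case: eqVneq => _; [exact: drv_mf|exact: drv_cst].
have du' k t : 0 <= t -> drv (u' k) t (u'' k t).
  move=> t0; apply: drv_eq.
    apply: drvZ; apply: drvD; last by apply: drv_green'.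
    have : drv (fun t => if k == 1%N then mf' S 1 t else 0) t
       ((if k == 1%N then (kap S k ^+ 2 - pot p b t) * mf S 1 t else 0)).
      by case: eqVneq => [->|_]; [exact: drv_mf'|exact: drv_cst].
    exact.
  by rewrite /u'' /u -/(Z k t); case: ifP => _; ring.
have ub k t : 0 <= t -> `|u k t| <= eps * D * expR (- t) / k.+1%:R ^+ 4.
  move=> t0; rewrite uE// normrM (gtr0_norm eps0) -!mulrA ler_wpM2l ?(ltW eps0)//.
  have := profile_coef_bound S k t eta1 adm; rewrite posE// -/C -/D => h.
  by apply: le_trans h _; rewrite -mulrA.
have pb t : `|pot p b t| <= 2 * p * (p + 1) := pot_bound hp hb0 hb1 t.
have eA t : 0 <= t -> expR (- t) <= 1 :> R by move=> t0; rewrite -expR0 ler_expR oppr_le0.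
have rate1 k t : 0 <= t -> expR (- (mrate p k * t)) <= 1.
  by move=> t0; rewrite -expR0 ler_expR oppr_le0 mulr_ge0//; exact: le_trans ler01 (mrate_ge1 hp k).
have Zb' k t : 0 <= t -> `|Z' k t| <= G * F / k.+1%:R ^+ 3.
  move=> t0; have FF : 0 <= F / k.+1%:R ^+ 2 by rewrite divr_ge0 ?exprn_ge0.
  have [_ h] := HG k _ _ FF (cF k) (HF k) t t0.
  apply: le_trans h _; rewrite [X in _ <= X](_ : _ = G * (F / k.+1%:R ^+ 2) / k.+1%:R); last first.
    have e (N : R) : N != 0 -> G * F / N ^+ 3 = G * (F / N ^+ 2) / N by move=> N0; field.
    by rewrite e.
  by rewrite ler_piMr ?eA// divr_ge0// mulr_ge0// ltW.
pose B1 := eps * (8 * (C * kap S 1) + G * F).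
pose B2 := (C ^+ 2 + 2 * p * (p + 1)) * (eps * D) + eps * F.
have kap0 := kap_gt0 S.
have CK0 : 0 <= C * kap S 1 by rewrite mulr_ge0 ?(ltW (kap0 _))//; exact: le_trans ler01 C1.
have B10 : 0 <= B1.
  apply: (mulr_ge0 (ltW eps0)); apply: addr_ge0; first exact: mulr_ge0.
  exact: (mulr_ge0 (ltW G0)).
have pp0 : 0 <= 2 * p * (p + 1) by clear -hp; do !apply: mulr_ge0 => //; lra.
have B20 : 0 <= B2.
  apply: addr_ge0; last exact: (mulr_ge0 (ltW eps0)).
  apply: mulr_ge0; last exact: (mulr_ge0 (ltW eps0) (ltW D0)).
  by apply: addr_ge0; [exact: sqr_ge0|].
exists om, u, u', u'', (eps * D), (B1 + B2), (eps * B); split.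
- by rewrite sqrtr_gt0.
- split.
  + exact: du.
  + exact: du'.
  + move=> k t t0; apply: cvgB; last by apply: cvgM; [exact: cvg_cst|exact: cF].
    apply: cvgM; last exact: drv_cont (du k t t0).
    apply: cvgB; first exact: cvg_cst.
    have cz : continuous (zeta p b) by apply: drv_continuous => s; exact: drv_zeta.
    have cpot : continuous (pot p b).
      by apply: contM; [exact: contZ|apply: contB => // ?; exact: cvg_cst].
    exact: cpot.
  + exact: ub.
  + move=> k t t0; apply: le_trans (_ : B1 / k.+1%:R ^+ 3 <= _); last first.
      by rewrite ler_wpM2r ?invr_ge0 ?exprn_ge0// lerDl.
    rewrite /u' normrM (gtr0_norm eps0) /B1 -mulrA ler_wpM2l ?(ltW eps0)//.
    apply: le_trans (ler_normD _ _) _; rewrite mulrDl; apply: lerD; last exact: Zb'.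
    case: eqVneq => [->|_]; last by rewrite normr0 divr_ge0 ?exprn_ge0// mulr_ge0.
    have -> : 2 ^+ 3 = 8 :> R by rewrite -natrX.
    rewrite [X in _ <= X](_ : _ = C * kap S 1); last by field.
    apply: le_trans (mf'_bound S 1 t0) _; rewrite ler_piMr//.
    by rewrite -expR0 ler_expR oppr_le0 mulr_ge0// ltW.
  + move=> k t t0; apply: le_trans (_ : B2 / k.+1%:R ^+ 2 <= _); last first.
      by rewrite ler_wpM2r ?invr_ge0 ?exprn_ge0// lerDr.
    have n2 : 1 <= k.+1%:R ^+ 2 :> R by rewrite exprn_ege1// ler1n.
    rewrite /u''; apply: le_trans (ler_normB _ _) _; rewrite /B2 [X in _ <= X]mulrDl; apply: lerD.
      rewrite normrM.
      have h1 : `|kap S k ^+ 2 - pot p b t| <= (C ^+ 2 + 2 * p * (p + 1)) * k.+1%:R ^+ 2.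
        apply: le_trans (ler_normB _ _) _; rewrite mulrDl; apply: lerD.
          rewrite ger0_norm ?sqr_ge0// -exprMn lerXn2r ?nnegrE ?(ltW (kap0 _))//.
            by apply: mulr_ge0 => //; exact: le_trans ler01 C1.
          exact: kap_ub.
        by apply: le_trans (pb t) _; rewrite ler_peMr.
      have h2 : `|u k t| <= eps * D / k.+1%:R ^+ 4.
        apply: le_trans (ub k t t0) _; rewrite ler_wpM2r ?invr_ge0 ?exprn_ge0//.
        by rewrite ler_piMr ?eA// mulr_ge0 ?ltW.
      apply: le_trans (ler_pM (normr_ge0 _) (normr_ge0 _) h1 h2) _.
      have e (X N : R) : N != 0 -> X * N ^+ 2 * (eps * D / N ^+ 4) = X * (eps * D) / N ^+ 2.
        by move=> N0; field.
      by rewrite e.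
    rewrite normrM (gtr0_norm eps0) -mulrA ler_wpM2l ?(ltW eps0)//.
    apply: le_trans (HF k t t0) _; rewrite ler_piMr ?rate1// divr_ge0 ?exprn_ge0//.
  + move=> k; rewrite /u /Z (green0 (cF k)); last first.
      case: (eqVneq k 1%N) => [->|k1']; [right|by left].
      exact: (forcing_orthogonal hp hb0 hb1 cw0 cwP eps0 eta01' small adm).
    by case: eqVneq => [_|_]; rewrite ?mf1_zero addr0 mulr0.
  + by [].
  + move=> t t0; rewrite ratE//.
    exact: (dec4_ratio S hp hb0 hb1 cw0 cwP t (ltW eps0) eta1 adm).
  + move=> k t t0; rewrite ratE// om2 /u'' /forcing /raw /nonlin posE// am kap_sq.
    have ak : a (Some (k, t)) = Z k t by exact: aZ.
    rewrite ak.
    have -> : eps * (prof p b t `^ p * cc (comp p (ratio_coef S eps a t)) k / eps -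
        k%:R ^+ 2 * a None * Z k t - (if k == 1%N then a None * mf S 1 t else 0)) =
      prof p b t `^ p * cc (comp p (ratio_coef S eps a t)) k -
        k%:R ^+ 2 * a None * (eps * Z k t) - eps * (if k == 1%N then a None * mf S 1 t else 0).
      by field; exact: lt0r_neq0.
    rewrite /u -/(Z k t); move: (cc _ k) (Z k t) (prof p b t `^ p) (pot p b t) (mu S) (a None) => X z w q m n.
    clear; case: eqVneq => [->|_]; last by move: (k%:R ^+ 2 : R) => H; clear; ring.
    by rewrite expr1n; move: (mf S 1 t) => f; clear; ring.
- apply: le_trans (_ : d / (D * Zsq) * (D * Zsq) <= _).
    by rewrite -(mulrA eps); apply: ler_wpM2r => //; apply: mulr_ge0; exact: ltW.
  by rewrite divfK// gt_eqF// mulr_gt0.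
- have decz : dec4 eta (fun k => a (Some (k, T))).
    move=> k; apply: le_trans (aw (Some (k, T))) _; rewrite /= posE ?(ltW T0)//.
    apply: (ler_wpM2l (ltW eta0)); apply: ler_piMl; first by rewrite invr_ge0 exprn_ge0.
    by apply: eA; exact: ltW.
  have decp : dec4 D (fun k => profile_coef S a k T).
    move=> k; apply: le_trans (profile_coef_bound S k T eta1 adm) _.
    rewrite -/C -/D ler_wpM2r ?invr_ge0 ?exprn_ge0// ler_piMr ?(ltW D0)//.
    by rewrite posE ?(ltW T0)// eA// ltW.
  have val y : csum (u^~ T) y = eps * (mf S 1 T * cos y + csum (fun k => a (Some (k, T))) y).
    have -> : csum (u^~ T) y = eps * csum (fun k => profile_coef S a k T) y.
      rewrite /csum -ssumZ; last by apply: (@cvg_dom_sq _ _ D) => k; exact: (csum_term k y decp).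
      by congr ssum; apply/funext => k; rewrite uE ?(ltW T0)// mulrA.
    congr (_ * _); rewrite -[LHS](subrK (csum (fun k => a (Some (k, T))) y)); congr (_ + _).
    rewrite (csumB y decp decz) /csum (@ssum_single _ _ 1%N).
      by rewrite /profile_coef posE ?(ltW T0)// addrK mul1r.
    by move=> k k1'; rewrite /profile_coef (negbTE k1') add0r subrr mul0r.
  (* At y = 0 and y = pi the first mode contributes phi(T) and - phi(T), which differ by 2 |phi(T)|,
     while the two corrections differ by at most |phi(T)|. *)
  rewrite !val => /(mulfI (lt0r_neq0 eps0)); rewrite cos0 cospi.
  have h y : `|csum (fun k => a (Some (k, T))) y| <= `|mf S 1 T| / 2.
    apply: le_trans (csum_bound y decz) _.
    apply: le_trans (ler_wpM2r (ltW Z0) etaf) _.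
    rewrite [X in X <= _](_ : _ = `|mf S 1 T| / 2)//; field; exact: lt0r_neq0.
  have := h 0; have := h pi; set c0 := csum _ 0; set c1 := csum _ pi; set f := mf S 1 T in fT0 *.
  case: (ltrgtP f 0) fT0 => [fn|fp|->] fT0; last by rewrite normr0 ltxx in fT0.
    by rewrite (ltr0_norm fn) !ler_norml; clear -fn; move=> /andP[? ?] /andP[? ?] e; lra.
  by rewrite (gtr0_norm fp) !ler_norml; clear -fp; move=> /andP[? ?] /andP[? ?] e; lra.
Qed.

(** * Solutions on the half space *)

Section ModeSums.
Variable R : realType.
Implicit Types (f g : nat -> R -> R) (F : R -> R -> R) (y t C D : R).

Definition msum f g y t : R := ssum (fun k => f k t * g k y).

(** The margin 2 makes the products with functions of growth of order j summable. Positive heights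
    suffice for the calculus in the open half space. *)
Definition decays j C f := forall k t, 0 < t -> `|f k t| <= C / k.+1%:R ^+ (j + 2).
Definition grows j D g := forall k y, `|g k y| <= D * k.+1%:R ^+ j.

Lemma decays_le i j C f : (i <= j)%N -> decays j C f -> decays i C f.
Proof.
move=> ij fC k t t0; have C0 : 0 <= C.
  by have := le_trans (normr_ge0 _) (fC 0%N 1 ltr01); rewrite expr1n divr1.
apply: le_trans (fC k t t0) _; apply: (ler_wpM2l C0).
by rewrite lef_pV2 ?posrE ?exprn_gt0// ler_weXn2l ?ler1n// leq_add2r.
Qed.

Lemma msum_term j C D f g k y t : decays j C f -> grows j D g -> 0 < t ->
  `|f k t * g k y| <= C * D / k.+1%:R ^+ 2.
Proof.
move=> fC gD t0; rewrite normrM; apply: le_trans (ler_pM _ _ (fC k t t0) (gD k y)) _ => //.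
have e (N : R) : N != 0 -> C / N ^+ (j + 2) * (D * N ^+ j) = C * D / N ^+ 2.
  by move=> N0; rewrite exprD; field; rewrite N0 expf_neq0.
by rewrite e.
Qed.

Lemma cvg_msum j C D f g y t : decays j C f -> grows j D g -> 0 < t ->
  cvgn (series (fun k => f k t * g k y)).
Proof. by move=> fC gD t0; apply: (@cvg_dom_sq _ _ (C * D)) => k; exact: msum_term fC gD t0. Qed.

Lemma cont_msum j C D f g (z : R * R) : decays j C f -> grows j D g -> 0 < z.2 ->
  (forall k, {for z.2, continuous (f k)}) -> (forall k, continuous (g k)) ->
  {for z, continuous (fun z => msum f g z.1 z.2)}.
Proof.
move=> fC gD z0 cf cg.
apply: (@cont_ssum _ _ (fun k z => f k z.2 * g k z.1) (fun k => C * D * (k.+1%:R ^+ 2)^-1)).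
- by apply: cvg_seriesZ; exact: cvg_inv_sq.
- have : \forall x \near z, 0 < x.2.
    have c2 : (fun x : R * R => x.2) @ z --> z.2 by exact: cvg_snd.
    exact: (cvgr_gt _ c2).
  by apply: filterS => x x0 n; exact: msum_term fC gD x0.
- move=> k; apply: cvgM.
    by apply: (@cvg_comp _ _ _ snd (f k) _ _ _ _ (cf k)); exact: cvg_snd.
  by apply: (@cvg_comp _ _ _ fst (g k) _ _ _ _ (cg k z.1)); exact: cvg_fst.
Qed.

Lemma drv_msum_t j C C' D f f' g y t : decays j C f -> decays j C' f' -> grows j D g ->
  (forall k s, 0 < s -> drv (f k) s (f' k s)) -> 0 < t ->
  drv (msum f g y) t (msum f' g y t).
Proof.
move=> fC fC' gD df t0.
have pos s : `|s - t| < t -> 0 < s by rewrite ltr_norml => /andP[? _]; lra.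
have cC E := cvg_seriesZ (c:=E) (@cvg_inv_sq R).
apply: (@drv_ssum _ (fun k s => f k s * g k y) (fun k s => f' k s * g k y) _ _ t t t0 (cC (C' * D)) (cC (C * D))).
- by move=> k s /pos s0; have := drvZ (g k y) (df k s s0); rewrite mulrC; apply: drv_near; near=> x; rewrite mulrC.
- by move=> k s /pos s0; exact: msum_term fC' gD s0.
- by move=> k; exact: msum_term fC gD t0.
Unshelve. all: by end_near.
Qed.

Lemma drv_msum_y j C D D' f g g' y t : decays j C f -> grows j D g -> grows j D' g' ->
  (forall k y, drv (g k) y (g' k y)) -> 0 < t ->
  drv (msum f g ^~ t) y (msum f g' y t).
Proof.
move=> fC gD gD' dg t0.
have cC E := cvg_seriesZ (c:=E) (@cvg_inv_sq R).
apply: (@drv_ssum _ (fun k y => f k t * g k y) (fun k y => f k t * g' k y) _ _ y 1 ltr01 (cC (C * D')) (cC (C * D))).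
- by move=> k s _; apply: drvZ.
- by move=> k s _; exact: msum_term fC gD' t0.
- by move=> k; exact: msum_term fC gD t0.
Qed.

End ModeSums.

Section Trig.
Variables (R : realType) (om : R).
Hypothesis om0 : 0 < om.

Definition trig0 (k : nat) (y : R) : R := cos (k%:R * (om * y)).
Definition trig1 (k : nat) (y : R) : R := - (k%:R * om) * sin (k%:R * (om * y)).
Definition trig2 (k : nat) (y : R) : R := - (k%:R * om) ^+ 2 * cos (k%:R * (om * y)).

Lemma drv_trig_arg (k : nat) (y : R) : drv (fun y => k%:R * (om * y)) y (k%:R * om).
Proof. by apply: drvZ; apply: drv_eq (drvZ om (drv_id y)) _; rewrite mulr1. Qed.

Lemma drv_trig0 k y : drv (trig0 k) y (trig1 k y).
Proof. by apply: drv_eq (drv_cos (drv_trig_arg k y)) _; rewrite /trig1 mulrC mulrN mulNr. Qed.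

Lemma drv_trig1 k y : drv (trig1 k) y (trig2 k y).
Proof. by apply: drv_eq (drvZ _ (drv_sin (drv_trig_arg k y))) _; rewrite /trig2; ring. Qed.

Lemma drv_trig2 k y : drv (trig2 k) y (- (k%:R * om) ^+ 2 * (- sin (k%:R * (om * y)) * (k%:R * om))).
Proof. exact: drvZ (drv_cos (drv_trig_arg k y)). Qed.

Lemma grows_trig0 : grows 0 1 trig0.
Proof. by move=> k y; rewrite expr0 mulr1 norm_cos_le1. Qed.

Lemma freq_le k : `|k%:R * om| <= om * k.+1%:R.
Proof.
have o := ltW om0; rewrite ger0_norm ?mulr_ge0// mulrC; apply: (ler_wpM2l o).
by rewrite ler_nat.
Qed.

Lemma grows_trig1 : grows 1 om trig1.
Proof.
move=> k y; rewrite normrM normrN expr1; apply: le_trans (freq_le k).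
by rewrite ler_piMr ?norm_sin_le1.
Qed.

Lemma grows_trig2 : grows 2 (om ^+ 2) trig2.
Proof.
move=> k y; rewrite normrM normrN normrX -exprMn.
apply: le_trans (ler_piMr _ (norm_cos_le1 _)) _; first exact: sqr_ge0.
by apply: lerXn2r (freq_le k); rewrite nnegrE// mulr_ge0// ltW.
Qed.

End Trig.

Lemma sum_two (R : nmodType) (I : finType) (i j : I) (G : I -> R) : i != j ->
  (forall k, k != i -> k != j -> G k = 0) -> \sum_k G k = G i + G j.
Proof.
move=> ij G0; rewrite (bigD1 i)//= (bigD1 j)/=; last by rewrite eq_sym.
by rewrite big1 ?addr0// => k /andP[ki kj]; exact: G0.
Qed.

Lemma near_eq_cont (T U : topologicalType) (f g : T -> U) x : {near x, f =1 g} ->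
  {for x, continuous f} -> {for x, continuous g}.
Proof.
move=> n h; have e := nbhs_singleton n; rewrite /prop_for /continuous_at -e.
by apply: cvg_trans h; exact: near_eq_cvg.
Qed.

(** * Calculus for functions of one tangential variable and the height *)

Section HalfSpaceCalculus.
Variables (R : realType) (N : nat).
Local Notation X := 'RN[R]_N.
Local Notation U := (half_space (R:=R) (N:=N)).
Implicit Types (x e : X) (v f g : X -> R).

Lemma is_derive_line v x e d : drv (fun s => v (x + s *: e)) 0 d -> is_derive x e v d.
Proof.
move=> [h1 h2].
have E : (fun h : R => h^-1 *: (((fun s => v (x + s *: e)) \o shift 0) (h *: (1 : R)) - v (x + 0 *: e))) =
    (fun h => h^-1 *: ((v \o shift x) (h *: e) - v x)).
  by apply/funext => h /=; rewrite addr0 scale0r addr0 /GRing.scale/= mulr1 [x + _]addrC.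
split; first by move: h1; rewrite /derivable E.
by rewrite -h2 /derive E.
Qed.

Lemma height_pt (x' : 'rV[R]_(N.-1)) t : height (pt x' t) = t.
Proof. by rewrite /height /pt row_mxKr mxE. Qed.

Lemma tang_pt (x' : 'rV[R]_(N.-1)) t : tang (pt x' t) = x'.
Proof. by rewrite /tang /pt row_mxKl. Qed.

Lemma cont_height : continuous (@height R N).
Proof.
have -> : @height R N = (fun x : X => x 0 (rshift N.-1 0)) by apply/funext => x; rewrite /height mxE.
by move=> x; exact: coord_continuous.
Qed.

Lemma near_half_space x : x \in U -> \forall z \near x, z \in U.
Proof.
rewrite inE => x0; have := @cont_height x.
move/(cvgr_gt (height x)) => /(_ _ x0); apply: filterS => z z0.
by rewrite inE.
Qed.

Lemma eq_C1_on v w : (forall x, x \in U -> v x = w x) -> C1_on U w -> C1_on U v.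
Proof.
move=> vw [cw dw].
have nvw x : x \in U -> {near x, w =1 v}.
  by move=> xU; apply: filterS (near_half_space xU) => z zU; rewrite vw.
split; first by move=> x xU; exact: near_eq_cont (nvw x xU) (cw x xU).
move=> i; have [di ci] := dw i.
have pE x : x \in U -> partial i w x = partial i v x.
  by move=> xU; exact: near_eq_derive (nvw x xU).
split; first by move=> x xU; apply: near_eq_derivable (di x xU); exact: nvw.
move=> x xU; apply: near_eq_cont (ci x xU).
by apply: filterS (near_half_space xU) => z zU; rewrite pE.
Qed.

Variable j : 'I_(N.-1).

(** The solutions vary in a single tangential direction j, so regularity and the Laplacian reduce to
    two real variables. *)
Definition pull (F : R -> R -> R) : X -> R := fun x => F (tang x 0 j) (height x).

Definition jcont (F : R -> R -> R) :=
  forall z : R * R, 0 < z.2 -> {for z, continuous (fun z => F z.1 z.2)}.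

Lemma cont_pull F : jcont F -> {in U, continuous (pull F)}.
Proof.
move=> cF x; rewrite inE => x0.
have cx : (fun z : X => (tang z 0 j, height z)) @ x --> (tang x 0 j, height x).
  apply: (@cvg_pair _ _ _ (nbhs x) (nbhs _) (nbhs _) _ _ _ (fun z : X => tang z 0 j) (@height R N)); last exact: cont_height.
  rewrite /= (_ : (fun z : X => tang z 0 j) = (fun z : X => z 0 (lshift 1 j))); last first.
    by apply/funext => z; rewrite /tang mxE.
  by rewrite /tang mxE; exact: coord_continuous.
exact: (@cvg_comp _ _ _ (fun z : X => (tang z 0 j, height z)) (fun z => F z.1 z.2) _ _ _ cx (cF (tang x 0 j, height x) x0)).
Qed.

Definition pull_partial (Fy Ft : R -> R -> R) (i : 'I_(N.-1 + 1)) : R -> R -> R :=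
  if i == lshift 1 j then Fy else if i == rshift N.-1 0 then Ft else fun _ _ => 0.

Lemma derive_pull F Fy Ft i x :
  (forall y t, 0 < t -> drv (F ^~ t) y (Fy y t)) ->
  (forall y t, 0 < t -> drv (F y) t (Ft y t)) -> x \in U ->
  is_derive x (delta_mx 0 i) (pull F) (pull (pull_partial Fy Ft i) x).
Proof.
rewrite inE => dy dt x0; apply: is_derive_line.
have tg s e : tang (x + s *: e) 0 j = tang x 0 j + s * e 0 (lshift 1 j) by rewrite /tang !mxE.
have hg s e : height (x + s *: e) = height x + s * e 0 (rshift N.-1 0) by rewrite /height !mxE.
rewrite /pull /pull_partial.
under eq_fun do rewrite tg hg.
have dE k : (delta_mx 0 i : X) 0 k = (i == k)%:R by rewrite mxE eqxx eq_sym.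
rewrite !dE.
case: eqVneq => [->|_].
  rewrite eq_lrshift /=.
  under eq_fun do rewrite mulr0 addr0 mulr1.
  apply: (drv_eq _ (mulr1 _)); apply: (@drv_comp _ (F ^~ (height x))).
    by rewrite addr0; exact: dy.
  by apply: drv_eq (drvD (drv_cst _ _) (drv_id _)) _; rewrite add0r.
case: eqVneq => _ /=; last first.
  under eq_fun do rewrite mulr0 !addr0.
  exact: drv_cst.
under eq_fun do rewrite mulr0 addr0 mulr1.
apply: (drv_eq _ (mulr1 _)); apply: (@drv_comp _ (F (tang x 0 j))).
  by rewrite addr0; exact: dt.
by apply: drv_eq (drvD (drv_cst _ _) (drv_id _)) _; rewrite add0r.
Qed.

Lemma jcont_partial Fy Ft i : jcont Fy -> jcont Ft -> jcont (pull_partial Fy Ft i).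
Proof.
move=> cy ct; rewrite /pull_partial; case: ifP => // _; case: ifP => // _ z _.
exact: cvg_cst.
Qed.

Lemma partial_pull F Fy Ft i x :
  (forall y t, 0 < t -> drv (F ^~ t) y (Fy y t)) ->
  (forall y t, 0 < t -> drv (F y) t (Ft y t)) -> x \in U ->
  partial i (pull F) x = pull (pull_partial Fy Ft i) x.
Proof. by move=> dy dt xU; have [_] := derive_pull i dy dt xU. Qed.

Lemma C1_pull F Fy Ft :
  (forall y t, 0 < t -> drv (F ^~ t) y (Fy y t)) ->
  (forall y t, 0 < t -> drv (F y) t (Ft y t)) ->
  jcont F -> jcont Fy -> jcont Ft -> C1_on U (pull F).
Proof.
move=> dy dt cF cy ct; split; first exact: cont_pull.
move=> i; split; first by move=> x xU; have [] := derive_pull i dy dt xU.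
have cp : {in U, continuous (pull (pull_partial Fy Ft i))}.
  by apply: cont_pull; exact: jcont_partial.
move=> x xU; apply: near_eq_cont (cp x xU).
by apply: filterS (near_half_space xU) => z zU; rewrite (partial_pull i dy dt zU).
Qed.

Lemma C1_zero : C1_on U (pull (fun _ _ => 0)).
Proof.
by apply: C1_pull => [y t _|y t _|z _|z _|z _]; try exact: drv_cst; exact: cvg_cst.
Qed.

Variables (F Fy Ft Fyy Fyt Ftt : R -> R -> R).
Hypotheses (dy : forall y t, 0 < t -> drv (F ^~ t) y (Fy y t))
  (dt : forall y t, 0 < t -> drv (F y) t (Ft y t))
  (dyy : forall y t, 0 < t -> drv (Fy ^~ t) y (Fyy y t))
  (dyt : forall y t, 0 < t -> drv (Fy y) t (Fyt y t))
  (dty : forall y t, 0 < t -> drv (Ft ^~ t) y (Fyt y t))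
  (dtt : forall y t, 0 < t -> drv (Ft y) t (Ftt y t)).
Hypotheses (cF : jcont F) (cy : jcont Fy) (ct : jcont Ft)
  (cyy : jcont Fyy) (cyt : jcont Fyt) (ctt : jcont Ftt).

Lemma C2_pull : C2_on U (pull F).
Proof.
split; first exact: C1_pull dy dt cF cy ct.
move=> i; apply: eq_C1_on (fun x xU => partial_pull i dy dt xU) _.
rewrite /pull_partial; case: ifP => _; first exact: C1_pull dyy dyt cy cyy cyt.
by case: ifP => _; [exact: C1_pull dty dtt ct cyt ctt|exact: C1_zero].
Qed.

Lemma laplacian_pull x : U x -> laplacian (pull F) x = pull Fyy x + pull Ftt x.
Proof.
move=> x0; have xU : x \in U by rewrite inE.
have E i : partial i (partial i (pull F)) x = partial i (pull (pull_partial Fy Ft i)) x.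
  apply: near_eq_derive => //.
  by apply: filterS (near_half_space xU) => z zU; rewrite (partial_pull i dy dt zU).
rewrite /laplacian (@sum_two R _ (lshift 1 j) (rshift N.-1 0)); first last.
  move=> i /negbTE i1 /negbTE i2; rewrite E /pull_partial i1 i2.
  rewrite (@partial_pull _ (fun _ _ => 0) (fun _ _ => 0)) => [|y t _|y t _|//]; try exact: drv_cst.
  by rewrite /pull_partial i1 i2.
  by rewrite eq_lrshift.
rewrite !E /pull_partial !eqxx (eq_sym (rshift _ _)) eq_lrshift.
rewrite (partial_pull _ dyy dyt xU) (partial_pull _ dty dtt xU).
by rewrite /pull_partial !eqxx (eq_sym (rshift _ _)) eq_lrshift.
Qed.

End HalfSpaceCalculus.

Lemma jcont_msum (R : realType) j (C D : R) (f g : nat -> R -> R) : decays j C f -> grows j D g ->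
  (forall k (t : R), 0 < t -> {for t, continuous (f k)}) -> (forall k, continuous (g k)) ->
  jcont (msum f g).
Proof. by move=> fC gD cf cg z z0; exact: (cont_msum fC gD z0 (fun k => cf k _ z0) cg). Qed.

(** The value cos (k x) is the k-th Chebyshev polynomial in cos x; the three-term recursion makes
    the induction carry two consecutive indices. *)
Lemma cos_mul_eq (R : realType) (x y : R) : cos x = cos y -> forall k : nat, cos (k%:R * x) = cos (k%:R * y).
Proof.
move=> xy k.
suff : cos (k%:R * x) = cos (k%:R * y) /\ cos (k.+1%:R * x) = cos (k.+1%:R * y) by case.
have rec (z : R) (n : nat) : cos (n.+2%:R * z) = 2 * cos z * cos (n.+1%:R * z) - cos (n%:R * z).
  have -> : n.+2%:R * z = n.+1%:R * z + z by rewrite -[in LHS]natr1 mulrDl mul1r.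
  have -> : n%:R * z = n.+1%:R * z - z by rewrite -natr1; ring.
  by rewrite cosD cosB; ring.
elim: k => [|k [IH1 IH2]]; first by rewrite !mul0r !mul1r.
by split=> //; rewrite !rec IH1 IH2 xy.
Qed.

(* Both sides depend on [y] only through [cos y]. *)
Lemma comp_inversion_all (R : realType) (p A : R) (r : nat -> R) (y : R) : A * Zsq <= 2^-1 -> dec4 A r ->
  comp p r y = ssum (fun k => cc (comp p r) k * cosn k y).
Proof.
move=> A1 rA; have yc : -1 <= cos y <= 1 by rewrite cos_geN1 cos_le1.
have [hz cz] := acos_def yc; have E := cos_mul_eq cz.
have := comp_inversion p A1 rA hz.
have -> : comp p r (acos (cos y)) = comp p r y.
  by rewrite /comp /csum; congr (nl p (ssum _)); apply/funext => k; rewrite E.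
by move=> ->; congr ssum; apply/funext => k; rewrite /cosn E.
Qed.

Lemma powR_pred (R : realType) (x p : R) : 0 < x -> x `^ p = x `^ (p - 1) * x.
Proof.
move=> x0; rewrite -[X in _ = _ * X](powRr1 (ltW x0)) -powRD ?subrK//.
by rewrite (gt_eqF x0) implybT.
Qed.

(** * Summing the modes: regularity, positivity and the equation in two variables *)

Section Solution.
Variables (R : realType) (p b om : R) (u u' u'' : nat -> R -> R) (A B a : R).
Hypotheses (hp : 1 < p) (hb0 : 0 < b) (hb1 : b < 1) (om0 : 0 < om).
Hypothesis H : periodic_modes p b om u u' u'' A B a.
Local Notation w := (prof p b).
Local Notation c0 := (trig0 om).
Local Notation c1 := (trig1 om).
Local Notation c2 := (trig2 om).
Let w_gt0 t : 0 < w t := prof_gt0 hp hb0 hb1 t.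

Lemma amplitude_ge0 : 0 <= A.
Proof.
have := le_trans (normr_ge0 _) (pm_bound H 0%N (lexx 0)).
by rewrite oppr0 expR0 expr1n divr1 mulr1.
Qed.

Lemma decays_u : decays 2 A u.
Proof.
move=> k t t0; apply: le_trans (pm_bound H k (ltW t0)) _.
apply: ler_wpM2r; first by rewrite invr_ge0 exprn_ge0.
by rewrite ler_piMr ?amplitude_ge0// -expR0 ler_expR oppr_le0 ltW.
Qed.

Lemma decays_u' : decays 1 B u'.
Proof. by move=> k t t0; apply: (pm_bound' H); exact: ltW. Qed.

Lemma decays_u'' : decays 0 B u''.
Proof. by move=> k t t0; apply: (pm_bound'' H); exact: ltW. Qed.

Let du k t (t0 : 0 < t) : drv (u k) t (u' k t) := pm_drv H k (ltW t0).
Let du' k t (t0 : 0 < t) : drv (u' k) t (u'' k t) := pm_drv' H k (ltW t0).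
Let dec_u0 : decays 0 A u := decays_le (leq0n 2) decays_u.
Let dec_u1 : decays 1 A u := decays_le (isT : (1 <= 2)%N) decays_u.
Let dec_u'0 : decays 0 B u' := decays_le (leq0n 1) decays_u'.
Let g0 := grows_trig0 om.
Let g1 := grows_trig1 om0.
Let g2 := grows_trig2 om0.

Definition sol y t := w t + msum u c0 y t.
Definition sol_t y t := prof' p b t + msum u' c0 y t.
Definition sol_tt y t := (1 - 2 * (p + 1) * zeta p b t * (1 - zeta p b t)) * w t + msum u'' c0 y t.

Lemma grows_lift i j (D : R) (g : nat -> R -> R) : (i <= j)%N -> 0 <= D -> grows i D g -> grows j D g.
Proof.
move=> ij D0 gD k y; apply: le_trans (gD k y) _; apply: (ler_wpM2l D0).
by apply: ler_weXn2l => //; rewrite ler1n.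
Qed.

Lemma drv_sol_t y t : 0 < t -> drv (sol y) t (sol_t y t).
Proof.
move=> t0; apply: drvD (drv_prof hp hb0 hb1 t) _.
exact: drv_msum_t dec_u0 dec_u'0 g0 du t0.
Qed.

Lemma drv_sol_tt y t : 0 < t -> drv (sol_t y) t (sol_tt y t).
Proof.
move=> t0; apply: drvD (drv_prof' hp hb0 hb1 t) _.
exact: drv_msum_t dec_u'0 decays_u'' g0 du' t0.
Qed.

Lemma drv_sol_y y t : 0 < t -> drv (sol ^~ t) y (msum u c1 y t).
Proof.
move=> t0; apply: drv_eq (add0r _); apply: drvD (drv_cst _ _) _.
apply: drv_msum_y dec_u1 (grows_lift _ _ g0) g1 (drv_trig0 om) t0 => //.
Qed.

Lemma drv_sol_yy y t : 0 < t -> drv (msum u c1 ^~ t) y (msum u c2 y t).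
Proof.
move=> t0; apply: drv_msum_y decays_u (grows_lift _ _ g1) g2 (drv_trig1 om) t0 => //; exact: ltW.
Qed.

Lemma drv_sol_yt y t : 0 < t -> drv (msum u c1 y) t (msum u' c1 y t).
Proof. by move=> t0; exact: drv_msum_t dec_u1 decays_u' g1 du t0. Qed.

Lemma drv_sol_ty y t : 0 < t -> drv (sol_t ^~ t) y (msum u' c1 y t).
Proof.
move=> t0; apply: drv_eq (add0r _); apply: drvD (drv_cst _ _) _.
apply: drv_msum_y decays_u' (grows_lift _ _ g0) g1 (drv_trig0 om) t0 => //.
Qed.

Lemma jcont_height (f : R -> R) : continuous f -> jcont (fun _ t => f t).
Proof. by move=> cf z _; apply: (@cvg_comp _ _ _ snd f _ _ _ _ (cf z.2)); exact: cvg_snd. Qed.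

Lemma jcontD (F G : R -> R -> R) : jcont F -> jcont G -> jcont (fun y t => F y t + G y t).
Proof. by move=> cF cG z z0; apply: cvgD; [exact: cF|exact: cG]. Qed.

Let cu k t (t0 : 0 < t) : {for t, continuous (u k)} := drv_cont (du k t0).
Let cu' k t (t0 : 0 < t) : {for t, continuous (u' k)} := drv_cont (du' k t0).
Let cu'' k t (t0 : 0 < t) : {for t, continuous (u'' k)} := pm_cont'' H (ltW t0).
Let cc0 k : continuous (c0 k) := drv_continuous (drv_trig0 om k).
Let cc1 k : continuous (c1 k) := drv_continuous (drv_trig1 om k).
Let cc2 k : continuous (c2 k) := drv_continuous (drv_trig2 om k).

Lemma jcont_sol : jcont sol.
Proof.
apply: jcontD; first by apply: jcont_height; apply: drv_continuous (drv_prof hp hb0 hb1).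
exact: (jcont_msum dec_u0 g0 cu cc0).
Qed.

Lemma jcont_sol_t : jcont sol_t.
Proof.
apply: jcontD; first by apply: jcont_height; apply: drv_continuous (drv_prof' hp hb0 hb1).
exact: (jcont_msum dec_u'0 g0 cu' cc0).
Qed.

Lemma jcont_sol_tt : jcont sol_tt.
Proof.
apply: jcontD; first by apply: jcont_height; apply: drv_continuous (drv_prof'' hp hb0 hb1).
exact: (jcont_msum decays_u'' g0 cu'' cc0).
Qed.

Lemma jcont_sol_y : jcont (msum u c1).
Proof. exact: (jcont_msum dec_u1 g1 cu cc1). Qed.

Lemma jcont_sol_yy : jcont (msum u c2).
Proof. exact: (jcont_msum decays_u g2 cu cc2). Qed.

Lemma jcont_sol_yt : jcont (msum u' c1).
Proof. exact: (jcont_msum decays_u' g1 cu' cc1). Qed.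

Lemma dec4_mode t : 0 <= t -> dec4 (A * expR (- t)) (u ^~ t).
Proof. by move=> t0 k; exact: (pm_bound H k t0). Qed.

Lemma sol_csum y t : sol y t = w t + csum (u ^~ t) (om * y). Proof. by []. Qed.

Lemma sol_dist y t : 0 <= t -> `|sol y t - w t| <= A * expR (- t) * Zsq.
Proof. by move=> t0; rewrite sol_csum addrC addKr; exact: csum_bound (dec4_mode t0). Qed.

Lemma sol_ratio y t : 0 <= t -> sol y t = w t * (1 + csum (fun k => u k t / w t) (om * y)).
Proof.
move=> t0; rewrite sol_csum mulrDr mulr1; congr (_ + _).
rewrite /csum -ssumZ; last by apply: (@cvg_dom_sq _ _ a) => k; exact: (csum_term k _ (pm_ratio H t0)).
by congr ssum; apply/funext => k; rewrite [RHS]mulrA (mulrCA (w t)) divff ?mulr1// gt_eqF.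
Qed.

Lemma ratio_small y t : 0 <= t -> `|csum (fun k => u k t / w t) y| <= 2^-1.
Proof. by move=> t0; apply: le_trans (csum_bound y (pm_ratio H t0)) (pm_small H). Qed.

Lemma sol_gt0 y t : 0 <= t -> 0 < sol y t.
Proof.
move=> t0; rewrite sol_ratio// mulr_gt0//.
by have := ratio_small (om * y) t0; rewrite ler_norml => /andP[? _]; lra.
Qed.

Lemma sol_0 y : sol y 0 = w 0.
Proof.
rewrite sol_csum /csum (@ssum_single _ _ 0%N) ?(pm_zero H) ?mul0r ?addr0// => k _.
by rewrite (pm_zero H) mul0r.
Qed.

Lemma sol_pow y t : 0 <= t -> sol y t `^ p =
  w t `^ p + pot p b t * csum (u ^~ t) (om * y) +
  w t `^ p * comp p (fun k => u k t / w t) (om * y).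
Proof.
move=> t0; have := ratio_small (om * y) t0; rewrite ler_norml => /andP[r1 r2].
have e := sol_ratio y t0; have E := sol_csum y t; move: e E r1 r2.
rewrite /comp /nl; set X := csum (u ^~ t) _; set r := csum _ _; clearbody X r.
move=> e E r1 r2; rewrite e powRM ?(ltW (w_gt0 t))//; last by lra.
have -> : X = w t * r by move: E; rewrite e => E; lra.
rewrite pot_prof//; set q := (1 + r) `^ p.
have -> : w t `^ p = w t `^ (p - 1) * w t.
  exact: powR_pred.
by move: (w t `^ (p - 1)) (w t) q => P W q; clear; ring.
Qed.

Lemma mode_sum_eq y t : 0 < t ->
  msum u'' c0 y t + msum u c2 y t - msum u c0 y t =
  - pot p b t * msum u c0 y t - w t `^ p * comp p (fun k => u k t / w t) (om * y).
Proof.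
move=> t0; rewrite (comp_inversion_all p (om * y) (pm_small H) (pm_ratio H (ltW t0))).
have cA := cvg_msum (y:=y) dec_u0 g0 t0.
have cB := cvg_msum (y:=y) decays_u'' g0 t0.
have cC := cvg_msum (y:=y) decays_u g2 t0.
set q := (fun k => cc _ k * _).
have W0 : w t `^ p != 0 by rewrite gt_eqF// powR_gt0.
(* The mode equation is solved for the coefficient of the nonlinearity, so that its cosine series
   becomes a combination of three series known to converge. *)
have E k : q k = (w t `^ p)^-1 * ((1 - pot p b t) * (u k t * c0 k y) - (u'' k t * c0 k y + u k t * c2 k y)).
  rewrite /q (pm_eq H k (ltW t0)) /cosn /trig2 -/(c0 k y).
  move: (cc _ k) (u k t) (c0 k y) (pot p b t) (w t `^ p) W0 => C U c P W W0.
  by field.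
have -> : ssum q = (w t `^ p)^-1 * ((1 - pot p b t) * msum u c0 y t - (msum u'' c0 y t + msum u c2 y t)).
  rewrite (funext E) ssumZ; last first.
    by apply: is_cvg_seriesB; [exact: cvg_seriesZ|exact: is_cvg_seriesD].
  rewrite ssumB; [|exact: cvg_seriesZ|exact: is_cvg_seriesD].
  by rewrite ssumZ// ssumD.
by rewrite mulrA divff// mul1r; ring.
Qed.

Lemma sol_pde y t : 0 < t -> - (msum u c2 y t + sol_tt y t) + sol y t = sol y t `^ p.
Proof.
move=> t0; have := mode_sum_eq y t0; rewrite sol_pow ?(ltW t0)// /sol /sol_tt.
have -> : csum (u ^~ t) (om * y) = msum u c0 y t by [].
have -> : w t `^ p = 2 * (p + 1) * zeta p b t * (1 - zeta p b t) * w t.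
  by rewrite -prof_pow//; exact: powR_pred.
set X := msum _ _ _ _; set Y := msum _ _ _ _; set Z := msum _ _ _ _; set Q := comp _ _ _.
move: (zeta p b t) (w t) (pot p b t) X Y Z Q => z W P X Y Z Q; clear => e.
have -> : W + Z = W + Z + (X + Y - Z) - (- P * Z - 2 * (p + 1) * z * (1 - z) * W * Q) by rewrite e; ring.
by ring.
Qed.

End Solution.

(** * The positive solution on the half space *)

Section PositiveSolution.
Variables (R : realType) (N : nat) (j : 'I_(N.-1)).
Variables (p b om : R) (u u' u'' : nat -> R -> R) (A B a : R).
Hypotheses (hp : 1 < p) (hb0 : 0 < b) (hb1 : b < 1) (om0 : 0 < om).
Hypothesis H : periodic_modes p b om u u' u'' A B a.

Definition solution : 'RN[R]_N -> R := pull j (sol p b om u).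

Lemma cont_solution : {within @closed_half_space R N, continuous solution}.
Proof.
have [C0 c0] : continuous (fun t => prof p b t) /\ continuous (fun t : R => Num.max t 0).
  by split; [exact: drv_continuous (drv_prof hp hb0 hb1)|exact: cont_maxr].
(* Extended to negative heights by the boundary values, the sum is continuous on the whole plane;
   continuity up to the boundary then follows by restriction. *)
pose G (z : R * R) := prof p b (Num.max z.2 0) + ssum (fun k => u k (Num.max z.2 0) * cos (k%:R * (om * z.1))).
have m0 (t : R) : 0 <= Num.max t 0 by rewrite le_max lexx orbT.
have cG : continuous G.
  move=> z; apply: cvgD.
    apply: (@cvg_comp _ _ _ snd (fun t => prof p b (Num.max t 0)) _ (nbhs z.2)); first exact: cvg_snd.
    exact: (cont_comp C0 c0 (x:=z.2)).
  apply: (@cont_ssum _ _ (fun k (z : R * R) => u k (Num.max z.2 0) * cos (k%:R * (om * z.1))) (fun k => A * (k.+1%:R ^+ 2)^-1)).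
  - by apply: cvg_seriesZ; exact: cvg_inv_sq.
  - suff h x k : `|u k (Num.max x.2 0) * cos (k%:R * (om * x.1))| <= A / k.+1%:R ^+ 2.
      exact: (@nearW _ (nbhs z) _ _ h).
    apply: le_trans (csum_term _ _ (dec4_mode H (m0 x.2))) _.
    rewrite ler_wpM2r ?invr_ge0 ?exprn_ge0// ler_piMr ?(amplitude_ge0 H)//.
    by rewrite -expR0 ler_expR oppr_le0.
  - move=> k; apply: cvgM.
      apply: (@cvg_comp _ _ _ snd (fun t => u k (Num.max t 0)) _ (nbhs z.2)); first exact: cvg_snd.
      apply: (@cvg_comp _ _ _ (fun t : R => Num.max t 0) (u k) _ (nbhs (Num.max z.2 0))); first exact: c0.
      exact: drv_cont (pm_drv H k (m0 _)).
    apply: (@cvg_comp _ _ _ fst (fun y => cos (k%:R * (om * y))) _ (nbhs z.1)); first exact: cvg_fst.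
    exact: (drv_cont (drv_trig0 om k z.1)).
have cGp : continuous (fun x : 'RN[R]_N => G (x 0 (lshift 1 j), x 0 (rshift N.-1 0))).
  move=> x; apply: (@cvg_comp _ _ _ (fun x : 'RN[R]_N => (x 0 (lshift 1 j), x 0 (rshift N.-1 0))) G _ (nbhs (x 0 (lshift 1 j), x 0 (rshift N.-1 0)))).
    by apply: (@cvg_pair _ _ _ (nbhs x) (nbhs _) (nbhs _) _ _ _ (fun z : 'RN[R]_N => z 0 (lshift 1 j)) (fun z : 'RN[R]_N => z 0 (rshift N.-1 0))); exact: coord_continuous.
  exact: cG.
apply: subspace_eq_continuous (continuous_subspaceT cGp) => x.
rewrite inE /closed_half_space /= /height mxE => x0.
change (G (x 0 (lshift 1 j), x 0 (rshift N.-1 0)) = solution x).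
by rewrite /G /= /solution /pull /tang /height !mxE (max_idPl x0).
Qed.

Lemma solution_vanishes :
  {uniform, (fun (t : R) (x' : 'rV[R]_(N.-1)) => solution (pt x' t)) @ +oo%R --> (fun=> 0 : R)}.
Proof.
have [C [C0 HC]] := prof_ub hp hb0 hb1.
have Z0 : 0 <= Zsq :> R by apply: le_trans Zsq_ge1.
have A0 := amplitude_ge0 H.
pose D := C + A * Zsq; have D0 : 0 < D by rewrite ltr_pwDl// mulr_ge0.
have bound (t : R) x' : 0 <= t -> `|solution (pt x' t)| <= D * expR (- t).
  move=> t0; rewrite /solution /pull tang_pt height_pt.
  rewrite -[X in `|X|](subrK (prof p b t)); apply: le_trans (ler_normD _ _) _.
  rewrite addrC /D mulrDl; apply: lerD; first by rewrite gtr0_norm ?prof_gt0.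
  by apply: le_trans (sol_dist H _ t0) _; rewrite mulrAC.
move=> P /uniform_nbhs [E [entE EP]].
have [e e0 eE] : exists2 e : R, 0 < e & forall y, ball (0 : R) e y -> E (0, y).
  move: entE; rewrite -entourage_ballE => -[e e0 eE]; exists e => // y y0.
  exact: eE.
have : \forall t \near +oo, D * expR (- t) < e /\ 0 <= t.
  near=> t; split; last by near: t; exact: nbhs_pinfty_ge.
  rewrite -ltr_pdivlMl// -[X in _ < X]lnK ?posrE ?mulr_gt0 ?invr_gt0// ltr_expR.
  by rewrite ltrNl; near: t; apply: nbhs_pinfty_gt; rewrite num_real.
rewrite /= /nbhs /=; apply: filterS => t [te t0]; apply: EP => x' _.
apply: eE; rewrite /ball /= sub0r normrN.
exact: le_lt_trans (bound t x' t0) te.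
Unshelve. all: by end_near.
Qed.

Lemma solution_positive : positive_solution p (prof p b 0) solution.
Proof.
pose F := sol p b om u.
have dt y t (t0 : 0 < t) := drv_sol_t hp hb0 hb1 H y t0.
have dtt y t (t0 : 0 < t) := drv_sol_tt hp hb0 hb1 H y t0.
have dy y t (t0 : 0 < t) := drv_sol_y om0 H y t0.
have dyy y t (t0 : 0 < t) := drv_sol_yy om0 H y t0.
have dyt y t (t0 : 0 < t) := drv_sol_yt om0 H y t0.
have dty y t (t0 : 0 < t) := drv_sol_ty om0 H y t0.
have gt0 (x : 'RN[R]_N) : 0 <= height x -> 0 < solution x.
  by move=> x0; exact: (sol_gt0 hp hb0 hb1 H _ x0).
split.
- apply: (C2_pull j dy dt dyy dyt dty dtt).
  + exact: (jcont_sol hp hb0 hb1 H).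
  + exact: (jcont_sol_y om0 H).
  + exact: (jcont_sol_t hp hb0 hb1 H).
  + exact: (jcont_sol_yy om0 H).
  + exact: (jcont_sol_yt om0 H).
  + exact: (jcont_sol_tt hp hb0 hb1 H).
- exact: cont_solution.
- exact: gt0.
- move=> x x0; have v0 := gt0 x (ltW x0).
  rewrite /solution (laplacian_pull j dy dt dyy dyt dty dtt)//.
  rewrite -/solution (gtr0_norm v0) -powR_pred//.
  exact: (sol_pde hp hb0 hb1 om0 H).
- by move=> x x0; rewrite /solution /pull x0; exact: (sol_0 H).
- exact: solution_vanishes.
Qed.

End PositiveSolution.

(* Each new object is chosen so close to [W] that its range cannot contain
   two points of the range of any earlier one. *)
Lemma ex_distinct_ranges (R : realType) (T : Type) (P : T -> Prop) (S : T -> set R) (W : R) :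
  (forall d, 0 < d -> exists v, [/\ P v, forall y, S v y -> `|y - W| <= d &
     exists y z, [/\ S v y, S v z & y != z]]) ->
  exists v : nat -> T, (forall n, P (v n)) /\ forall i j, (i < j)%N -> S (v i) <> S (v j).
Proof.
move=> HS.
have [v0 _] := HS 1 ltr01.
have : forall d : R, exists t : T * (R * R), 0 < d ->
    [/\ P t.1, forall y, S t.1 y -> `|y - W| <= d, S t.1 t.2.1, S t.1 t.2.2 & t.2.1 != t.2.2].
  move=> d; have [d0|_] := ltP 0 d; last by exists (v0, (0, 0)).
  by have [v [Pv Sv [y [z [Sy Sz yz]]]]] := HS d d0; exists (v, (y, z)).
move=> /choice[t Ht].
(* Two chosen values of the i-th range are 4 d_(i+1) apart, while any two values of a later range
   are at most 2 d_(i+1) apart. *)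
pose gap d := `|(t d).2.1 - (t d).2.2| / 4.
have gap_gt0 d : 0 < d -> 0 < gap d.
  by move=> /Ht[_ _ _ _ yz]; rewrite divr_gt0// normr_gt0 subr_eq0.
pose d n := iter n gap 1.
have d0 n : 0 < d n by elim: n => [|n IH]; [exact: ltr01|exact: gap_gt0].
have close e (y z : R) : `|y - W| <= e -> `|z - W| <= e -> `|y - z| <= 2 * e.
  move=> ye ze; have -> : y - z = (y - W) - (z - W) by ring.
  by apply: le_trans (ler_normB _ _) _; lra.
have dS n : d n.+1 <= d n.
  have [_ h Sy Sz _] := Ht _ (d0 n); have := close _ _ _ (h _ Sy) (h _ Sz).
  by have := d0 n; rewrite /= -/(d n) /gap; lra.
exists (fun n => (t (d n)).1); split=> [n|i j ij E]; first by have [] := Ht _ (d0 n).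
have [_ _ Sy Sz _] := Ht _ (d0 i); rewrite E in Sy Sz.
have [_ h _ _ _] := Ht _ (d0 j).
have dij : d j <= d i.+1 by apply: (homo_leq (r := fun x y : R => y <= x)) ij => // x y z yx zy; exact: le_trans zy yx.
have := close _ _ _ (h _ Sy) (h _ Sz); have := d0 i.+1.
by move: dij; rewrite /= -/(d i) /gap; lra.
Qed.

(** * Ranges at a fixed height as invariants of orbits, and the conclusion *)

Lemma same_orbit_range (R : realType) (N : nat) (v w : 'RN[R]_N -> R) (t : R) : 0 <= t ->
  same_orbit v w -> range (fun x' => w (pt x' t)) = range (fun x' => v (pt x' t)).
Proof.
move=> t0 [A [b [[AA _] vw]]].
have {}vw x' : w (pt x' t) = v (pt (x' *m A + b) t).
  by rewrite vw ?tang_pt ?height_pt// /closed_half_space /= height_pt.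
apply/seteqP; split=> y [x' _ <-]; first by exists (x' *m A + b).
exists ((x' - b) *m A^T) => //.
by rewrite vw -mulmxA (mulmx1C AA) mulmx1 subrK.
Qed.

Lemma ex_solution_near (R : realType) (N : nat) (j : 'I_(N.-1)) (p c : R) :
  1 < p -> 0 < c -> c < critical_height p ->
  exists T W : R, 0 < T /\ forall d, 0 < d -> exists v : 'RN[R]_N -> R,
    [/\ positive_solution p c v, forall x', `|v (pt x' T) - W| <= d &
        exists x' z', v (pt x' T) != v (pt z' T)].
Proof.
move=> hp hc0 hc; have [b [hb0 [hb1 pc]]] := ex_prof hp hc0 hc.
have [T T0 HT] := ex_periodic_modes hp hb0 hb1.
exists T, (prof p b T); split=> // d /HT[om [u [u' [u'' [A [B [a [om0 H Ad osc]]]]]]]].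
exists (solution j p b om u); split.
- by rewrite -pc; exact: (solution_positive j hp hb0 hb1 om0 H).
- move=> x'; rewrite /solution /pull tang_pt height_pt.
  apply: le_trans (sol_dist H _ (ltW T0)) _; apply: le_trans _ Ad.
  rewrite ler_wpM2r//; first by apply: le_trans Zsq_ge1.
  by rewrite ler_piMr ?(amplitude_ge0 H)// -expR0 ler_expR oppr_le0 ltW.
- exists 0, (const_mx (pi / om)); rewrite /solution /pull !tang_pt !height_pt !mxE !sol_csum.
  rewrite mulr0 mulrCA divff ?mulr1 ?(gt_eqF om0)//; apply/eqP => /addrI; exact: osc.
Qed.

Theorem corollary1p4 (R : realType) (N M : nat) (p c : R)
    (hN : (3 <= N)%N) (hM : (3 <= M <= N)%N)
    (hp1 : 1 < p) (hpM : p < (M%:R + 2) / (M%:R - 2))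
    (hc0 : 0 < c) (hc : c < critical_height p) :
  exists v : 'I_M.+1 -> ('RN[R]_N -> R),
    (forall k, positive_solution p c (v k)) /\
    (forall j k, j != k -> geometrically_distinct (v j) (v k)).
Proof.
have N1 : (0 < N.-1)%N by rewrite -ltnS prednK ?(ltn_trans _ hN)// (ltn_trans _ hN).
have [T [W [T0 HT]]] := ex_solution_near (Ordinal N1) hp1 hc0 hc.
have [|v [Pv Dv]] := @ex_distinct_ranges R ('RN[R]_N -> R) (positive_solution p c)
    (fun v => range (fun x' => v (pt x' T))) W.
  move=> d /HT[v [Pv vd [x' [z' xz]]]]; exists v; split=> //; first by move=> y [x _ <-].
  by exists (v (pt x' T)), (v (pt z' T)); split.
exists (fun k => v k); split=> [k|j k jk orb]; first exact: Pv.
have E := same_orbit_range (ltW T0) orb.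
by case: (ltngtP j k) jk => [/Dv h _|/Dv h _|/val_inj -> /eqP]; [exact/h/esym|exact/h|].
Qed.
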